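(* Let $R$ be a commutative Noetherian ring, $(X,\check X,\Phi,\check\Phi,\Pi)$ a reduced based root system, $H=H_{\mathbf a,\mathbf b}$ the associated generic affine Hecke algebra over $R[\mathbf a,\mathbf b]$, $\mathscr A$ the affine Coxeter complex of dimension $d=\mathrm{rk}(\mathbb Z[\Phi])$, and $\underline{\underline H}$ the coefficient system on $\mathscr A$ assigning $H$ to each facet, with transition maps $r^F_{F'}:h\mapsto T_{d_{F'}^{-1}d_F}h$ for $F'\subseteq\overline F$. Consider the augmented oriented chain complex of right $H$-modules $$0\to C_c^{or}(\mathscr A_{(d)},\underline{\underline H})\xrightarrow{\partial}\cdots\xrightarrow{\partial}C_c^{or}(\mathscr A_{(0)},\underline{\underline H})\xrightarrow{\boldsymbol{\alpha}}H\to0,\qquad \boldsymbol{\alpha}((h_x)_x)=\sum_xT_{d_x}h_x .$$ For $i\ge0$ let $\mathscr F_i$ be a (finite) set of $i$-dimensional facets contained in $\overline C$ representing the $W$-orbits of $i$-dimensional facets. Then each $C_c^{or}(\mathscr A_{(i)},\underline{\underline H})$ carries the structure of an $H$-bimodule such that: (1) it extends its natural structure of right $H$-module; (2) $C_c^{or}(\mathscr A_{(i)},\underline{\underline H})\cong\bigoplus_{F\in\mathscr F_i}H(j_F)\otimes_{H_F}H$ (as $H$-bimodules); (3) the maps $\partial$ and $\boldsymbol{\alpha}$ are $H$-biequivariant.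
   Context: Root system. $X,\check X$ are free abelian groups of finite rank with a perfect pairing $\langle -,-\rangle:X\times\check X\to\mathbb Z$; $\Phi\subset X$ and $\check\Phi\subset\check X$ are the finite sets of roots and coroots, with bijection $\alpha\leftrightarrow\check\alpha$, $\langle\alpha,\check\alpha\rangle=2$, the reflections $s_\alpha:x\mapsto x-\langle x,\check\alpha\rangle\alpha$ and $s_{\check\alpha}:\check x\mapsto \check x-\langle\alpha,\check x\rangle\check\alpha$ preserving $\Phi$ and $\check\Phi$; the root system is reduced; $\Pi\subset\Phi$ is a base, giving $\Phi^+,\Phi^-$. The finite Weyl group $W_0$ is generated by the $s_\alpha$ and $W=W_0\ltimes\check X$. The affine roots are $\Phi_{\rm aff}=\Phi\times\mathbb Z=\Phi_{\rm aff}^+\sqcup\Phi_{\rm aff}^-$ with $\Phi_{\rm aff}^+=\{(\alpha,r):r>0\}\cup\{(\alpha,0):\alpha\in\Phi^+\}$; $w_0\check x\in W$ acts by $(\alpha,r)\mapsto(w_0\alpha,r-\langle\alpha,\check x\rangle)$. The length $\ell(w)$ is the number of $A\in\Phi_{\rm aff}^+$ with $w(A)\in\Phi_{\rm aff}^-$. For $A=(\alpha,r)$ let $s_A\in W$ be the affine reflection $v\mapsto v-(\langle\alpha,v\rangle+r)\check\alpha$ ($\check X$ acting by translations). Order $\Phi$ by $\alpha\preceq\beta$ iff $\beta-\alpha$ is a nonnegative integral combination of $\Pi$, let $\Pi_m$ be the set of minimal roots, $\Pi_{\rm aff}=\{(\alpha,0):\alpha\in\Pi\}\cup\{(\alpha,1):\alpha\in\Pi_m\}$,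 $S_{\rm aff}=\{s_A:A\in\Pi_{\rm aff}\}$, $W_{\rm aff}=\langle s_A:A\in\Phi_{\rm aff}\rangle$, $\Omega=\{w\in W:\ell(w)=0\}$. Hecke algebra. $H=H_{\mathbf a,\mathbf b}$ is the $R[\mathbf a,\mathbf b]$-algebra free as a module with basis $\{T_w\}_{w\in W}$ and relations $T_vT_w=T_{vw}$ if $\ell(vw)=\ell(v)+\ell(w)$, and $(T_s-\mathbf a)(T_s-\mathbf b)=0$ for $s\in S_{\rm aff}$. Coxeter complex. Let $Q^\perp=\{\check x\in\check X:\langle\alpha,\check x\rangle=0\ \forall\alpha\in\Phi\}$. $\mathscr A$ is the polysimplicial complex given by the hyperplane arrangement $\{\langle\alpha,v\rangle+r=0\}$, $(\alpha,r)\in\Phi_{\rm aff}$, on $(\check X\otimes\mathbb R)/(Q^\perp\otimes\mathbb R)$; $W$ acts on it. $C$ is the chamber on which all positive affine roots are positive. $W_{\rm aff}$ acts simply transitively on chambers. For a facet $F$ there is a unique chamber $C(F)$ at closest gallery distance to $C$ containing $F$ in its closure; $d_F\in W_{\rm aff}$ is the unique element with $C(F)=d_FC$. Chains. $\mathscr A_i$ (resp. $\mathscr A_{(i)}$) is the set of facets (resp. oriented facets $(F,c)$) of dimension $i$. A facet of dimension $\ge1$ has two orientations (orientations of its affine span) $(F,\pm c)$; vertices carry only the trivial orientation. An orientation of $F$ induces, by the usual boundary rule, one on each codimension one face, with $-c$ inducing the opposite one. $C_c^{or}(\mathscr A_{(i)},\underline{\underline H})$ is the set of finitely supported maps $\gamma:\mathscr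 A_{(i)}\to H$ with $\gamma(F,-c)=-\gamma(F,c)$ if $i\ge1$. For $i\ge1$, $(\partial\gamma)(F',c')=\sum_{F\in\mathscr A_i,\,F'\subseteq\overline F}r^F_{F'}(\gamma(F,c_{(F',c')}))$, where $c_{(F',c')}$ is the orientation of $F$ inducing $(F',c')$ on $F'$ (when $F'$ is a vertex of an edge $F$, it is the orientation of $F$ pointing towards $F'$). Finite Hecke algebras. For a facet $F\subseteq\overline C$: $S_F\subset S_{\rm aff}$ is the set of $s$ fixing $F$ pointwise, $W_F^0=\langle S_F\rangle$, $\Omega_F\subset\Omega$ is the stabilizer of $F$, $W_F\subset W$ is the subgroup generated by $W_F^0$ and $\Omega_F$ (equal to $\{w\in W:wF=F\}$), and $H_F\subset H$ is the subalgebra with $R[\mathbf a,\mathbf b]$-basis $\{T_w\}_{w\in W_F}$. For $w\in W_F$, $\epsilon_F(w)=+1$ (resp. $-1$) if $w$ preserves (resp. reverses) a given orientation of $F$; $j_F$ is the involutive automorphism $T_w\mapsto\epsilon_F(w)T_w$ of $H_F$. $H(j_F)$ is $H$ as a right $H_F$-module with action twisted by $j_F$ (left $H$-action unchanged). *)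

(* Defs.v *)
From HB Require Import structures.
From mathcomp Require Import all_boot all_order all_algebra finmap.
From mathcomp Require Import generic_quotient ring_quotient.
From mathcomp Require Import all_classical all_reals.
From mathcomp Require Import topology normedtype.
From mathcomp.multinomials Require Import freeg.
From mathcomp Require Import zify lra.

Set Implicit Arguments.
Unset Strict Implicit.
Unset Printing Implicit Defensive.

Import Order.TTheory GRing.Theory Num.Theory numFieldNormedType.Exports.

Local Open Scope classical_set_scope.
Local Open Scope ring_scope.

Definition noetherian (R : comNzRingType) : Prop :=
  forall I : set R,
    I 0 -> (forall x y, I x -> I y -> I (x + y)) ->
    (forall a x, I x -> I (a * x)) ->
    exists (k : nat) (g : 'I_k -> R),
      forall x, I x <-> exists c : 'I_k -> R, x = \sum_i c i * g i.

Definition is_subgroup (G : groupType) (S : set G) : Prop :=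
  [/\ S 1%g, forall x y, S x -> S y -> S (x * y)%g & forall x, S x -> S x^-1%g].

Definition gen_subgroup (G : groupType) (S : set G) : set G :=
  [set x | forall P : set G, is_subgroup P -> S `<=` P -> P x].

(* The lattices are X = Z^n (rows) and its dual Xc = Z^n (columns), in dual   *)
(* bases, so that the perfect pairing is the product of a row and a column.   *)
Definition pairing n (x : 'rV[int]_n) (y : 'cV[int]_n) : int := (x *m y) 0 0.

Definition nneg_comb n (B : {fset 'rV[int]_n}) (x : 'rV[int]_n) : Prop :=
  exists c : 'rV[int]_n -> nat, x = \sum_(b <- B) b *+ c b.

Record root_system (n : nat) := RootSystem {
  Phi : {fset 'rV[int]_n};
  Phic : {fset 'cV[int]_n};
  coroot : 'rV[int]_n -> 'cV[int]_n;
  Pi : {fset 'rV[int]_n};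
  coroot_bij : set_bij [set` Phi] [set` Phic] coroot;
  pairing_coroot : forall a, a \in Phi -> pairing a (coroot a) = 2;
  refl_root : forall a b, a \in Phi -> b \in Phi ->
    b - pairing b (coroot a) *: a \in Phi;
  refl_coroot : forall a y, a \in Phi -> y \in Phic ->
    y - pairing a y *: coroot a \in Phic;
  root_reduced : forall a b, a \in Phi -> b \in Phi ->
    forall k l : int, k != 0 -> k *: b = l *: a -> b = a \/ b = - a;
  base_root : forall b, b \in Pi -> b \in Phi;
  base_free : forall c : 'rV[int]_n -> int,
    \sum_(b <- Pi) c b *: b = 0 -> forall b, b \in Pi -> c b = 0;
  base_span : forall a, a \in Phi -> nneg_comb Pi a \/ nneg_comb Pi (- a) }.

Section AffineWeylGroup.
Context (n : nat) (D : root_system n).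

(* s_a as a matrix: y |-> refl a *m y on Xc, and x |-> x *m refl a on X. *)
Definition refl (a : 'rV[int]_n) : 'M[int]_n := 1%:M - coroot D a *m a.

(* The s_a are involutions, so the group they generate consists of products. *)
Definition in_W0 (g : 'M[int]_n) : Prop :=
  exists s : seq 'rV[int]_n,
    {subset s <= Phi D} /\ g = foldr (fun a h => refl a *m h) 1%:M s.

(* ExtW g x _ is the element g x of W = W0 |>< Xc, which acts on Xc by        *)
(* v |-> g (v + x).                                                           *)
Record extW := ExtW {
  wlin : 'M[int]_n;
  wtrans : 'cV[int]_n;
  wlinP : `[< in_W0 wlin >] }.

Definition extW_val (w : extW) : 'M[int]_n * 'cV[int]_n := (wlin w, wtrans w).

Definition extW_pred (p : 'M[int]_n * 'cV[int]_n) : bool := `[< in_W0 p.1 >].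

Definition extW_sub p (Hp : extW_pred p) : extW := ExtW p.2 Hp.

Fact extW_rect (P : extW -> Type) :
  (forall p Hp, P (@extW_sub p Hp)) -> forall w, P w.
Proof. by move=> HP [g x gW]; exact: (HP (g, x) gW). Qed.

Fact extW_subK p Hp : extW_val (@extW_sub p Hp) = p.
Proof. by case: p Hp. Qed.

HB.instance Definition _ := isSub.Build _ extW_pred extW extW_rect extW_subK.
HB.instance Definition _ := [Choice of extW by <:].

Lemma extW_eq (v w : extW) : wlin v = wlin w -> wtrans v = wtrans w -> v = w.
Proof. by move=> e1 e2; apply: val_inj; rewrite /= /extW_val e1 e2. Qed.

Lemma refl_invol a : a \in Phi D -> refl a *m refl a = 1%:M.
Proof.
move=> aP; have XX : coroot D a *m a *m (coroot D a *m a) = coroot D a *m a *+ 2.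
  have aac : a *m coroot D a = 2%:M.
    by apply/matrixP => i j; rewrite !ord1 [RHS]mxE eqxx; exact: pairing_coroot.
  rewrite -mulmxA [a *m (_ *m a)]mulmxA aac mul_scalar_mx -scalemxAr.
  by rewrite scaler_nat.
by rewrite /refl mulmxBl mul1mx mulmxBr mulmx1 XX opprB mulr2n addrK subrK.
Qed.

Lemma in_W0_1 : in_W0 1%:M.
Proof. by exists [::]. Qed.

Lemma in_W0_mul g h : in_W0 g -> in_W0 h -> in_W0 (g *m h).
Proof.
move=> [s [sP ->]] [t [tP ->]]; exists (s ++ t); split.
  by move=> a; rewrite mem_cat => /orP[/sP|/tP].
by elim: s {sP} => [|a s IHs] /=; rewrite ?mul1mx// -mulmxA IHs.
Qed.

Lemma in_W0_refl a : a \in Phi D -> in_W0 (refl a).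
Proof.
move=> aP; exists [:: a]; rewrite /= mulmx1; split=> // b.
by rewrite inE => /eqP->.
Qed.

Lemma in_W0_inv g : in_W0 g -> exists2 h, in_W0 h & h *m g = 1%:M.
Proof.
move=> [s [sP ->]]; elim: s sP => [|a s IHs] sP /=.
  by exists 1%:M; [exact: in_W0_1|rewrite mulmx1].
have aP : a \in Phi D by rewrite sP ?mem_head.
have [|h hW hs] := IHs; first by move=> b bs; rewrite sP// in_cons bs orbT.
exists (h *m refl a); first exact/in_W0_mul/in_W0_refl.
by rewrite -mulmxA [refl a *m _]mulmxA refl_invol// mul1mx.
Qed.

Lemma wlin_unit (w : extW) : wlin w \in unitmx.
Proof.
have /asboolP/in_W0_inv[h _ hg] := wlinP w.
by have /mulmx1_unit[] := hg.
Qed.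

Lemma extW_invP (w : extW) : `[< in_W0 (invmx (wlin w)) >].
Proof.
apply/asboolP; have /asboolP/in_W0_inv[h hW hg] := wlinP w.
by rewrite -[invmx _]mul1mx -hg -mulmxA mulmxV ?mulmx1// wlin_unit.
Qed.

Lemma extW_mulP (v w : extW) : `[< in_W0 (wlin v *m wlin w) >].
Proof. by apply/asboolP/in_W0_mul; apply/asboolP/wlinP. Qed.

Definition extW_one : extW := ExtW 0 (asboolT in_W0_1).
Definition extW_inv (w : extW) : extW :=
  ExtW (- (wlin w *m wtrans w)) (extW_invP w).
Definition extW_mul (v w : extW) : extW :=
  ExtW (invmx (wlin w) *m wtrans v + wtrans w) (extW_mulP v w).

Fact invmxM (g h : 'M[int]_n) :
  g \in unitmx -> h \in unitmx -> invmx (g *m h) = invmx h *m invmx g.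
Proof.
move=> gU hU; have ghU : g *m h \in unitmx by rewrite unitmx_mul gU.
apply: (can_inj (mulKmx ghU)); rewrite mulmxV// -mulmxA mulKVmx//.
by rewrite mulmxV.
Qed.

Fact extW_mulA : associative extW_mul.
Proof.
move=> u v w; apply: extW_eq => /=; first by rewrite mulmxA.
by rewrite mulmxDr mulmxA addrA invmxM ?wlin_unit.
Qed.

Fact extW_mul1 : left_id extW_one extW_mul.
Proof. by move=> w; apply: extW_eq; rewrite /= ?mul1mx// mulmx0 add0r. Qed.

Fact extW_mulr1 : right_id extW_one extW_mul.
Proof. by move=> w; apply: extW_eq; rewrite /= ?mulmx1// invmx1 mul1mx addr0. Qed.

Fact extW_mulV : left_inverse extW_one extW_inv extW_mul.
Proof.
move=> w; apply: extW_eq; rewrite /= ?mulVmx ?wlin_unit//.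
by rewrite mulmxN mulKmx ?wlin_unit// addNr.
Qed.

Fact extW_mulrV : right_inverse extW_one extW_inv extW_mul.
Proof.
move=> w; apply: extW_eq; rewrite /= ?mulmxV ?wlin_unit//.
by rewrite invmxK subrr.
Qed.

HB.instance Definition _ := isGroup.Build extW
  extW_mulA extW_mul1 extW_mulr1 extW_mulV extW_mulrV.

(* An affine root (a, r) is the affine function v |-> <a, v> + r.             *)
Definition affine_root (A : 'rV[int]_n * int) : Prop := A.1 \in Phi D.

Definition aff_pos (A : 'rV[int]_n * int) : Prop :=
  affine_root A /\ (0 < A.2 \/ A.2 = 0 /\ nneg_comb (Pi D) A.1).

Definition aff_neg (A : 'rV[int]_n * int) : Prop :=
  affine_root A /\ ~ aff_pos A.

Definition wact_root (w : extW) (A : 'rV[int]_n * int) : 'rV[int]_n * int :=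
  (A.1 *m invmx (wlin w), A.2 - pairing A.1 (wtrans w)).

Definition wlength (w : extW) : nat :=
  #|` fset_set [set A | aff_pos A /\ aff_neg (wact_root w A)] |%fset.

(* v |-> v - (<a, v> + r) a^v = refl a (v + r a^v). *)
Definition is_aff_refl (A : 'rV[int]_n * int) (w : extW) : Prop :=
  wlin w = refl A.1 /\ wtrans w = A.2 *: coroot D A.1.

Definition root_le (a b : 'rV[int]_n) : Prop := nneg_comb (Pi D) (b - a).

Definition minimal_root (a : 'rV[int]_n) : Prop :=
  a \in Phi D /\ forall b, b \in Phi D -> root_le b a -> b = a.

Definition simple_aff (A : 'rV[int]_n * int) : Prop :=
  A.1 \in Pi D /\ A.2 = 0 \/ minimal_root A.1 /\ A.2 = 1.

Definition S_aff : set extW := [set s | exists2 A, simple_aff A & is_aff_refl A s].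

Definition W_aff : set extW :=
  gen_subgroup [set s | exists2 A, affine_root A & is_aff_refl A s].

Definition Omega : set extW := [set w | wlength w = 0%N].

End AffineWeylGroup.

Definition Qperp n (D : root_system n) : set 'cV[int]_n :=
  [set y | forall a, a \in Phi D -> pairing a y = 0].

(* Coordinates on the quotient of Xc (x) R by Q^perp (x) R: a surjective      *)
(* linear map whose kernel is the real span of Q^perp.                        *)
Record apartment (K : realType) n (D : root_system n) := Apartment {
  adim : nat;
  aproj : 'M[K]_(adim, n);
  aproj_surj : forall v : 'cV[K]_adim, exists x : 'cV[K]_n, aproj *m x = v;
  aproj_ker : forall x : 'cV[K]_n, aproj *m x = 0 <->
    exists (k : nat) (t : 'I_k -> K) (y : 'I_k -> 'cV[int]_n),
      (forall i, Qperp D (y i)) /\ x = \sum_i t i *: map_mx intr (y i) }.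

Section CoxeterComplex.
Context (K : realType) (n : nat) (D : root_system n) (P : apartment K D).

Local Notation V := 'cV[K]_(adim P).
Local Notation W := (extW D).

(* pinvmx (aproj P) is a section of aproj P; what follows does not depend on  *)
(* its choice, roots and W acting compatibly with the quotient.               *)
Definition alift (v : V) : 'cV[K]_n := pinvmx (aproj P) *m v.

Definition aff_val (A : 'rV[int]_n * int) (v : V) : K :=
  (map_mx intr A.1 *m alift v) 0 0 + A.2%:~R.

Definition wact_lin (w : W) (v : V) : V :=
  aproj P *m (map_mx intr (wlin w) *m alift v).

Definition wact (w : W) (v : V) : V :=
  aproj P *m (map_mx intr (wlin w) *m (alift v + map_mx intr (wtrans w))).

Definition facet_of (v : V) : set V :=
  [set u | forall A, affine_root D A ->
             Num.sg (aff_val A u) = Num.sg (aff_val A v)].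

Record facet := Facet {
  fpts :> set V;
  fptsP : `[< exists v, fpts = facet_of v >] }.

HB.instance Definition _ := [isSub for fpts].
HB.instance Definition _ := [Choice of facet by <:].

Definition is_direction (F : set V) (U : {vspace V}) : Prop :=
  (forall u v, F u -> F v -> u - v \in U) /\
  forall U' : {vspace V}, (forall u v, F u -> F v -> u - v \in U') -> (U <= U')%VS.

(* The direction of the affine span. *)
Definition direction (F : set V) : {vspace V} := xget 0%VS (is_direction F).

Definition fdim (F : set V) : nat := \dim (direction F).

Definition is_face (F' F : set V) : Prop := F' `<=` closure F.

Definition is_chamber (F : facet) : Prop :=
  forall A v, affine_root D A -> fpts F v -> aff_val A v != 0.

Definition base_chamber : set V :=
  [set v | forall A, aff_pos D A -> 0 < aff_val A v].

Definition adjacent (E F : facet) : Prop :=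
  [/\ is_chamber E, is_chamber F, E <> F &
      exists G : facet, [/\ is_face G E, is_face G F & (fdim G).+1 = fdim E]].

Definition gallery (E F : facet) (k : nat) : Prop :=
  exists s : seq facet,
    [/\ size s = k, path (fun E F => `[< adjacent E F >]) E s & last E s = F].

Definition closest_chamber (F : facet) (E : facet) : Prop :=
  exists C : facet, fpts C = base_chamber /\
  [/\ is_chamber E, is_face F E & exists2 k, gallery C E k &
     forall E' k', is_chamber E' -> is_face F E' -> gallery C E' k' -> (k <= k')%N].

Definition d_ (F : facet) : W :=
  xget 1%g [set w | W_aff w /\
    exists2 E, closest_chamber F E & fpts E = wact w @` base_chamber].

Definition S_of (F : set V) : set W :=
  [set s | S_aff s /\ forall v, F v -> wact s v = v].
Definition W0_of (F : set V) : set W := gen_subgroup (S_of F).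
Definition Omega_of (F : set V) : set W :=
  [set w | Omega w /\ wact w @` F = F].
Definition W_of (F : set V) : set W := gen_subgroup (W0_of F `|` Omega_of F).

(* An orientation of the direction U, dim U = i, is encoded as a function on  *)
(* i-tuples: 1 on the positively and -1 on the negatively oriented bases of U *)
(* and 0 on the other tuples. For i = 0 there is only one, with value 1.      *)
Definition orient_of (U : {vspace V}) i (X : i.-tuple V) (Y : i.-tuple V) : int :=
  if all (fun v => v \in U) Y
  then sgz (\det (\matrix_(j, k) coord X k (tnth Y j))) else 0.

Definition is_orientation (U : {vspace V}) i (c : i.-tuple V -> int) : Prop :=
  exists2 X : i.-tuple V, basis_of U X & c = orient_of U X.

Record ofacet (i : nat) := OFacet {
  ofac :> facet;
  oori : i.-tuple V -> int;
  ofacetP : `[< fdim ofac = i /\ is_orientation (direction ofac) oori >] }.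

Definition ofacet_val i (o : ofacet i) : facet * (i.-tuple V -> int) :=
  (ofac o, oori o).

Definition ofacet_pred i (p : facet * (i.-tuple V -> int)) : bool :=
  `[< fdim p.1 = i /\ is_orientation (direction p.1) p.2 >].

Definition ofacet_sub i p (Hp : @ofacet_pred i p) : ofacet i := OFacet Hp.

Fact ofacet_rect i (Q : ofacet i -> Type) :
  (forall p Hp, Q (@ofacet_sub i p Hp)) -> forall o, Q o.
Proof. by move=> HQ [F c oP]; exact: (HQ (F, c) oP). Qed.

Fact ofacet_subK i p Hp : ofacet_val (@ofacet_sub i p Hp) = p.
Proof. by case: p Hp. Qed.

HB.instance Definition _ i :=
  isSub.Build _ (@ofacet_pred i) (ofacet i) (@ofacet_rect i) (@ofacet_subK i).
HB.instance Definition _ i := [Choice of ofacet i by <:].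

(* The orientation induced on a codimension one face: outward vector first.   *)
(* The vectors from F to F' point outwards, and towards F' if F' is a vertex. *)
Definition induces i (o : ofacet i.+1) (o' : ofacet i) : Prop :=
  forall (u u' : V) (Y : i.-tuple V), fpts o u -> fpts o' u' ->
    all (fun v => v \in direction o') Y ->
    oori o' Y = oori o [tuple of u' - u :: Y].

Definition preserves_orientation (F : set V) (w : W) : Prop :=
  forall c : (fdim F).-tuple V -> int, is_orientation (direction F) c ->
    forall Y, c (map_tuple (wact_lin w) Y) = c Y.

Definition eps (F : set V) (w : W) : int :=
  if `[< preserves_orientation F w >] then 1 else -1.

Definition orbit_reps (i : nat) (Fs : {fset facet}) : Prop :=
  (forall F, F \in Fs -> fdim F = i /\ is_face F base_chamber) /\
  (forall F : facet, fdim F = i ->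
     exists! F' : facet, F' \in Fs /\ exists w, fpts F' = wact w @` F).

End CoxeterComplex.

Section HeckeAlgebra.
Context (R : comNzRingType) (n : nat) (D : root_system n).
Local Notation W := (extW D).
Local Notation Rab := {poly {poly R}}.

Definition par_a : Rab := 'X%:P.
Definition par_b : Rab := 'X.

Context (H : algType Rab) (T : W -> H).

Definition expansion (h : H) (c : W -> Rab) : Prop :=
  finite_set [set w | c w != 0] /\ h = \sum_(w \in [set: W]) c w *: T w.

Record generic_hecke : Prop := GenericHecke {
  hecke_basis : forall h, exists! c, expansion h c;
  hecke_mul : forall v w : W,
    wlength (v * w)%g = (wlength v + wlength w)%N -> T v * T w = T (v * w)%g;
  hecke_quad : forall s, S_aff s -> (T s - par_a%:A) * (T s - par_b%:A) = 0 }.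

Definition hcoef (h : H) : W -> Rab := xget (fun=> 0) (expansion h).

Context (K : realType) (P : apartment K D).

Definition H_of (F : set 'cV[K]_(adim P)) : set H :=
  [set h | exists2 c, expansion h c & forall w, c w != 0 -> W_of F w].

(* The value outside H_F is irrelevant. *)
Definition j_of (F : set 'cV[K]_(adim P)) (h : H) : H :=
  \sum_(w \in W_of F) (hcoef h w *~ eps F w) *: T w.

End HeckeAlgebra.

Section Chains.
Context (K : realType) (n : nat) (D : root_system n) (P : apartment K D).

Section ChainGroup.
Context (H : nzRingType) (i : nat).

Definition is_chain (c : ofacet P i -> H) : Prop :=
  finite_set [set o | c o != 0] /\
  ((0 < i)%N -> forall o o' : ofacet P i,
     ofac o' = ofac o -> (forall Y, oori o' Y = - oori o Y) -> c o' = - c o).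

Definition chain_pred : {pred ofacet P i -> H} := fun c => `[< is_chain c >].

Fact chain_zmod_closed : zmod_closed chain_pred.
Proof.
split=> [|c c' /asboolP[cf co] /asboolP[cf' co']]; apply/asboolP; split=> //.
- by apply: (sub_finite_set _ (@finite_set0 _)) => o /=; rewrite eqxx.
- by move=> _ o o' _ _ /=; rewrite oppr0.
- apply: (@sub_finite_set _ _ ([set o | c o != 0] `|` [set o | c' o != 0])).
    move=> o /=; rewrite !fctE.
    have [->|cn0] := eqVneq (c o) 0; last by left.
    by rewrite sub0r oppr_eq0; right.
  by rewrite finite_setU.
- move=> i0 o o' e1 e2; rewrite !fctE.
  by rewrite (co i0 o o')// (co' i0 o o')// opprD.
Qed.

HB.instance Definition _ :=
  GRing.isZmodClosed.Build (ofacet P i -> H) chain_pred chain_zmod_closed.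

Record chain := Chain {
  chain_val :> ofacet P i -> H;
  chainP : chain_val \in chain_pred }.

HB.instance Definition _ := [isSub for chain_val].
HB.instance Definition _ := [Choice of chain by <:].
HB.instance Definition _ := [SubChoice_isSubZmodule of chain by <:].

Fact chain_ractP (c : chain) (h : H) : (fun o => c o * h) \in chain_pred.
Proof.
case: c => c /= /asboolP[cf co]; apply/asboolP; split.
  apply: (sub_finite_set _ cf) => o /=; apply: contra_neq => ->.
  by rewrite mul0r.
by move=> i0 o o' e1 e2; rewrite (co i0 o o')// mulNr.
Qed.

Definition chain_ract (c : chain) (h : H) : chain := Chain (chain_ractP c h).

End ChainGroup.
End Chains.

Section BoundaryLemmas.
Context (K : realType) (n : nat) (D : root_system n) (P : apartment K D).
Local Notation V := 'cV[K]_(adim P).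

Lemma aff_val_continuous A : continuous (@aff_val K n D P A).
Proof.
have -> : @aff_val K n D P A = fun v : V =>
    (\sum_j (map_mx intr A.1 *m pinvmx (aproj P)) 0 j * v j 0) + A.2%:~R.
  by apply/funext => v; rewrite /aff_val /alift mulmxA mxE.
have h : continuous (fun v : V =>
    \sum_j (map_mx intr A.1 *m pinvmx (aproj P)) 0 j * v j 0).
  apply: continuous_big; first exact: add_continuous.
  move=> j _ v.
  apply: (@cvgM K _ (nbhs v) _ (fun=> _) (fun w : V => w j 0)).
    exact: cvg_cst.
  exact: coord_continuous.
move=> v; apply: (@cvgD K K _ (nbhs v) _ _ (fun=> _) _ _ (h v)).
exact: cvg_cst.
Qed.

Lemma aff_val_shift a r (v : V) : aff_val (a, r) v = aff_val (a, 0) v + r%:~R.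
Proof. by rewrite /aff_val /= addr0. Qed.

Lemma face_aff_ge0 (F' F : set V) A u :
  is_face F' F -> (forall v, F v -> 0 <= aff_val A v) -> F' u -> 0 <= aff_val A u.
Proof.
move=> FF' F0 /FF' uF.
have cl : closed [set v : V | 0 <= aff_val A v].
  apply: (@closed_comp _ _ (@aff_val K n D P A) [set x | 0 <= x]).
    by move=> v _; exact: aff_val_continuous.
  exact: closed_ge.
change ([set v : V | 0 <= aff_val A v] u).
by rewrite ((closure_id _).1 cl); apply: closureS uF => v; exact: F0.
Qed.

Lemma face_aff_le0 (F' F : set V) A u :
  is_face F' F -> (forall v, F v -> aff_val A v <= 0) -> F' u -> aff_val A u <= 0.
Proof.
move=> FF' F0 /FF' uF.
have cl : closed [set v : V | aff_val A v <= 0].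
  apply: (@closed_comp _ _ (@aff_val K n D P A) [set x | x <= 0]).
    by move=> v _; exact: aff_val_continuous.
  exact: closed_le.
change ([set v : V | aff_val A v <= 0] u).
by rewrite ((closure_id _).1 cl); apply: closureS uF => v; exact: F0.
Qed.

Lemma facetE (F : facet P) u : fpts F u -> fpts F = facet_of u.
Proof.
have /asboolP[v ->] := fptsP F => uF; apply/seteqP; split=> x xv A AD.
  by rewrite xv// uF.
by rewrite xv// uF.
Qed.

Lemma facet_nonempty (F : facet P) : exists u, fpts F u.
Proof. by have /asboolP[v ->] := fptsP F; exists v. Qed.

Lemma facet_sg (F : facet P) A u v : affine_root D A -> fpts F u -> fpts F v ->
  Num.sg (aff_val A u) = Num.sg (aff_val A v).
Proof. by move=> AD uF; rewrite (facetE uF) => ->. Qed.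

Definition facet_pt (F : facet P) : V := projT1 (cid (facet_nonempty F)).
Lemma facet_ptP F : fpts F (facet_pt F).
Proof. exact: projT2 (cid _). Qed.

Lemma finite_faces (F : facet P) : finite_set [set F' : facet P | is_face F' F].
Proof.
pose u0 := facet_pt F.
pose fl (a : 'rV[int]_n) : int := Num.floor (aff_val (a, 0) u0).
pose code (F' : facet P) : {ffun Phi D -> bool * bool} :=
  [ffun a => (aff_val (fsval a, - fl (fsval a)) (facet_pt F') == 0,
              aff_val (fsval a, - fl (fsval a) - 1) (facet_pt F') == 0)].
pose dec c := xget F [set F' : facet P | is_face F' F /\ code F' = c].
apply: (@sub_finite_set _ _ (dec @` setT)); last exact/finite_image/finite_finset.
move=> F' F'F; exists (code F') => //; rewrite /dec.
case: xgetP => [F'' _ [F''F ce]|/(_ F')]; last by case.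
apply: val_inj => /=.
have u'F := facet_ptP F'; have u''F := facet_ptP F''.
rewrite (facetE u'F) (facetE u''F).
set u' := facet_pt F' in u'F *; set u'' := facet_pt F'' in u''F *.
suff key : forall A, affine_root D A -> Num.sg (aff_val A u') = Num.sg (aff_val A u'').
  by apply/seteqP; split=> x xA A AD; rewrite xA// key.
have bnd G (GF : is_face (fpts G) F) u (uG : fpts G u) a (aD : a \in Phi D) :
    (fl a)%:~R <= aff_val (a, 0) u <= (fl a + 1)%:~R.
  have /andP[fl1 fl2] := floor_itv (aff_val (a, 0) u0).
  apply/andP; split; rewrite -subr_ge0.
    suff : 0 <= aff_val (a, - fl a) u by rewrite aff_val_shift intrN.
    apply: (face_aff_ge0 GF) uG => v vF.
    rewrite -sgr_ge0 (facet_sg _ vF (facet_ptP F))// sgr_ge0.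
    by rewrite aff_val_shift intrN subr_ge0.
  suff : aff_val (a, - (fl a + 1)) u <= 0.
    by rewrite aff_val_shift intrN subr_le0 subr_ge0.
  apply: (face_aff_le0 GF) uG => v vF.
  rewrite -sgr_le0 (facet_sg _ vF (facet_ptP F))// sgr_le0.
  by rewrite aff_val_shift intrN subr_le0 ltW.
move=> [a r] aD; rewrite /affine_root /= in aD.
have /andP[l1 l2] := bnd F' F'F u' u'F a aD.
have /andP[m1 m2] := bnd F'' F''F u'' u''F a aD.
have /ffunP/(_ [` aD]%fset) := ce; rewrite !ffunE /= => -[].
rewrite -/u' -/u'' !(aff_val_shift a (- _)) !(aff_val_shift a (- _ - _)).
rewrite (aff_val_shift a r u') (aff_val_shift a r u'').
move: (fl a) l1 l2 m1 m2 => k.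
move: (aff_val (a, 0) u') (aff_val (a, 0) u'') => x y.
rewrite -opprD !intrN !subr_eq0 => kx xk ky yk e1 e2.
have [rk|kr] := leP (- r) (k - 1).
  have h (z : K) : k%:~R <= z -> Num.sg (z + r%:~R) = 1.
    move=> kz; apply: gtr0_sg; have : (- r)%:~R <= (k - 1)%:~R :> K by rewrite ler_int.
    by rewrite intrN intrB => h; lra.
  by rewrite !h.
have [kr2|rk2] := leP (k + 2) (- r).
  have h (z : K) : z <= (k + 1)%:~R -> Num.sg (z + r%:~R) = -1.
    move=> kz; apply: ltr0_sg; have : (k + 2)%:~R <= (- r)%:~R :> K by rewrite ler_int.
    by move: kz; rewrite intrN !intrD => kz h; lra.
  by rewrite !h.
have [] : - r = k \/ - r = k + 1 by lia.
  move=> rk3; have -> : r = - k by lia.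
  rewrite intrN; move: e1; have [->|xn] := eqVneq x k%:~R; have [->|yn] := eqVneq y k%:~R => //.
  by rewrite !gtr0_sg// subr_gt0 lt_neqAle eq_sym ?xn ?yn ?kx ?ky.
move=> rk3; have -> : r = - (k + 1) by lia.
rewrite intrN; move: e2; have [->|xn] := eqVneq x (k + 1)%:~R; have [->|yn] := eqVneq y (k + 1)%:~R => //.
by rewrite !ltr0_sg// subr_lt0 lt_neqAle ?xn ?yn ?xk ?yk.
Qed.

Definition detc i (X Y : i.-tuple V) : K := \det (\matrix_(j, k) coord X k (tnth Y j)).

Lemma detc_mul U i (X X' Y : i.-tuple V) : basis_of U X' ->
  all (fun v => v \in U) Y -> detc X Y = detc X' Y * detc X X'.
Proof.
move=> X'U /all_tnthP YU; rewrite /detc -det_mulmx; congr (\det _).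
apply/matrixP => j k; rewrite !mxE.
have /coord_span {1}-> : tnth Y j \in <<X'>>%VS by rewrite (span_basis X'U).
rewrite linear_sum /=; apply: eq_bigr => l _.
by rewrite linearZ /= !mxE (tnth_nth 0 X').
Qed.

Lemma detcXX U i (X : i.-tuple V) : basis_of U X -> detc X X = 1.
Proof.
move=> XU; rewrite /detc -[RHS](det1 K i); congr (\det _).
apply/matrixP => j k; rewrite !mxE (tnth_nth 0) coord_free ?(basis_free XU)//.
Qed.

Lemma basis_all U i (X : i.-tuple V) : basis_of U X -> all (fun v => v \in U) X.
Proof. by move=> XU; apply/allP => v; exact: basis_mem. Qed.

Lemma detc_neq0 U i (X X' : i.-tuple V) :
  basis_of U X -> basis_of U X' -> detc X X' != 0.
Proof.
move=> XU X'U; have := detc_mul X' XU (basis_all X'U).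
rewrite (detcXX X'U) => /esym/eqP; apply: contraTneq => ->.
by rewrite mul0r eq_sym oner_neq0.
Qed.

Lemma orient_change U i (X X' : i.-tuple V) : basis_of U X -> basis_of U X' ->
  orient_of U X = fun Y => sgz (detc X X') * orient_of U X' Y.
Proof.
move=> XU X'U; apply/funext => Y; rewrite /orient_of; case: ifP => [YU|]; last by rewrite mulr0.
by rewrite -!/(detc _ Y) (detc_mul X X'U YU) sgzM mulrC.
Qed.

Lemma finite_orient U i : finite_set [set c : i.-tuple V -> int | is_orientation U c].
Proof.
have [[c0 [X0 X0U _]]|noc] := pselect (exists c : i.-tuple V -> int, is_orientation U c);
  last by apply: (sub_finite_set _ (@finite_set0 _)) => c oc; apply: noc; exists c.
pose f (s : int) := fun Y => s * orient_of U X0 Y.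
apply: (@sub_finite_set _ _ ([set f 1] `|` [set f (-1)])); last first.
  by rewrite finite_setU; split; exact: finite_set1.
move=> c [X XU ->]; rewrite (orient_change XU X0U).
by have := detc_neq0 XU X0U; case: sgzP => // _ _; [left|right].
Qed.

Lemma finite_ofaces i (F : facet P) :
  finite_set [set o : ofacet P i | is_face o F].
Proof.
apply: (@sub_finite_set _ _ (\bigcup_(G in [set G : facet P | is_face G F])
   (@ofacet_val _ _ _ _ i @^-1` ([set G] `*`
     [set c : i.-tuple V -> int | is_orientation (direction G) c])))).
  by move=> o oF; exists (ofac o) => //; split=> //=; have /asboolP[] := ofacetP o.
apply: bigcup_finite; first exact: finite_faces.
move=> G _; apply: finite_preimage; first by move=> o o' _ _; exact: (@val_inj _ _ (ofacet P i)).
by apply: finite_setX; [exact: finite_set1|exact: finite_orient].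
Qed.

Lemma orient_opp U i (c : i.+1.-tuple V -> int) :
  is_orientation U c -> is_orientation U (fun Y => - c Y).
Proof.
move=> [X XU ->].
pose X' := [tuple of - thead X :: behead X].
have Xe : X = [tuple of thead X :: behead X] by exact: tuple_eta.
have X'U : basis_of U X'.
  rewrite basisEdim (size_basis XU) size_tuple leqnn andbT.
  rewrite -(span_basis XU) [in X in (X <= _)%VS]Xe.
  apply/span_subvP => v; rewrite inE => /orP[/eqP->|vX].
    by rewrite -[thead X]opprK memvN memv_span// mem_head.
  by rewrite memv_span// inE vX orbT.
exists X' => //; rewrite (orient_change X'U XU); apply/funext => Y.
suff -> : detc X' X = -1 by rewrite sgzN1 mulN1r.
pose d := \row_(j < i.+1) (if j == 0 then -1 else 1 : K).
have -> : detc X' X = \det (diag_mx d).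
  congr (\det _); apply/matrixP => j k; rewrite !mxE.
  have -> : tnth X j = (if j == 0 then -1 else 1 : K) *: X'`_j.
    rewrite (tnth_nth 0) {1}Xe; case: j => [[|j] jlt] /=; last by rewrite scale1r.
    by rewrite scaleN1r opprK.
  rewrite linearZ /= coord_free ?(basis_free X'U)//.
  by case: (j =P k) => _; rewrite ?mulr1// mulr0.
rewrite det_diag big_ord_recl !mxE /= big1 ?mulr1// => j _.
by rewrite mxE.
Qed.

Lemma ofacet_eq i (o o' : ofacet P i) :
  ofac o = ofac o' -> (forall Y, oori o Y = oori o' Y) -> o = o'.
Proof. by move=> e1 /funext e2; apply: val_inj; rewrite /= /ofacet_val e1 e2. Qed.

Fact oopp_subproof i (o : ofacet P i.+1) : ofacet_pred (ofac o, fun Y => - oori o Y).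
Proof.
have /asboolP[oi oo] := ofacetP o; apply/asboolP; split=> //=.
exact: orient_opp.
Qed.

Definition oopp i (o : ofacet P i.+1) : ofacet P i.+1 :=
  ofacet_sub (oopp_subproof o).

Lemma ooppK i : involutive (@oopp i).
Proof. by move=> o; apply: ofacet_eq => // Y; rewrite /= opprK. Qed.

End BoundaryLemmas.

Lemma fsbig_opp (I : choiceType) (M : zmodType) (A : set I) (f : I -> M) :
  \sum_(i \in A) - f i = - \sum_(i \in A) f i.
Proof.
rewrite -sumrN; have -> // : finite_support 0 A (fun i => - f i) = finite_support 0 A f.
rewrite /finite_support !unlock; congr (fset_set (A `&` _) : seq I).
by apply/seteqP; split=> i; rewrite /= => fi0 fi; apply: fi0; apply/eqP; move/eqP: fi; rewrite oppr_eq0.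
Qed.

Section Boundary.
Context (K : realType) (n : nat) (D : root_system n) (P : apartment K D).
Context (R : comNzRingType) (H : algType {poly {poly R}}) (T : extW D -> H).

Definition transition (F F' : facet P) (h : H) : H :=
  T ((d_ F')^-1 * d_ F)%g * h.

(* The sum over F of the terms r^F_F'(c(F, c_(F', c'))): each F has exactly   *)
(* one orientation inducing c' on F'.                                         *)
Definition boundary_fun i (c : ofacet P i.+1 -> H) (o' : ofacet P i) : H :=
  \sum_(o \in [set o : ofacet P i.+1 | is_face o' o /\ induces o o'])
    transition o o' (c o).

Fact boundaryP i (c : chain P H i.+1) : boundary_fun c \in @chain_pred _ _ _ P H i.
Proof.
case: c => c /= /asboolP[cf co]; apply/asboolP; split.
  apply: (@sub_finite_set _ _ (\bigcup_(o in [set o | c o != 0])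
      [set o' : ofacet P i | is_face o' o])).
    move=> o' /=; apply: contra_neqP => no; apply: fsbig1 => o [o'o _].
    have [co0|cn0] := eqVneq (c o) 0; first by rewrite /transition co0 mulr0.
    by exfalso; apply: no; exists o.
  by apply: bigcup_finite => // o _; exact: finite_ofaces.
move=> i0 o o' e1 e2; rewrite /boundary_fun -fsbig_opp.
rewrite (reindex_fsbig (@oopp _ _ _ P i)
  [set x : ofacet P i.+1 | is_face o x /\ induces x o]).
  apply: eq_fsbigr => x _; rewrite /transition e1 -mulrN; congr (_ * _).
  exact: co.
have ind (x : ofacet P i.+1) : induces x o -> induces (oopp x) o'.
  move=> xo u u' Y /=; rewrite e1 => ux u'o' Yo.
  by rewrite e2; congr (- _); exact: xo.
have ind' (x : ofacet P i.+1) : induces x o' -> induces (oopp x) o.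
  move=> xo u u' Y /= ux u'o' Yo; rewrite -xo ?e1//.
  by rewrite e2 opprK.
split.
- by move=> x [xF xo] /=; rewrite e1; split=> //; exact: ind.
- by move=> x y _ _; exact: (can_inj (@ooppK _ _ _ P i)).
- move=> x /=; rewrite e1 => -[xF xo]; exists (oopp x); last exact: ooppK.
  by split=> //; exact: ind'.
Qed.

Definition boundary i (c : chain P H i.+1) : chain P H i := Chain (boundaryP c).

Definition augmentation (c : chain P H 0) : H :=
  \sum_(x \in [set: ofacet P 0]) T (d_ x) * c x.

End Boundary.

(* M (x)_S N for a right action of S on M and a left action on N: the free    *)
(* abelian group on M * N modulo the subgroup generated by the usual relators.*)
Section TensorProduct.
Local Open Scope quotient_scope.
Context (M N : zmodType) (S : Type) (B : set S).
Context (mr : M -> S -> M) (nl : S -> N -> N).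

Inductive tensor_rel : {freeg (M * N)} -> Prop :=
| TensorRel0 : tensor_rel 0
| TensorRelB x y : tensor_rel x -> tensor_rel y -> tensor_rel (x - y)
| TensorRelDl m m' z :
    tensor_rel (<< (m + m', z) >> - << (m, z) >> - << (m', z) >>)
| TensorRelDr m z z' :
    tensor_rel (<< (m, z + z') >> - << (m, z) >> - << (m, z') >>)
| TensorRelS m s z : B s ->
    tensor_rel (<< (mr m s, z) >> - << (m, nl s z) >>).

Definition tensor_pred : {pred {freeg (M * N)}} := fun x => `[< tensor_rel x >].

Fact tensor_zmod_closed : zmod_closed tensor_pred.
Proof.
split; first by apply/asboolP; constructor.
by move=> x y /asboolP xr /asboolP yr; apply/asboolP; constructor.
Qed.

HB.instance Definition _ :=
  GRing.isZmodClosed.Build {freeg (M * N)} tensor_pred tensor_zmod_closed.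

Definition tensor : zmodType := Quotient.quot tensor_pred.

Definition tens (m : M) (z : N) : tensor := \pi_(Quotient.quot tensor_pred) << (m, z) >>.

(* f (x) g, for f and g commuting with S. *)
Definition tensor_map (f : M -> M) (g : N -> N) (t : tensor) : tensor :=
  \pi_(Quotient.quot tensor_pred)
    (fglift (fun p => << (f p.1, g p.2) >>) (repr (t : Quotient.quot tensor_pred))).

Lemma tensor_mapE f g m z :
    {morph f : x y / x + y} -> {morph g : x y / x + y} ->
    (forall x s, B s -> f (mr x s) = mr (f x) s) ->
    (forall s y, B s -> g (nl s y) = nl s (g y)) ->
  tensor_map f g (tens m z) = tens (f m) (g z).
Proof.
move=> fD gD fS gS; rewrite /tensor_map /tens.
set L := fglift _.
have LB : {morph L : x y / x - y} by move=> x y; exact: lift_is_additive.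
have LU x : L << x >> = << (f x.1, g x.2) >> by rewrite /L liftU scale1r.
have Lrel t : tensor_rel t -> tensor_rel (L t).
  elim=> [||||].
  - by rewrite -(subrr 0) LB subrr; constructor.
  - by move=> x1 x2 _ r1 _ r2; rewrite LB; constructor.
  - by move=> *; rewrite !LB !LU /= fD; apply: TensorRelDl.
  - by move=> *; rewrite !LB !LU /= gD; apply: TensorRelDr.
  - by move=> x s y0 Bs; rewrite !LB !LU /= fS// gS//; apply: TensorRelS.
pose x : {freeg (M * N)} := << (m, z) >>.
have xr : repr (\pi_(Quotient.quot tensor_pred) x) - x \in tensor_pred.
  by rewrite Quotient.idealrBE reprK eqxx.
rewrite -[<< (f m, g z) >>](LU (m, z)) -/x.
apply/eqP; rewrite -Quotient.idealrBE.
move: (repr _) xr => y; rewrite -LB.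
by move=> /asboolP/Lrel yr; apply/asboolP.
Qed.

End TensorProduct.

Record bimodule (H : nzRingType) (M : zmodType)
    (l : H -> M -> M) (r : M -> H -> M) : Prop := Bimodule {
  bimod_lDl : forall h k m, l (h + k) m = l h m + l k m;
  bimod_lDr : forall h m m', l h (m + m') = l h m + l h m';
  bimod_l1 : forall m, l 1 m = m;
  bimod_lM : forall h k m, l (h * k) m = l h (l k m);
  bimod_rDl : forall m m' h, r (m + m') h = r m h + r m' h;
  bimod_rDr : forall m h k, r m (h + k) = r m h + r m k;
  bimod_r1 : forall m, r m 1 = m;
  bimod_rM : forall m h k, r m (h * k) = r (r m h) k;
  bimod_lr : forall h m k, r (l h m) k = l h (r m k) }.

Definition biequivariant (H M M' : Type)
    (l : H -> M -> M) (r : M -> H -> M) (l' : H -> M' -> M') (r' : M' -> H -> M')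
    (f : M -> M') : Prop :=
  (forall h m, f (l h m) = l' h (f m)) /\ (forall m h, f (r m h) = r' (f m) h).

Section FiniteDirectSum.
Context (I : finType) (M : I -> zmodType).

Definition dirsum : Type := forall i, M i.
HB.instance Definition _ := Choice.on dirsum.

Let add (x y : dirsum) : dirsum := fun i => x i + y i.
Let opp (x : dirsum) : dirsum := fun i => - x i.
Let zero : dirsum := fun i => 0.

Fact dirsum_addA : associative add.
Proof. by move=> x y z; apply: functional_extensionality_dep => i; exact: addrA. Qed.
Fact dirsum_addC : commutative add.
Proof. by move=> x y; apply: functional_extensionality_dep => i; exact: addrC. Qed.
Fact dirsum_add0 : left_id zero add.
Proof. by move=> x; apply: functional_extensionality_dep => i; exact: add0r. Qed.
Fact dirsum_addN : left_inverse zero opp add.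
Proof. by move=> x; apply: functional_extensionality_dep => i; exact: addNr. Qed.

HB.instance Definition _ := GRing.isZmodule.Build dirsum
  dirsum_addA dirsum_addC dirsum_add0 dirsum_addN.

End FiniteDirectSum.

Section TwistedInduction.
Context (K : realType) (n : nat) (D : root_system n) (P : apartment K D).
Context (R : comNzRingType) (H : algType {poly {poly R}}) (T : extW D -> H).

(* H(j_F) (x)_{H_F} H *)
Definition twisted_tensor (F : facet P) : zmodType :=
  @tensor H H H (H_of T F) (fun m s => m * j_of T F s) (fun s z => s * z).

Definition twisted_lact (F : facet P) (h : H) :
    twisted_tensor F -> twisted_tensor F :=
  tensor_map (fun m => h * m) id.

Definition twisted_ract (F : facet P) (t : twisted_tensor F) (h : H) :
    twisted_tensor F :=
  tensor_map id (fun z => z * h) t.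

Context (Fs : {fset facet P}).

Definition twisted_sum : zmodType :=
  dirsum (fun F : Fs => twisted_tensor (fsval F)).

Definition twisted_sum_lact (h : H) (t : twisted_sum) : twisted_sum :=
  fun F => twisted_lact h (t F).

Definition twisted_sum_ract (t : twisted_sum) (h : H) : twisted_sum :=
  fun F => twisted_ract (t F) h.

End TwistedInduction.

(* Main.v *)
From HB Require Import structures.
Require Import Defs.
From mathcomp Require Import all_boot all_order all_algebra finmap.
From mathcomp Require Import generic_quotient ring_quotient.
From mathcomp Require Import all_classical all_reals.
From mathcomp Require Import topology normedtype.
From mathcomp.multinomials Require Import freeg.
From mathcomp Require Import zify ring lra.

(* The left action is transported from the sum of the H(j_F) (x)_{H_F} H,     *)
(* where multiplication by T_w is visible on elementary chains: for a facet F *)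
(* in the closure of C with orientation c,                                    *)
(*     T_w . [F, c, h] = [w F, w c, T_(d_(wF)^-1 w) h].                       *)
(* Everything rests on the gate property of the chamber C(G): no hyperplane   *)
(* through G separates it from C. It yields l(w) = l(d_G) + l(d_G^-1 w)       *)
(* whenever w^-1 G lies in the closure of C, so the displayed formula is      *)
(* compatible with the transition maps (hence with the boundary and, T_(d_x)  *)
(* being the last transition, with the augmentation). The stabilizer of F is  *)
(* generated by Omega_F and the simple reflections fixing F, which makes the  *)
(* formula H_F-balanced up to the orientation character. The choice of d_G    *)
(* only matters through the chamber d_G C, so the simple transitivity of      *)
(* W_aff on chambers is never needed.                                         *)

Set Implicit Arguments.
Unset Strict Implicit.
Unset Printing Implicit Defensive.

Import Order.TTheory GRing.Theory Num.Theory numFieldNormedType.Exports.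

Local Open Scope classical_set_scope.
Local Open Scope ring_scope.

(** * Roots and minimal roots *)

(** Let T_w send the elementary chain with value h on an oriented facet (F, c) of the closure of C
    to the chain with value T_(d_G^-1 w) h on (w F, w c), where G = w F. This is the product [star].
    For a representative F the map z (x) h |-> [star] of z on the elementary chain of h at F
    descends to H(j_F) (x)_{H_F} H. Summed over the representatives it gives a bijection [psi] with
    inverse [theta], and [lact] is left multiplication on the tensor products carried over to
    chains. What has to be proved is that [psi] is well defined and bijective and that [boundary]
    and [augmentation] respect [lact].

    Lengths. A simple affine reflection permutes the positive affine roots other than its own
    ([simple_refl_pos]). Hence the gallery distance from C to a chamber is the number of hyperplanes
    separating them ([gallery_nsep], [chamber_gallery]), and d_G C is separated from C only by
    hyperplanes that already separate G from C ([d_spec], [d_gate]). It follows that T_w = T_(d_G)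
    T_(d_G^-1 w) as soon as w^-1 G lies in the closure of C ([wlength_d]), and a similar identity
    holds for the transition from G to a face ([hecke_mul_face]).

    Well-definedness. An element carrying a facet F of the closure of C to another one is an element
    of Omega times simple reflections fixing F pointwise, with lengths adding ([stab_ind]). For such
    reflections [star] is balanced without sign, by the quadratic relation ([star_mul_S]). For
    elements of Omega it is balanced up to the orientation character. Together this is the balancing
    twisted by j_F ([balanced_H]).

    Bijectivity. Every G in the orbit of F is x F with d_G^-1 x of length zero ([facet_Omega]). Then
    T_(d_G^-1 x) is a unit, and a value on G can be traced back to T_x (x) h. This defines [theta];
    the two composites are [thetaK], resting on [theta_star], and [psiK], resting on [chain_gen].

    Equivariance. The faces of a representative lie in the closure of C but need not be
    representatives, so [lact_star] first shows that [lact] is given by [star] on all chains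
    supported there. Then [boundary_star] and [augmentation_star] move z across, and [chain_gen]
    reduces the general case to these chains. *)

Section Pairing.
Context (n : nat).
Implicit Types (x : 'rV[int]_n) (y : 'cV[int]_n).

Lemma pairingDl x x' y : pairing (x + x') y = pairing x y + pairing x' y.
Proof. by rewrite /pairing mulmxDl mxE. Qed.
Lemma pairingNl x y : pairing (- x) y = - pairing x y.
Proof. by rewrite /pairing mulNmx mxE. Qed.
Lemma pairingBl x x' y : pairing (x - x') y = pairing x y - pairing x' y.
Proof. by rewrite pairingDl pairingNl. Qed.
Lemma pairingZl k x y : pairing (k *: x) y = k * pairing x y.
Proof. by rewrite /pairing -scalemxAl mxE. Qed.
Lemma pairingDr x y y' : pairing x (y + y') = pairing x y + pairing x y'.
Proof. by rewrite /pairing mulmxDr mxE. Qed.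
Lemma pairingZr k x y : pairing x (k *: y) = k * pairing x y.
Proof. by rewrite /pairing -scalemxAr mxE. Qed.
Lemma pairing_mulmx x (g : 'M[int]_n) y : pairing (x *m g) y = pairing x (g *m y).
Proof. by rewrite /pairing mulmxA. Qed.
Lemma pairing_scalar x y : x *m y = (pairing x y)%:M.
Proof. by apply/matrixP => i j; rewrite !ord1 [RHS]mxE eqxx. Qed.

Lemma scale_int_eq0 k x : (k *: x == 0) = (k == 0) || (x == 0).
Proof.
have [->|k0 /=] := eqVneq k 0; first by rewrite scale0r eqxx.
apply/eqP/eqP => [kx0|->]; last exact: scaler0.
apply/rowP => j; have /rowP/(_ j) := kx0; rewrite !mxE => /eqP.
by rewrite mulf_eq0 (negPf k0) => /eqP.
Qed.

End Pairing.

Section RootSystem.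
Context (n : nat) (D : root_system n).
Implicit Types (a b c x : 'rV[int]_n).

Lemma mul_refl a x : x *m refl D a = x - pairing x (coroot D a) *: a.
Proof. by rewrite /refl mulmxBr mulmx1 mulmxA pairing_scalar mul_scalar_mx. Qed.

Lemma refl_mul a y : refl D a *m y = y - pairing a y *: coroot D a.
Proof.
by rewrite /refl mulmxBl mul1mx -mulmxA pairing_scalar mul_mx_scalar.
Qed.

Lemma root_neq0 a : a \in Phi D -> a != 0.
Proof.
move=> /pairing_coroot; apply: contra_eq_neq => ->.
by rewrite /pairing mul0mx mxE.
Qed.

Lemma root_opp a : a \in Phi D -> - a \in Phi D.
Proof.
move=> aP; have := refl_root aP aP.
by rewrite pairing_coroot// scaler_nat mulr2n opprD addNKr.
Qed.

Lemma root_refl a b : a \in Phi D -> b \in Phi D -> b *m refl D a \in Phi D.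
Proof. by move=> aP bP; rewrite mul_refl refl_root. Qed.

Lemma root_mulW0 (g : 'M_n) b : in_W0 D g -> b \in Phi D -> b *m g \in Phi D.
Proof.
move=> [s [sP ->]]; elim: s b sP => [|a s IHs] b sP bP; first by rewrite mulmx1.
rewrite /= mulmxA; apply: IHs; first by move=> c cs; rewrite sP// inE cs orbT.
by rewrite root_refl// sP ?mem_head.
Qed.

Lemma reflV a : a \in Phi D -> invmx (refl D a) = refl D a.
Proof.
move=> aP; have aa := refl_invol aP; have [aU _] := mulmx1_unit aa.
by rewrite -[LHS]mulmx1 -aa mulKmx.
Qed.

(** A positive semidefinite form, invariant under W0 because the reflections permute the coroots. It
    serves to compare lengths of roots. *)
Let form x x' : int := \sum_(y <- Phic D) pairing x y * pairing x' y.

Let formC x x' : form x x' = form x' x.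
Proof. by apply: eq_bigr => y _; rewrite mulrC. Qed.
Let formBl x x' z : form (x - x') z = form x z - form x' z.
Proof. by rewrite -sumrB; apply: eq_bigr => y _; rewrite pairingBl mulrBl. Qed.
Let formZl k x z : form (k *: x) z = k * form x z.
Proof. by rewrite mulr_sumr; apply: eq_bigr => y _; rewrite pairingZl mulrA. Qed.

Let form_refl a x x' : a \in Phi D -> form (x *m refl D a) (x' *m refl D a) = form x x'.
Proof.
move=> aP; have inv y : refl D a *m (refl D a *m y) = y.
  by rewrite mulmxA refl_invol// mul1mx.
have pr : perm_eq [seq refl D a *m y | y <- Phic D] (Phic D).
  apply: uniq_perm; [|exact: fset_uniq|].
    rewrite map_inj_uniq; first exact: fset_uniq.
    by move=> y z /(congr1 (mulmx (refl D a))); rewrite !inv.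
  move=> y; apply/mapP/idP => [[z zP ->]|yP].
    by rewrite refl_mul refl_coroot.
  by exists (refl D a *m y); rewrite ?inv// refl_mul refl_coroot.
rewrite /form -[in RHS](perm_big _ pr)/= big_map.
by apply: eq_bigr => y _; rewrite !pairing_mulmx.
Qed.

(** The Cartan identity: expand the invariance of the form under s_a, using s_a a = - a. *)
Let form_root a b : a \in Phi D ->
  2 * form a b = pairing b (coroot D a) * form a a.
Proof.
move=> aP; have := form_refl a b aP; rewrite !mul_refl pairing_coroot//.
rewrite formBl formZl (formC _ (b - _)) !formBl !formZl (formC b a).
lia.
Qed.

Let form_ge0 x : 0 <= form x x.
Proof. by apply: sumr_ge0 => y _; rewrite -expr2 sqr_ge0. Qed.

Let form_eq0 x y : form x x = 0 -> y \in Phic D -> pairing x y = 0.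
Proof.
move=> /eqP; rewrite psumr_eq0; last by move=> z _; rewrite -expr2 sqr_ge0.
by move=> /allP/(_ y) h /h/=; rewrite mulf_eq0 orbb => /eqP.
Qed.

Lemma coroot_in a : a \in Phi D -> coroot D a \in Phic D.
Proof. by move=> aP; have [h _ _] := coroot_bij D; exact: (h a aP). Qed.

Let form_gt0 a : a \in Phi D -> 0 < form a a.
Proof.
move=> aP; rewrite lt_neqAle form_ge0 andbT; apply/eqP => /esym/form_eq0.
by move=> /(_ _ (coroot_in aP)); rewrite pairing_coroot.
Qed.

(* If both Cartan integers are at least 2 then a - b is null for the          *)
(* invariant form, and a + 2k(a - b) is a root for every k.                   *)
Lemma root_sub a b : a \in Phi D -> b \in Phi D -> a <> b ->
  0 < pairing b (coroot D a) -> a - b \in Phi D.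
Proof.
move=> aP bP ab p0.
have e1 := form_root b aP; have e2 := form_root a bP.
have fa := form_gt0 aP; have fb := form_gt0 bP.
set p := pairing b _ in p0 e1; set q := pairing a _ in e2.
have q0 : 0 < q.
  by rewrite -(pmulr_lgt0 _ fb) -e2 formC e1 mulr_gt0.
have [p1|p1] := eqVneq p 1.
  by rewrite -opprB root_opp//; have := refl_root aP bP; rewrite -/p p1 scale1r.
have [q1|q1] := eqVneq q 1.
  by have := refl_root bP aP; rewrite -/q q1 scale1r.
exfalso; pose d := a - b.
(* Now p, q >= 2, so the Cartan identities give 2(a, b) >= 2(a, a) and 2(a, b) >= 2(b, b), whence
   (d, d) = (a, a) - 2(a, b) + (b, b) <= 0. *)
have d0 : form d d = 0.
  apply/eqP; rewrite eq_le form_ge0 andbT.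
  rewrite /d formBl (formC a) (formC b) !formBl (formC b a).
  move: (form b a) (formC a b) e1 e2 => z -> e1 e2.
  have h1 : 2 * form a a <= p * form a a by rewrite ler_pM2r//; lia.
  have h2 : 2 * form b b <= q * form b b by rewrite ler_pM2r//; lia.
  lia.
have dn c : c \in Phi D -> pairing d (coroot D c) = 0.
  by move=> cP; apply: (form_eq0 d0); exact: coroot_in.
have bE : b = a - d by rewrite /d opprB addrC subrK.
have pba : pairing b (coroot D a) = 2 by rewrite bE pairingBl dn// pairing_coroot// subr0.
have pab : pairing a (coroot D b) = 2.
  have -> : a = b + d by rewrite bE subrK.
  by rewrite pairingDl pairing_coroot// dn// addr0.
(* As d pairs to zero with every coroot, s_b followed by s_a moves these roots by 2 d. *)
have shift (k : int) : a + (2 * k) *: d \in Phi D -> a + (2 * (k + 1)) *: d \in Phi D.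
  move=> kP; have := refl_root aP (refl_root bP kP).
  rewrite pairingBl !pairingDl !pairingZl !dn// pab pba pairing_coroot//.
  rewrite mulr0 addr0.
  suff -> : a + (2 * (k + 1)) *: d = a + (2 * k) *: d - 2 *: b - (2 - 2 * 2) *: a by [].
  by rewrite /d; apply/matrixP => i j; rewrite !mxE; ring.
have roots (k : nat) : a + (2 * k%:Z) *: d \in Phi D.
  elim: k => [|k IHk]; first by rewrite mulr0 scale0r addr0.
  by rewrite -(addn1 k) PoszD; exact: shift.
have dn0 : d != 0 by rewrite subr_eq0; exact/eqP.
(* One root more than [Phi D] can hold; they are distinct because d is nonzero and the lattice is
   torsion free. *)
pose s := [seq a + (2 * k%:Z) *: d | k <- iota 0 (#|` Phi D|).+1].
have : (size s <= #|` Phi D|)%N.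
  apply: uniq_leq_size; last by move=> c /mapP[k _ ->].
  rewrite map_inj_uniq ?iota_uniq// => k l /addrI/eqP.
  rewrite -subr_eq0 -scalerBl scale_int_eq0 (negPf dn0) orbF; lia.
by rewrite size_map size_iota ltnn.
Qed.

Local Notation pos := (nneg_comb (Pi D)).

Lemma pos0 : pos 0.
Proof. by exists (fun=> 0%N); rewrite big1. Qed.

Lemma posD x x' : pos x -> pos x' -> pos (x + x').
Proof.
move=> [c ->] [c' ->]; exists (fun b => (c b + c' b)%N).
by rewrite -big_split; apply: eq_bigr => b _; rewrite mulrnDr.
Qed.

(** Adding the two expansions gives a vanishing combination of the base with nonnegative
    coefficients. *)
Lemma pos_anti x : pos x -> pos (- x) -> x = 0.
Proof.
move=> [c xE] [c' xE']; have := base_free (r := D) (c := fun b => (c b + c' b)%:Z).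
have -> : \sum_(b <- Pi D) (c b + c' b)%:Z *: b = 0.
  transitivity (x - x); last exact: subrr.
  rewrite xE' {1}xE -big_split; apply: eq_bigr => b _.
  by rewrite PoszD scalerDl -!scaler_nat !natz.
move=> /(_ erefl) h; rewrite xE big_seq big1// => b /h.
by move=> h0; have -> : c b = 0%N by lia.
Qed.

Lemma pos_base b : b \in Pi D -> pos b.
Proof.
move=> bP; exists (fun b' => (b' == b) : nat).
rewrite (big_fsetD1 b)//= eqxx mulr1n big_seq big1 ?addr0// => c.
by rewrite !inE => /andP[/negPf-> _].
Qed.

(** s_a changes only the coefficient of a. If the image were negative, all other coefficients of b
    would vanish, so b would be proportional to a, and reducedness would leave b = a or b = - a. *)
Lemma refl_base_pos a b : a \in Pi D -> b \in Phi D -> pos b -> b <> a ->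
  pos (b *m refl D a).
Proof.
move=> aP bP bpos ba; have aR := base_root aP.
case: (base_span (root_refl aR bP)) => // neg; exfalso.
have bpos0 := bpos; move: bpos neg => [c bE] [c' bE'].
set m := pairing b (coroot D a).
have e := base_free (r := D) (c := fun b => (c b + c' b)%:Z - (b == a)%:Z * m).
have {}e : forall b', b' \in Pi D -> (c b' + c' b')%:Z - (b' == a)%:Z * m = 0.
  apply: e; transitivity (b - b *m refl D a - m *: a); last first.
    by rewrite mul_refl opprB addrCA subrr addr0 subrr.
  rewrite bE' {1}bE.
  have -> : m *: a = \sum_(b' <- Pi D) ((b' == a)%:Z * m) *: b'.
    rewrite (big_fsetD1 a)//= eqxx mul1r big_seq big1 ?addr0// => c0.
    by rewrite !inE => /andP[/negPf-> _]; rewrite mul0r scale0r.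
  rewrite -big_split -sumrB; apply: eq_bigr => b' _ /=.
  by rewrite scalerBl PoszD scalerDl -!scaler_nat !natz.
have {}bE : 1 *: b = (c a)%:Z *: a.
  rewrite scale1r bE (big_fsetD1 a)//= -natz scaler_nat big_seq big1 ?addr0// => b'.
  rewrite !inE => /andP[b'a b'P]; have := e b' b'P.
  by rewrite (negPf b'a) mul0r => e'; have -> : c b' = 0%N by lia.
have [//|bN] : b = a \/ b = - a by exact: (root_reduced aR bP _ bE).
have := root_neq0 bP; rewrite (pos_anti bpos0) ?eqxx//.
by rewrite bN opprK; exact: pos_base.
Qed.

Lemma root_le_refl a : root_le D a a.
Proof. by rewrite /root_le subrr; exact: pos0. Qed.

Lemma root_le_trans a b c : root_le D a b -> root_le D b c -> root_le D a c.
Proof. by move=> ab bc; have := posD bc ab; rewrite addrA subrK. Qed.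

Lemma root_le_anti a b : root_le D a b -> root_le D b a -> a = b.
Proof.
move=> ab ba; apply/eqP; rewrite -subr_eq0; apply/eqP.
by apply: pos_anti; rewrite ?opprB.
Qed.

(** Descent on the number of roots below b, which drops strictly since the order is
    antisymmetric. *)
Lemma minimal_root_below b : b \in Phi D -> exists2 a, minimal_root D a & root_le D a b.
Proof.
pose below b := [fset c in Phi D | `[< root_le D c b >]]%fset.
have [m] := ubnP #|` below b|; elim: m b => // m IHm b bm bP.
have [bmin|nmin] := pselect (minimal_root D b); first by exists b => //; exact: root_le_refl.
have [c [cP cb nbc]] : exists c, [/\ c \in Phi D, root_le D c b & c <> b].
  apply: contrapT => nex; apply: nmin; split=> // c cP cb.
  by apply: contrapT => nbc; apply: nex; exists c.
have [|a amin ac] := IHm c _ cP; last by exists a => //; exact: root_le_trans cb.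
rewrite ltnS in bm; apply: leq_trans bm; apply: fproper_ltn_card.
rewrite fproperE; apply/andP; split.
  apply/fsubsetP => d; rewrite !inE => /andP[-> /asboolP dc] /=; apply/asboolP.
  exact: root_le_trans cb.
apply/fsubsetPn; exists b; rewrite !inE bP /=; first exact/asboolP/root_le_refl.
by apply/asboolPn => bc; apply: nbc; exact: root_le_anti.
Qed.

Lemma minimal_root_neg a : minimal_root D a -> pos (- a).
Proof.
move=> [aP amin]; case: (base_span aP) => // apos; exfalso.
have /(amin _ (root_opp aP)) : root_le D (- a) a.
  by rewrite /root_le opprK; exact: posD.
move=> /eqP; rewrite -subr_eq0 -opprD oppr_eq0 -mulr2n -scaler_nat.
by rewrite scale_int_eq0 (negPf (root_neq0 aP)).
Qed.

(** Otherwise [root_sub] makes a - b a root, strictly below a because b is positive. *)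
Lemma minimal_root_antidominant a b : minimal_root D a -> b \in Phi D -> pos b ->
  pairing b (coroot D a) <= 0.
Proof.
move=> amin bP bpos; have [aP am] := amin; rewrite leNgt; apply/negP => p0.
have ab : a <> b.
  move=> ab; have := root_neq0 aP; rewrite -ab in bpos.
  by rewrite (pos_anti bpos (minimal_root_neg amin)) eqxx.
have /(am _ (root_sub aP bP ab p0)) : root_le D (a - b) a.
  by rewrite /root_le opprB addrC subrK.
move=> /eqP; rewrite -subr_eq0 addrAC subrr sub0r oppr_eq0.
by rewrite (negPf (root_neq0 bP)).
Qed.

(** a - b is a root by [root_sub]; were it positive, b would lie below a. *)
Lemma minimal_root_above a b : minimal_root D a -> b \in Phi D -> b <> a ->
  0 < pairing b (coroot D a) -> pos (b - a).
Proof.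
move=> [aP amin] bP ba p0; have ab := root_sub aP bP (nesym ba) p0.
case: (base_span ab) => [h|]; last by rewrite opprB.
have := amin _ bP; rewrite /root_le => /(_ h).
by move=> /ba.
Qed.

(** If m = <b, a^v> >= 2, the root c = - s_a(b) = m a - b also pairs to m with a^v, so b - a and c -
    a are both positive. Their sum (m - 2) a is nonpositive, a being negative, so m = 2; then c - a
    = a - b, which forces b = a. *)
Lemma minimal_root_le1 a b : minimal_root D a -> b \in Phi D -> b <> a ->
  pairing b (coroot D a) <= 1.
Proof.
move=> amin bP ba; have [aP _] := amin; rewrite leNgt; apply/negP => p1.
set m := pairing b _ in p1.
have bpos : pos (b - a) by apply: minimal_root_above => //; rewrite -/m; lia.
pose c := - (b *m refl D a).
have cP : c \in Phi D by rewrite root_opp// root_refl.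
have cE : c = m *: a - b by rewrite /c mul_refl -/m opprB.
have cm : pairing c (coroot D a) = m.
  by rewrite cE pairingBl pairingZl pairing_coroot// -/m; lia.
have ca : c <> a.
  move=> ca; have : 1 *: b = (m - 1) *: a.
    by rewrite scale1r scalerBl scale1r -[in - a]ca cE opprB addrC subrK.
  move=> /(root_reduced aP bP)[//|//|bN].
  by move: p1; rewrite /m bN pairingNl pairing_coroot.
have cpos : pos (c - a) by apply: minimal_root_above => //; rewrite cm; lia.
have aneg := minimal_root_neg amin.
have mneg (k : nat) : pos (k%:Z *: - a).
  elim: k => [|k IHk]; first by rewrite scale0r; exact: pos0.
  by rewrite -(addn1 k) PoszD scalerDl scale1r; exact: posD.
have s0 : pos ((m - 2) *: a).
  have := posD bpos cpos; congr pos; rewrite cE.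
  by apply/matrixP => i j; rewrite !mxE; ring.
have e : (m - 2) *: a = 0.
  apply: pos_anti => //; rewrite -scalerN.
  by have -> : m - 2 = `|m - 2|%N%:Z by lia.
have m2' : m = 2.
  by move/eqP: e; rewrite scale_int_eq0 (negPf (root_neq0 aP)) orbF => /eqP; lia.
have : b - a = 0.
  apply: pos_anti => //; move: cpos; congr pos; rewrite cE m2'.
  by apply/matrixP => i j; rewrite !mxE; ring.
by move=> /eqP; rewrite subr_eq0 => /eqP.
Qed.

Lemma simple_affine_root A : simple_aff D A -> affine_root D A.
Proof. by case=> -[+ _]; [exact: base_root|case]. Qed.

Lemma simple_aff_pos A : simple_aff D A -> aff_pos D A.
Proof.
move=> AP; split; first exact: simple_affine_root.
by case: AP => -[h ->]; [right; split=> //; exact: pos_base|left].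
Qed.

Lemma wact_root_refl A (s : extW D) B : is_aff_refl A s -> affine_root D A ->
  wact_root s B = (B.1 - pairing B.1 (coroot D A.1) *: A.1,
                   B.2 - A.2 * pairing B.1 (coroot D A.1)).
Proof.
by move=> [s1 s2] AP; rewrite /wact_root s1 s2 reflV// mul_refl pairingZr.
Qed.

(** All length computations rest on this. For A = (a, 1) the image of (b, r) is (b - m a, r - m)
    with m = <b, a^v>; the bounds m <= 1 for b <> a, and m <= 0 for b positive, keep it positive. *)
Lemma simple_refl_pos A (s : extW D) B : simple_aff D A -> is_aff_refl A s ->
  aff_pos D B -> B <> A -> aff_pos D (wact_root s B).
Proof.
move=> AS As [BP Bpos] BA; have AP := simple_affine_root AS.
rewrite (wact_root_refl _ As AP); split.
  by rewrite /affine_root /= refl_root.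
case: A B {As} AS AP BP Bpos BA => [a k] [b r] /= AS aP bP Bpos BA.
rewrite /affine_root /= in aP bP; move: AS; rewrite /simple_aff /= => -[[aB k0]|[amin k1]].
  rewrite k0 mul0r subr0; case: Bpos => [r0|[r0 bpos]]; first by left.
  right; split=> //; rewrite -mul_refl; apply: refl_base_pos => // ba.
  by apply: BA; rewrite ba r0 k0.
rewrite k1 mul1r; set m := pairing b _.
have [ba|ba] := pselect (b = a).
  (* Here r = 1 would be A itself and r = 0 is excluded because a is negative. So r >= 2, and for r
     = 2 the image is (- a, 0). *)
  have m2 : m = 2 by rewrite /m ba pairing_coroot.
  have neg := minimal_root_neg amin.
  have r1 : r <> 1 by move=> r1; apply: BA; rewrite ba r1 k1.
  have r0 : 0 < r.
    case: Bpos => // -[_ bpos]; exfalso; rewrite ba in bpos.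
    by have := root_neq0 aP; rewrite (pos_anti bpos neg) eqxx.
  have [r2|r2] := eqVneq r 2; last by left; lia.
  right; split; first by lia.
  by rewrite m2 ba scaler_nat mulr2n opprD addNKr.
have m1 := minimal_root_le1 amin bP ba; rewrite -/m in m1.
case: Bpos => [r0|[r0 bpos]].
  have [rm|rm] := eqVneq r m; last by left; lia.
  right; split; first by lia.
  have -> : m = 1 by lia.
  by rewrite scale1r; apply: minimal_root_above => //; rewrite -/m; lia.
have m0 := minimal_root_antidominant amin bP bpos; rewrite -/m in m0.
have [->|mn] := eqVneq m 0; last by left; lia.
by right; split; [lia|rewrite scale0r subr0].
Qed.

End RootSystem.

(** * Affine roots and length *)

Lemma card_fset_set_image (S T : choiceType) (f : S -> T) (A : set S) :
  injective f -> finite_set A -> #|` fset_set (f @` A)|%fset = #|` fset_set A|%fset.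
Proof. by move=> fI fA; rewrite fset_set_image// card_imfset. Qed.

Lemma big_morph_comb (M N : nmodType) (f : M -> N) (r : seq M) (c : M -> nat) :
  {morph f : x y / x + y} -> f 0 = 0 ->
  f (\sum_(b <- r) b *+ c b) = \sum_(b <- r) f b *+ c b.
Proof.
move=> fD f0; rewrite (big_morph f fD f0); apply: eq_bigr => b _.
by elim: (c b) => [|k IHk]; rewrite ?mulr0n// !mulrS fD IHk.
Qed.

Section AffineAction.
Context (n : nat) (D : root_system n).
Local Notation W := (extW D).
Implicit Types (v w s : W) (A B : 'rV[int]_n * int).

Lemma wact_rootM v w A : wact_root (v * w)%g A = wact_root v (wact_root w A).
Proof.
have U := wlin_unit; rewrite /wact_root /= invmxM ?U// mulmxA; congr pair.
by rewrite pairingDr -pairing_mulmx opprD addrCA addrC.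
Qed.

Lemma wact_root1 A : wact_root (1 : W)%g A = A.
Proof.
case: A => a r; rewrite /wact_root /= invmx1 mulmx1; congr pair.
by rewrite /pairing mulmx0 mxE subr0.
Qed.

Lemma wact_rootK w : cancel (wact_root w) (wact_root w^-1%g).
Proof. by move=> A; rewrite -wact_rootM mulVg wact_root1. Qed.

Lemma wact_rootVK w : cancel (wact_root w^-1%g) (wact_root w).
Proof. by move=> A; rewrite -wact_rootM mulgV wact_root1. Qed.

Lemma affine_root_wact w A : affine_root D A -> affine_root D (wact_root w A).
Proof. by apply: root_mulW0; apply/asboolP; exact: extW_invP. Qed.

Definition opp_aff A := (- A.1, - A.2).

Lemma opp_affK : involutive opp_aff.
Proof. by case=> a r; rewrite /opp_aff /= !opprK. Qed.

Lemma affine_root_opp A : affine_root D A -> affine_root D (opp_aff A).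
Proof. exact: root_opp. Qed.

Lemma wact_root_opp w A : wact_root w (opp_aff A) = opp_aff (wact_root w A).
Proof. by rewrite /wact_root /opp_aff /= mulNmx pairingNl opprB opprK addrC. Qed.

Definition aff_refl A (AP : affine_root D A) : W :=
  ExtW (A.2 *: coroot D A.1) (asboolT (in_W0_refl AP)).

Lemma aff_refl_invol A s : affine_root D A -> is_aff_refl A s -> (s * s = 1)%g.
Proof.
move=> AP [s1 s2]; apply: extW_eq; rewrite /= s1 ?refl_invol//.
rewrite reflV// s2 refl_mul pairingZr pairing_coroot//.
by apply/matrixP => i j; rewrite !mxE; ring.
Qed.

Lemma aff_reflV A s : affine_root D A -> is_aff_refl A s -> (s^-1 = s)%g.
Proof.
move=> AP /(aff_refl_invol AP) ss.
by rewrite -[LHS]mulg1 -ss mulgA mulVg mul1g.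
Qed.

Lemma wact_root_self A s : affine_root D A -> is_aff_refl A s ->
  wact_root s A = opp_aff A.
Proof.
case: A => a r AP As; rewrite (wact_root_refl _ As AP) /= pairing_coroot//.
rewrite /opp_aff /=; congr pair; last by ring.
by rewrite scaler_nat mulr2n opprD addNKr.
Qed.

Lemma aff_pos_or_opp A : affine_root D A -> aff_pos D A \/ aff_pos D (opp_aff A).
Proof.
move=> AP; have [r0|r0|r0] := ltgtP 0 A.2.
- by left; split=> //; left.
- by right; split; [exact: affine_root_opp|left; rewrite oppr_gt0].
- have [h|h] := base_span AP; first by left; split=> //; right.
  by right; split; [exact: affine_root_opp|right; rewrite /= -r0 oppr0].
Qed.

Lemma gen_subgroupP (G : groupType) (S : set G) : is_subgroup (gen_subgroup S).
Proof.
split; first by move=> P [].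
  by move=> x y xS yS P PS SP; have [_ + _] := PS; apply; [exact: xS|exact: yS].
by move=> x xS P PS SP; have [_ _] := PS; apply; exact: xS.
Qed.

Lemma gen_subgroup_sub (G : groupType) (S : set G) : S `<=` gen_subgroup S.
Proof. by move=> x xS P _; apply. Qed.

End AffineAction.

(** * The apartment: action of W, base chamber, separating hyperplanes and length *)

Section Apartment.
Context (K : realType) (n : nat) (D : root_system n) (P : apartment K D).
Local Notation V := 'cV[K]_(adim P).
Local Notation W := (extW D).
Implicit Types (v w s : W) (A B : 'rV[int]_n * int).

Local Notation mapK := (map_mx (intr : int -> K)).

Lemma aprojK (e : V) : aproj P *m alift e = e.
Proof.
have [x <-] := aproj_surj e.
have := mulmxKpV (submx_refl (aproj P)); rewrite /alift.
by move: (pinvmx _) => B h; rewrite !mulmxA h.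
Qed.

(** The kernel is the real span of Q^perp, which every reflection fixes. *)
Lemma aproj_ker_fix (g : 'M[int]_n) (x : 'cV[K]_n) : in_W0 D g ->
  aproj P *m x = 0 -> mapK g *m x = x.
Proof.
move=> [s [sP ->]] /aproj_ker[k [t [y [yQ ->]]]].
rewrite mulmx_sumr; apply: eq_bigr => i _.
rewrite -scalemxAr -map_mxM; congr (_ *: mapK _).
elim: s sP => [|a s IHs] sP /=; first by rewrite mul1mx.
rewrite -mulmxA IHs; last by move=> b bs; rewrite sP// inE bs orbT.
by rewrite refl_mul yQ ?sP ?mem_head// scale0r subr0.
Qed.

Lemma root_aproj_ker a (x : 'cV[K]_n) : a \in Phi D -> aproj P *m x = 0 ->
  mapK a *m x = 0.
Proof.
move=> aP /aproj_ker[k [t [y [yQ ->]]]]; rewrite mulmx_sumr big1// => i _.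
rewrite -scalemxAr -map_mxM pairing_scalar yQ//.
by apply/matrixP => j l; rewrite !mxE mul0rn mulr0.
Qed.

Lemma aproj_alift_sub (x : 'cV[K]_n) : aproj P *m (alift (aproj P *m x) - x) = 0.
Proof. by rewrite mulmxBr aprojK subrr. Qed.

Lemma root_alift a (x : 'cV[K]_n) : a \in Phi D ->
  mapK a *m alift (aproj P *m x) = mapK a *m x.
Proof.
move=> aP; apply/eqP; rewrite -subr_eq0 -mulmxBr.
by rewrite (root_aproj_ker aP) ?eqxx// aproj_alift_sub.
Qed.

(** A lift is determined only up to the kernel; this removes its choice from the action of W. *)
Lemma aproj_W0_alift (g : 'M[int]_n) (x y : 'cV[K]_n) : in_W0 D g ->
  aproj P *m (mapK g *m (alift (aproj P *m x) + y)) = aproj P *m (mapK g *m (x + y)).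
Proof.
move=> gW; apply/eqP; rewrite -subr_eq0 -!mulmxBr opprD addrACA subrr addr0.
by rewrite (aproj_ker_fix gW) ?aproj_alift_sub.
Qed.

Lemma wlin_W0 w : in_W0 D (wlin w). Proof. exact/asboolP/wlinP. Qed.

Lemma wactM v w (e : V) : wact (v * w)%g e = wact v (wact w e).
Proof.
rewrite /wact aproj_W0_alift; last exact: wlin_W0.
rewrite /= map_mxM -mulmxA; congr (_ *m (_ *m _)).
rewrite !mulmxDr -addrA; congr (_ + _).
by rewrite -!map_mxM -map_mxD mulmxDr mulmxA mulmxV ?wlin_unit// mul1mx addrC.
Qed.

Lemma wact1 (e : V) : wact (1 : W)%g e = e.
Proof.
rewrite /wact /= (_ : mapK 0 = 0) ?map_mx0// addr0.
by rewrite map_mx1 mul1mx aprojK.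
Qed.

Lemma wactVK w : cancel (wact w^-1%g : V -> V) (wact w).
Proof. by move=> e; rewrite -wactM mulgV wact1. Qed.

Definition lin_val (a : 'rV[int]_n) (u : V) : K := (mapK a *m alift u) 0 0.

Lemma aff_valE A (e : V) : aff_val A e = lin_val A.1 e + A.2%:~R.
Proof. by []. Qed.

Lemma lin_valD a (u u' : V) : lin_val a (u + u') = lin_val a u + lin_val a u'.
Proof. by rewrite /lin_val /alift !mulmxDr mxE. Qed.
Lemma lin_valN a (u : V) : lin_val a (- u) = - lin_val a u.
Proof. by rewrite /lin_val /alift !mulmxN mxE. Qed.
Lemma lin_valB a (u u' : V) : lin_val a (u - u') = lin_val a u - lin_val a u'.
Proof. by rewrite lin_valD lin_valN. Qed.
Lemma lin_valZ a k (u : V) : lin_val a (k *: u) = k * lin_val a u.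
Proof. by rewrite /lin_val /alift -!scalemxAr mxE. Qed.
Lemma lin_val0l (u : V) : lin_val 0 u = 0.
Proof. by rewrite /lin_val map_mx0 mul0mx mxE. Qed.
Lemma lin_valDl a b (u : V) : lin_val (a + b) u = lin_val a u + lin_val b u.
Proof. by rewrite /lin_val map_mxD mulmxDl mxE. Qed.
Lemma lin_valNl a (u : V) : lin_val (- a) u = - lin_val a u.
Proof. by rewrite /lin_val map_mxN mulNmx mxE. Qed.
Lemma lin_val_sum (r : seq 'rV[int]_n) (c : 'rV[int]_n -> nat) (u : V) :
  lin_val (\sum_(b <- r) b *+ c b) u = \sum_(b <- r) lin_val b u *+ c b.
Proof.
apply: (big_morph_comb (f := fun b => lin_val b u)); last exact: lin_val0l.
by move=> a b; exact: lin_valDl.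
Qed.

Lemma aff_val_opp A (e : V) : aff_val (opp_aff A) e = - aff_val A e.
Proof. by rewrite !aff_valE /= lin_valNl intrN opprD. Qed.

Lemma aff_valD A (e u : V) : aff_val A (e + u) = aff_val A e + lin_val A.1 u.
Proof. by rewrite !aff_valE lin_valD addrAC. Qed.

Lemma lin_val_aproj a (x : 'cV[K]_n) : a \in Phi D ->
  lin_val a (aproj P *m x) = (mapK a *m x) 0 0.
Proof. by move=> aP; rewrite /lin_val root_alift. Qed.

Lemma aff_val_wact w A (e : V) : affine_root D A ->
  aff_val (wact_root w A) (wact w e) = aff_val A e.
Proof.
move=> AP; have gP := affine_root_wact w AP.
rewrite !aff_valE /wact lin_val_aproj//= mulmxA -map_mxM.
rewrite mulmxKV ?wlin_unit// mulmxDr mxE -/(lin_val _ _) -map_mxM.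
by rewrite pairing_scalar /= !mxE eqxx mulr1n intrB addrACA subrr addr0.
Qed.

Lemma aff_val_wactV w A (e : V) : affine_root D A ->
  aff_val A (wact w^-1%g e) = aff_val (wact_root w A) e.
Proof. by move=> AP; rewrite -[in RHS](wactVK w e) aff_val_wact. Qed.

Lemma aff_val_wactE w A (e : V) : affine_root D A ->
  aff_val A (wact w e) = aff_val (wact_root w^-1%g A) e.
Proof. by move=> AP; rewrite -[w in LHS]invgK aff_val_wactV. Qed.

Lemma wact_linD w (u u' : V) : wact_lin w (u + u') = wact_lin w u + wact_lin w u'.
Proof. by rewrite /wact_lin /alift !mulmxDr. Qed.
Lemma wact_linZ w k (u : V) : wact_lin w (k *: u) = k *: wact_lin w u.
Proof. by rewrite /wact_lin /alift -!scalemxAr. Qed.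
Lemma wact_sub w (e e' : V) : wact w e - wact w e' = wact_lin w (e - e').
Proof.
rewrite /wact /wact_lin -mulmxBr -mulmxBr; congr (_ *m (_ *m _)).
by rewrite opprD addrACA subrr addr0 /alift mulmxBr.
Qed.
Lemma wact_shift w (e u : V) : wact w (e + u) = wact w e + wact_lin w u.
Proof.
have := wact_sub w (e + u) e; rewrite addrAC subrr add0r => <-.
by rewrite addrCA subrr addr0.
Qed.
Lemma wact_linM v w (u : V) : wact_lin (v * w)%g u = wact_lin v (wact_lin w u).
Proof.
have h x (e : V) : wact_lin x u = wact x (e + u) - wact x e.
  by rewrite wact_shift addrAC subrr add0r.
by rewrite (h _ 0) !wactM wact_sub wact_sub addrAC subrr add0r.
Qed.
Lemma wact_lin1 (u : V) : wact_lin (1 : W)%g u = u.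
Proof. by rewrite -[u in LHS]subr0 -wact_sub !wact1 subr0. Qed.
Lemma wact_linK w : cancel (wact_lin w : V -> V) (wact_lin w^-1%g).
Proof. by move=> u; rewrite -wact_linM mulVg wact_lin1. Qed.
Lemma wact_linVK w : cancel (wact_lin w^-1%g : V -> V) (wact_lin w).
Proof. by move=> u; rewrite -wact_linM mulgV wact_lin1. Qed.

(** A point where all simple roots equal 1. The base is independent over Z, hence over Q by clearing
    denominators and over K by extension of scalars, so the matrix of its elements has a right
    inverse. *)
Lemma base_direction : exists x : 'cV[K]_n,
  forall b, b \in Pi D -> (mapK b *m x) 0 0 = 1.
Proof.
pose k := #|` Pi D|%fset; pose bs (i : 'I_k) := nth 0 (Pi D) i.
pose M : 'M[int]_(k, n) := \matrix_i bs i.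
have sumE (c : 'I_k -> int) : \sum_i c i *: bs i = 0 -> forall i, c i = 0.
  move=> c0 i; pose c' (b : 'rV[int]_n) := \sum_(j | bs j == b) c j.
  have bsI : injective bs.
    by move=> j l /eqP; rewrite nth_uniq ?fset_uniq// => /eqP/val_inj.
  have c'E j : c' (bs j) = c j.
    by rewrite /c' (big_pred1 j)// => l; rewrite /= (inj_eq bsI).
  rewrite -c'E; apply: (base_free (r := D)); last exact/mem_nth.
  by rewrite (big_nth 0) big_mkord -[RHS]c0; apply: eq_bigr => j _; rewrite -[in RHS]c'E.
have Mfree : row_free (map_mx (intr : int -> rat) M).
  apply: inj_row_free => v vM; pose N := \prod_i denq (v 0 i).
  have N0 : N != 0 by apply/prodf_neq0 => i _; exact: denq_neq0.
  have vN i : v 0 i * N%:~R \is a Num.int.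
    rewrite /N (bigD1 i)//= intrM mulrA -numqE rpredM//; exact: rpred_int.
  pose c i := Num.floor (v 0 i * N%:~R).
  have cE i : (c i)%:~R = v 0 i * N%:~R by rewrite /c floorK.
  have c0 : \sum_i c i *: bs i = 0.
    apply/rowP => j; rewrite summxE mxE; apply: (@intr_inj rat).
    have /rowP/(_ j) := vM; rewrite !mxE => /(congr1 (fun z => z * N%:~R)).
    rewrite mul0r mulr_suml => vM0; rewrite rmorph_sum /= -[RHS]vM0.
    by apply: eq_bigr => i _; rewrite !mxE intrM cE mulrAC.
  apply/rowP => i; rewrite mxE; have := cE i; rewrite (sumE _ c0).
  by move=> /esym/eqP; rewrite mulf_eq0 intr_eq0 (negPf N0) orbF => /eqP.
have {}Mfree : row_free (mapK M).
  move: Mfree; rewrite -(row_free_map (ratr : rat -> K)) -map_mx_comp.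
  by congr (row_free _); apply/matrixP => i j; rewrite !mxE /= ratr_int.
exists (pinvmx (mapK M) *m const_mx 1) => b bP.
have ib : (index b (Pi D) < k)%N by rewrite index_mem.
have -> : mapK b = row (Ordinal ib) (mapK M).
  by rewrite -map_row rowK /bs /= nth_index.
by rewrite mulmxA -row_mul mulmxVp// -row_mul mul1mx !mxE.
Qed.

(** Divide the point of [base_direction] by N, so large that every root has absolute value less than
    1 there. A constant r >= 1 then dominates, and for r = 0 the sign is that of the height. *)
Lemma base_chamber_nonempty : exists e : V, base_chamber e.
Proof.
have [x x1] := base_direction.
have xpos a : a \in Phi D -> nneg_comb (Pi D) a -> 0 < (mapK a *m x) 0 0.
  move=> aP [c aE]; have lv : (mapK a *m x) 0 0 = (\sum_(b <- Pi D) c b)%:R.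
    rewrite {1}aE (big_morph_comb (f := fun b => (mapK b *m x) 0 0)).
    - rewrite natr_sum big_seq [RHS]big_seq.
      by apply: eq_bigr => b bP; rewrite x1// mulr1n.
    - by move=> b b'; rewrite map_mxD mulmxDl mxE.
    - by rewrite map_mx0 mul0mx mxE.
  rewrite lv ltr0n lt0n sum_nat_seq_neq0; apply: contraT => /hasPn c0.
  have := root_neq0 aP; rewrite aE big_seq big1 ?eqxx// => b /c0 /=.
  by rewrite negbK => /eqP->.
pose N : K := 1 + \sum_(a <- Phi D) `|(mapK a *m x) 0 0|.
have N0 : 0 < N by rewrite /N ltr_pwDl// sumr_ge0.
exists (aproj P *m (N^-1 *: x)) => -[a r] [aP pos]; rewrite /affine_root /= in aP pos.
rewrite aff_valE lin_val_aproj//= -scalemxAr mxE.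
have aN : `|N^-1 * (mapK a *m x) 0 0| < 1.
  rewrite normrM gtr0_norm ?invr_gt0// mulrC ltr_pdivrMr// mul1r /N.
  by rewrite (big_fsetD1 a)//= ltr_pwDl// lerDl sumr_ge0.
case: pos => [r0|[-> /(xpos _ aP) a0]]; last by rewrite addr0 mulr_gt0// invr_gt0.
have r1 : 1 <= r%:~R :> K by rewrite (ler_int K 1); lia.
by move: aN; rewrite ltr_norml => /andP[aN _]; lra.
Qed.

Definition base_pt : V := projT1 (cid base_chamber_nonempty).
Lemma base_ptP : base_chamber base_pt. Proof. exact: projT2 (cid _). Qed.

Lemma aff_pos_val A (e : V) : affine_root D A -> base_chamber e ->
  aff_pos D A <-> 0 < aff_val A e.
Proof.
move=> AP eC; split; first exact: eC.
have [//|/eC] := aff_pos_or_opp AP.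
by rewrite aff_val_opp oppr_gt0 => h1 h2; have := lt_trans h1 h2; rewrite ltxx.
Qed.

Lemma aff_neg_val A (e : V) : affine_root D A -> base_chamber e ->
  aff_neg D A <-> aff_val A e < 0.
Proof.
move=> AP eC; split=> [[_ /(aff_pos_val AP eC)/negP]|h].
  rewrite -leNgt le_eqVlt => /orP[/eqP e0|//].
  have [/eC|/eC] := aff_pos_or_opp AP; first by rewrite e0 ltxx.
  by rewrite aff_val_opp e0 oppr0 ltxx.
by split=> // /(aff_pos_val AP eC) /(lt_trans h); rewrite ltxx.
Qed.

Lemma aff_neg_opp A : affine_root D A -> aff_neg D A <-> aff_pos D (opp_aff A).
Proof.
move=> AP; have oP := affine_root_opp AP.
rewrite (aff_neg_val AP base_ptP) (aff_pos_val oP base_ptP) aff_val_opp oppr_gt0.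
by [].
Qed.

Lemma base_chamber_neq0 A (e : V) : affine_root D A -> base_chamber e ->
  aff_val A e != 0.
Proof.
move=> AP eC; have [/eC|/eC] := aff_pos_or_opp AP; first by move=> /gt_eqF->.
by rewrite aff_val_opp oppr_gt0 => /lt_eqF->.
Qed.

(** The hyperplanes strictly separating e from C, each named by its affine root that is positive on
    C. *)
Definition sep (e : V) : set ('rV[int]_n * int) :=
  [set B | aff_pos D B /\ aff_val B e < 0].

Lemma finite_sep e : finite_set (sep e).
Proof.
(* If (a, r) with r >= 0 is negative at e, then r < |<a, e>|, so N bounds all constants that
   occur. *)
pose N := (\sum_(a <- Phi D) Num.bound `|lin_val a e|)%N.
pose f (p : 'rV[int]_n * nat) : 'rV[int]_n * int := (p.1, p.2%:Z).
apply: (@sub_finite_set _ _ (f @` ([set` Phi D] `*` `I_N))).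
  move=> [a r] [[aP pos] /=]; rewrite aff_valE /= => neg.
  have r0 : 0 <= r by case: pos => /= [|[->]] //; lia.
  exists (a, `|r|%N); last by rewrite /f /= gez0_abs.
  split=> //=; rewrite /affine_root /= in aP.
  have := archi_boundP (normr_ge0 (lin_val a e)).
  rewrite /N (big_fsetD1 a)//=; set b := Num.bound _; set rest := (\sum_(_ <- _) _)%N.
  move=> hb; suff : (`|r| < b)%N by lia.
  rewrite -(ltr_nat K); apply: le_lt_trans hb.
  have -> : `|r|%N%:R = r%:~R :> K by rewrite -[in RHS](gez0_abs r0).
  by have := ler_norm (- lin_val a e); rewrite normrN; lra.
by apply: finite_image; apply: finite_setX; [exact: finite_fset|exact: finite_II].
Qed.

Definition nsep (e : V) : nat := #|` fset_set (sep e)|%fset.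

Lemma length_setE w (e : V) : base_chamber e ->
  [set A | aff_pos D A /\ aff_neg D (wact_root w A)] = sep (wact w^-1%g e).
Proof.
move=> eC; apply/seteqP; split=> B [BP].
  move=> /(aff_neg_val (affine_root_wact _ BP.1) eC) h; split=> //.
  by rewrite (aff_val_wactV _ _ BP.1).
move=> h; split=> //; apply/(aff_neg_val (affine_root_wact _ BP.1) eC).
by rewrite -(aff_val_wactV _ _ BP.1).
Qed.

Lemma finite_length_set w :
  finite_set [set A | aff_pos D A /\ aff_neg D (wact_root w A)].
Proof. by rewrite (length_setE _ base_ptP); exact: finite_sep. Qed.

Lemma wlengthE w (e : V) : base_chamber e -> wlength w = nsep (wact w^-1%g e).
Proof. by move=> eC; rewrite /wlength (length_setE _ eC). Qed.

(** B |-> - w B carries the inversions of w to those of w^-1. *)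
Lemma wlengthV w : wlength (w^-1)%g = wlength w.
Proof.
rewrite /wlength.
have -> : [set A | aff_pos D A /\ aff_neg D (wact_root w^-1%g A)] =
  (fun A => opp_aff (wact_root w A)) @` [set A | aff_pos D A /\ aff_neg D (wact_root w A)].
  apply/seteqP; split=> [B [BP Bn]|_ [B [BP Bn] <-]].
    exists (opp_aff (wact_root w^-1%g B)).
      split; first exact/(aff_neg_opp (affine_root_wact _ BP.1)).
      rewrite wact_root_opp wact_rootVK; apply/(aff_neg_opp (affine_root_opp BP.1)).
      by rewrite opp_affK.
    by rewrite wact_root_opp wact_rootVK opp_affK.
  have wB := affine_root_wact w BP.1; split; first exact/(aff_neg_opp wB).
  rewrite wact_root_opp wact_rootK; apply/(aff_neg_opp (affine_root_opp BP.1)).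
  by rewrite opp_affK.
rewrite card_fset_set_image//; last exact: finite_length_set.
by move=> A B /(congr1 (@opp_aff n)); rewrite !opp_affK => /(can_inj (wact_rootK w)).
Qed.

(** When v undoes no inversion of w, the inversions of v w are those of w together with the disjoint
    set of all w^-1 C, for C an inversion of v. *)
Lemma wlength_add v w :
  (forall B, aff_pos D B -> aff_neg D (wact_root w B) -> aff_neg D (wact_root (v * w)%g B)) ->
  wlength (v * w)%g = (wlength v + wlength w)%N.
Proof.
move=> h.
have -> : wlength (v * w)%g = #|` fset_set ((wact_root w^-1%g @`
    [set A | aff_pos D A /\ aff_neg D (wact_root v A)]) `|`
    [set A | aff_pos D A /\ aff_neg D (wact_root w A)])|%fset.
  congr (#|` fset_set _|%fset); apply/seteqP; split=> [B [BP Bn]|B [[C [CP Cn] <-]|[BP Bn]]].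
  - have wB := affine_root_wact w BP.1.
    have [wpos|] := pselect (aff_pos D (wact_root w B)); last by right.
    left; exists (wact_root w B); last by rewrite wact_rootK.
    by split=> //; rewrite -wact_rootM.
  - split; last by rewrite wact_rootM wact_rootVK.
    (* If w^-1 C were negative, - w^-1 C would be an inversion of w that v turns back into a
       positive root, against the hypothesis. *)
    apply: contrapT => npos; have wC := affine_root_wact w^-1%g CP.1.
    have opos : aff_pos D (opp_aff (wact_root w^-1%g C)) by exact/(aff_neg_opp wC).
    have := h _ opos; rewrite wact_root_opp wact_rootVK.
    move=> []; first by apply/(aff_neg_opp (affine_root_opp CP.1)); rewrite opp_affK.
    rewrite wact_rootM wact_root_opp wact_rootVK wact_root_opp => _; apply.
    exact/(aff_neg_opp (affine_root_wact v CP.1)).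
  - by split=> //; exact: h.
rewrite fset_setU; [|exact/finite_image/finite_length_set|exact: finite_length_set].
rewrite cardfsU card_fset_set_image; [|exact: can_inj (wact_rootVK w)|exact: finite_length_set].
rewrite (_ : (_ `&` _)%fset = fset0) ?cardfs0 ?subn0//.
apply/fsetP => B; rewrite !inE; apply/negbTE/negP => /andP[].
rewrite in_fset_set; last exact/finite_image/finite_length_set.
rewrite in_fset_set; last exact: finite_length_set.
move=> /set_mem[C [CP Cn] <-] /set_mem[_ []].
by rewrite wact_rootVK.
Qed.

Lemma OmegaP w : Omega w <-> forall B, aff_pos D B -> aff_pos D (wact_root w B).
Proof.
rewrite /Omega /= /wlength; split=> [/eqP|h].
  rewrite cardfs_eq0 => /eqP e B BP; apply: contrapT => npos.
  have : B \in fset_set [set A | aff_pos D A /\ aff_neg D (wact_root w A)].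
    rewrite in_fset_set; last exact: finite_length_set.
    by apply/mem_set; split=> //; split=> //; exact: affine_root_wact BP.1.
  by rewrite e.
apply/eqP; rewrite cardfs_eq0; apply/eqP/fsetP => B.
rewrite in_fset_set; last exact: finite_length_set.
by rewrite inE; apply/negbTE/negP => /set_mem[/h ? []].
Qed.

Lemma Omega1 : Omega (1 : W)%g.
Proof. by apply/OmegaP => B; rewrite wact_root1. Qed.

Lemma OmegaV w : Omega w -> Omega w^-1%g.
Proof. by rewrite /Omega /= wlengthV. Qed.

Lemma wlength_mul_Omega w x : Omega x -> wlength (w * x)%g = wlength w.
Proof.
move=> xO; rewrite wlength_add; first by rewrite [wlength x]xO addn0.
by move=> B /((OmegaP x).1 xO) ? [].
Qed.

(** By [simple_refl_pos], s matches the hyperplanes separating s e from C with those separating e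
    from C other than that of A. *)
Lemma nsep_refl A s (e : V) : simple_aff D A -> is_aff_refl A s ->
  aff_val A e < 0 -> nsep e = (nsep (wact s e)).+1.
Proof.
move=> AS As neg; have AP := simple_affine_root AS.
have sV := aff_reflV AP As.
have -> : nsep e = #|` fset_set (A |` (wact_root s @` sep (wact s e)))|%fset.
  congr (#|` fset_set _|%fset); apply/seteqP; split=> [B [BP Bn]|_ [->|[B [BP Bn] <-]]].
  - have [->|BA] := pselect (B = A); first by left.
    right; exists (wact_root s B); last by rewrite -{1}sV wact_rootK.
    split; first exact: simple_refl_pos As BP BA.
    by rewrite (aff_val_wact _ _ BP.1).
  - by split=> //; exact: simple_aff_pos.
  - have BA : B <> A.
      move=> BA; move: Bn; rewrite BA aff_val_wactE// sV (wact_root_self AP As).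
      by rewrite aff_val_opp oppr_lt0 => /(lt_trans neg); rewrite ltxx.
    split; first exact: simple_refl_pos As BP BA.
    by rewrite -[s]sV -(aff_val_wactE _ _ BP.1).
rewrite fset_setU1; last exact/finite_image/finite_sep.
rewrite cardfsU1 card_fset_set_image; [|by rewrite -sV; exact: can_inj (wact_rootVK s)|exact: finite_sep].
rewrite in_fset_set; last exact/finite_image/finite_sep.
rewrite (_ : A \in _ = false)//; apply/negbTE/negP => /set_mem[B [[BP Bpos] Bn]].
move=> /(congr1 (wact_root s)); rewrite -{1}sV wact_rootK (wact_root_self AP As) => BA.
have /(aff_neg_opp AP)[_] : aff_pos D (opp_aff A) by rewrite -BA.
by apply; exact: simple_aff_pos.
Qed.

Lemma wlength_refl_neg A s w : simple_aff D A -> is_aff_refl A s ->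
  aff_neg D (wact_root w A) -> wlength w = (wlength (w * s)%g).+1.
Proof.
move=> AS As neg; have AP := simple_affine_root AS.
rewrite !(wlengthE _ base_ptP) invgM wactM (aff_reflV AP As).
apply: (nsep_refl AS As); rewrite aff_val_wactV//.
by apply/aff_neg_val => //; [exact: affine_root_wact|exact: base_ptP].
Qed.

Lemma wlength_refl_pos A s w : simple_aff D A -> is_aff_refl A s ->
  aff_pos D (wact_root w A) -> wlength (w * s)%g = (wlength w).+1.
Proof.
move=> AS As pos; have AP := simple_affine_root AS.
have wA := affine_root_wact w AP.
rewrite (wlength_refl_neg AS As (w := (w * s)%g)); first by rewrite -mulgA (aff_refl_invol AP As) mulg1.
rewrite wact_rootM (wact_root_self AP As) wact_root_opp.
by apply/(aff_neg_opp (affine_root_opp wA)); rewrite opp_affK.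
Qed.

Lemma S_aff_length (s : W) : S_aff s -> wlength s = 1%N.
Proof.
move=> [A AS As]; rewrite -[s]mul1g (wlength_refl_pos AS As).
  by have /= -> := Omega1.
by rewrite wact_root1; exact: simple_aff_pos.
Qed.

Lemma S_aff_invol (s : W) : S_aff s -> (s * s = 1)%g.
Proof. by move=> [A /simple_affine_root AP]; exact: aff_refl_invol. Qed.

Lemma aff_refl_ex A : affine_root D A -> exists s : W, is_aff_refl A s.
Proof. by move=> AP; exists (aff_refl AP). Qed.

(** For r >= 1 choose a minimal root a below b: then (b, r) is (a, 1) plus a nonnegative combination
    of the base plus the constant r - 1. *)
Lemma simple_aff_ge0 (e : V) : (forall A, simple_aff D A -> 0 <= aff_val A e) ->
  forall B, aff_pos D B -> 0 <= aff_val B e.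
Proof.
move=> h; have pos0 x : nneg_comb (Pi D) x -> 0 <= lin_val x e.
  move=> [c ->]; rewrite lin_val_sum big_seq sumr_ge0// => b bP.
  by rewrite mulrn_wge0//; have := h (b, 0) (or_introl (conj bP erefl)); rewrite aff_valE addr0.
move=> [b r] [bP]; rewrite aff_valE /= => -[r0|[-> /pos0]]; last by rewrite addr0.
have [a amin ab] := minimal_root_below bP.
have := h (a, 1) (or_intror (conj amin erefl)); rewrite aff_valE /= => a0.
have := pos0 _ ab; rewrite lin_valDl lin_valNl => ba.
have r1 : 1 <= r%:~R :> K by rewrite (ler_int K 1); lia.
by move: a0; rewrite mulr1z; lra.
Qed.

Lemma nsep_gt0 (e : V) : (0 < nsep e)%N ->
  exists2 A, simple_aff D A & aff_val A e < 0.
Proof.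
move=> e0; apply: contrapT => nex; move: e0; rewrite /nsep.
have -> : sep e = set0; last by rewrite fset_set0 cardfs0.
apply/seteqP; split=> // B [BP]; rewrite ltNge simple_aff_ge0// => A AS.
by rewrite leNgt; apply/negP => neg; apply: nex; exists A.
Qed.

Lemma nsep_eq0 (e : V) : nsep e = 0%N -> forall B, aff_pos D B -> 0 <= aff_val B e.
Proof.
move=> /eqP; rewrite cardfs_eq0 => /eqP e0 B BP; rewrite leNgt; apply/negP => neg.
have : B \in fset_set (sep e) by rewrite in_fset_set; [exact/mem_set|exact: finite_sep].
by rewrite e0.
Qed.

End Apartment.

(** * Facets, galleries and the chambers C(F) *)

Lemma small_seq (K : realFieldType) (I : eqType) (s : seq I) (Q : I -> K -> Prop) :
  (forall i, i \in s -> exists2 t0, 0 < t0 & forall t, 0 < t <= t0 -> Q i t) ->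
  exists2 t0, 0 < t0 & forall t, 0 < t <= t0 -> forall i, i \in s -> Q i t.
Proof.
elim: s => [|i s IHs] h; first by exists 1.
have [|t1 t1p h1] := IHs; first by move=> j js; apply: h; rewrite inE js orbT.
have [t2 t2p h2] := h i (mem_head _ _).
exists (Order.min t1 t2) => [|t]; first by rewrite lt_min t1p.
rewrite le_min => /and3P[t0 tt1 tt2] j; rewrite inE => /orP[/eqP->|].
  by apply: h2; rewrite t0.
by apply: h1; rewrite t0.
Qed.

Lemma sgr_perturb (K : realFieldType) (x y d : K) :
  d <= `|x| -> `|y| < d -> Num.sg (x + y) = Num.sg x.
Proof.
move=> dx; rewrite ltr_norml => /andP[y1 y2].
have [x0|x0|x0] := ltgtP x 0; move: dx; last first.
- by rewrite x0 normr0; lra.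
- by rewrite (gtr0_norm x0) => dx; rewrite !gtr0_sg//; lra.
- by rewrite (ltr0_norm x0) => dx; rewrite !ltr0_sg//; lra.
Qed.

Section Facets.
Context (K : realType) (n : nat) (D : root_system n) (P : apartment K D).
Local Notation V := 'cV[K]_(adim P).
Local Notation W := (extW D).
Local Notation C0 := (@base_chamber K n D P).
Implicit Types (v w s : W) (A B : 'rV[int]_n * int) (e u : V) (E F G : facet P).

(** The values <a, e> + r form a translate of Z, so the nonzero ones stay away from 0. Uniformity in
    r is what copes with infinitely many affine roots. *)
Lemma aff_val_gap a e : exists2 d : K, 0 < d &
  forall r, aff_val (a, r) e != 0 -> d <= `|aff_val (a, r) e|.
Proof.
pose x := lin_val a e; pose k := Num.floor x.
have /andP[k1 k2] := floor_itv x; rewrite -/k intrD in k1 k2.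
have gapr r : r = - k \/ (1 <= x + r%:~R - (x - k%:~R)) \/ (x + r%:~R - (x - k%:~R) <= -1).
  have [rk|rk|->] := ltgtP (- k) r; last by left.
    right; left; have : (1 - k)%:~R <= r%:~R :> K by rewrite ler_int; lia.
    by rewrite intrB; lra.
  right; right; have : r%:~R <= (- k - 1)%:~R :> K by rewrite ler_int; lia.
  by rewrite intrB intrN; lra.
have [xk|xk] := eqVneq x k%:~R.
  exists 1 => // r; rewrite aff_valE /= -/x.
  by case: (gapr r) => [->|]; rewrite xk ?intrN ?subrr ?eqxx// subr0 => -[h _|h _];
    rewrite ler_normr; apply/orP; [left|right; lra].
exists (Order.min (x - k%:~R) (1 - (x - k%:~R))).
  by rewrite lt_min; apply/andP; split; [rewrite subr_gt0 lt_neqAle eq_sym xk|lra].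
move=> r _; rewrite aff_valE /= -/x ler_normr !ge_min.
by case: (gapr r) => [->|[h|h]]; rewrite ?intrN; apply/orP;
  [left; rewrite lexx|left; apply/orP; left; lra|right; apply/orP; right; lra].
Qed.

Lemma aff_val_perturb e u : exists2 t0 : K, 0 < t0 &
  forall t, 0 < t <= t0 -> forall B, affine_root D B -> aff_val B e != 0 ->
    Num.sg (aff_val B (e + t *: u)) = Num.sg (aff_val B e).
Proof.
have [|t0 t0p h] := @small_seq K _ (Phi D) (fun a t => forall r, aff_val (a, r) e != 0 ->
    Num.sg (aff_val (a, r) (e + t *: u)) = Num.sg (aff_val (a, r) e)).
  move=> a aP; have [d d0 gap] := aff_val_gap a e.
  have y0 : 0 < 1 + `|lin_val a u| by rewrite ltr_pwDl.
  exists (d / (1 + `|lin_val a u|)) => [|t /andP[tp td] r /gap dr]; first exact: divr_gt0.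
  rewrite aff_valD; apply: sgr_perturb dr _.
  rewrite lin_valZ normrM (gtr0_norm tp).
  rewrite ler_pdivlMr// mulrDr mulr1 in td; apply: lt_le_trans td.
  by rewrite ltrDr.
by exists t0 => // t /h h' [a r] BP; exact: h'.
Qed.

Definition facet_at e : facet P := Facet (asboolT (ex_intro _ e erefl)).

Lemma facet_at_self e : fpts (facet_at e) e. Proof. by []. Qed.

Lemma facet_eq F G : fpts F = fpts G -> F = G.
Proof. by move=> FG; exact: (@val_inj _ _ (facet P)). Qed.

Lemma facet_of_wact w e : wact w @` facet_of e = facet_of (wact w e).
Proof.
apply/seteqP; split=> [_ [u ue <-] A AP|u ue].
  by rewrite !aff_val_wactE// ue//; exact: affine_root_wact.
exists (wact w^-1%g u); last exact: wactVK.
move=> A AP; rewrite aff_val_wactV// ue; last exact: affine_root_wact.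
by rewrite aff_val_wact.
Qed.

Fact wfacet_subproof w F : `[< exists e, wact w @` F = facet_of e >].
Proof.
apply/asboolP; have /asboolP[e ->] := fptsP F.
by exists (wact w e); exact: facet_of_wact.
Qed.
Definition wfacet w F : facet P := Facet (wfacet_subproof w F).

Lemma wfacet_pt w F e : fpts F e -> fpts (wfacet w F) (wact w e).
Proof. by move=> Fe; exists e. Qed.

Lemma wfacetM v w F : wfacet (v * w)%g F = wfacet v (wfacet w F).
Proof.
apply: facet_eq; apply/seteqP; split=> [_ [e Fe <-]|_ [_ [e Fe <-] <-]].
  by exists (wact w e); [exists e|rewrite wactM].
by exists e => //; rewrite wactM.
Qed.

Lemma wfacet1 F : wfacet 1%g F = F.
Proof.
apply: facet_eq; apply/seteqP; split=> [_ [e Fe <-]|e Fe]; first by rewrite wact1.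
by exists e => //; rewrite wact1.
Qed.

Lemma wfacetK w : cancel (wfacet w) (wfacet w^-1%g).
Proof. by move=> F; rewrite -wfacetM mulVg wfacet1. Qed.

Lemma wfacetVK w : cancel (wfacet w^-1%g) (wfacet w).
Proof. by move=> F; rewrite -wfacetM mulgV wfacet1. Qed.

Lemma closure_segment (X : set V) e u (t0 : K) : 0 < t0 ->
  (forall t, 0 < t <= t0 -> X (e + t *: u)) -> closure X e.
Proof.
move=> t0p h Y Ye.
have cont : (fun t : K => e + t *: u) t @[t --> (0 : K)] --> e.
  rewrite -[e in X in _ --> X]addr0 -[0 in X in _ --> X](scale0r u).
  by apply: cvgD; [exact: cvg_cst|apply: cvgZr_tmp; exact: cvg_id].
have /nbhs_ballP[r /= r0 hr] := cont _ Ye.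
pose t := Order.min t0 (r / 2).
have tp : 0 < t by rewrite lt_min t0p divr_gt0.
exists (e + t *: u); split; first by apply: h; rewrite tp ge_min lexx.
apply: hr; rewrite /ball /= sub0r normrN gtr0_norm//.
by rewrite (le_lt_trans (y := r / 2))// ?ge_min ?lexx ?orbT//; lra.
Qed.

(** Closure is read off from signs: in passing from G to F only zeros may change. One point of each
    facet suffices since signs are constant on facets. *)
Lemma is_faceP G F e u : fpts G e -> fpts F u ->
  is_face G F <-> forall B, affine_root D B -> 0 < aff_val B e -> 0 < aff_val B u.
Proof.
move=> Ge Fu; split=> [GF B BP e0|h e' Ge'].
  rewrite ltNge; apply/negP => u0; have := e0; rewrite ltNge => /negP; apply.
  apply: (face_aff_le0 GF) Ge => u' Fu'.
  by rewrite -sgr_le0 (facet_sg BP Fu' Fu) sgr_le0.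
(* For small t the point e' + t (u - e') keeps the nonzero signs of e', which are also those of u,
   and takes the signs of u where e' vanishes. So it lies in F and tends to e'. *)
have [t0 t0p ht] := aff_val_perturb e' (u - e').
apply: (@closure_segment _ e' (u - e') (Order.min t0 1)); first by rewrite lt_min t0p ltr01.
move=> t; rewrite le_min => /and3P[tp tt0 t1].
rewrite (facetE Fu) => B BP.
have [e0|e0] := eqVneq (aff_val B e') 0.
  rewrite aff_valD e0 add0r lin_valZ lin_valB.
  have -> : lin_val B.1 u - lin_val B.1 e' = aff_val B u.
    by rewrite -[RHS]subr0 -e0 !aff_valE; ring.
  by rewrite sgrM gtr0_sg// mul1r.
rewrite ht ?tp// (facet_sg BP Ge' Ge).
have : aff_val B e != 0 by rewrite -sgr_eq0 (facet_sg BP Ge Ge') sgr_eq0.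
rewrite neq_lt => /orP[neg|pos].
  have := h _ (affine_root_opp BP); rewrite !aff_val_opp !oppr_gt0 => /(_ neg) neg'.
  by rewrite !ltr0_sg.
by rewrite !gtr0_sg//; exact: h.
Qed.

Lemma is_face_wfacet w G F : is_face (wfacet w G) (wfacet w F) <-> is_face G F.
Proof.
have Gg := facet_ptP G; have Ff := facet_ptP F.
rewrite (is_faceP Gg Ff) (is_faceP (wfacet_pt w Gg) (wfacet_pt w Ff)).
split=> h B BP.
  by have := h _ (affine_root_wact w BP); rewrite !aff_val_wact.
by rewrite !aff_val_wactE//; apply: h; exact: affine_root_wact.
Qed.

Lemma base_facetE e : base_chamber e -> facet_of e = C0.
Proof.
move=> eC; apply/seteqP; split=> [u ue A Apos|u uC A AP].
  by rewrite -sgr_gt0 ue ?sgr_gt0; [exact: eC|exact: Apos.1].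
have [Apos|npos] := pselect (aff_pos D A).
  by rewrite !gtr0_sg//; [exact: eC|exact: uC].
have neg : aff_neg D A by [].
by rewrite !ltr0_sg//; exact/aff_neg_val.
Qed.

Definition base_facet : facet P := facet_at (base_pt P).
Lemma base_facet_val : fpts base_facet = C0.
Proof. exact: (base_facetE (base_ptP P)). Qed.

Definition inCbar F := is_face F C0.

Lemma inCbarP F e : fpts F e ->
  inCbar F <-> forall B, aff_pos D B -> 0 <= aff_val B e.
Proof.
move=> Fe; rewrite /inCbar -base_facet_val.
rewrite (is_faceP Fe (facet_at_self _)); split=> h B BP.
  rewrite leNgt; apply/negP => neg; have := h _ (affine_root_opp BP.1).
  rewrite !aff_val_opp !oppr_gt0 => /(_ neg)/(lt_trans (base_ptP P BP)).
  by rewrite ltxx.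
move=> pos; apply/(aff_pos_val BP (base_ptP P)); apply: contrapT => npos.
have : aff_pos D (opp_aff B) by exact/(aff_neg_opp P BP).
by move=> /h; rewrite aff_val_opp oppr_ge0 => /(lt_le_trans pos); rewrite ltxx.
Qed.

Fact lin_val_is_linear a : linear (lin_val (P := P) a : V -> K^o).
Proof. by move=> k u u'; rewrite lin_valD lin_valZ. Qed.
HB.instance Definition _ a := GRing.isLinear.Build K V K^o *:%R
  (lin_val (P := P) a : V -> K^o) (lin_val_is_linear a).

Definition lin_hom a : 'Hom(V, K^o) := linfun (lin_val (P := P) a : V -> K^o).

Lemma mem_lker_lin_hom a u : (u \in lker (lin_hom a)) = (lin_val a u == 0).
Proof. by rewrite memv_ker lfunE. Qed.

Lemma lin_val_coroot a b : a \in Phi D -> b \in Phi D ->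
  lin_val b (aproj P *m map_mx intr (coroot D a)) = (pairing b (coroot D a))%:~R.
Proof.
by move=> aP bP; rewrite lin_val_aproj// -map_mxM pairing_scalar !mxE eqxx mulr1n.
Qed.

Lemma dim_lker_lin_hom a : a \in Phi D -> (\dim (lker (lin_hom a))).+1 = \dim {:V}.
Proof.
move=> aP; rewrite -[in RHS](limg_ker_dim (lin_hom a) fullv) capfv -addn1.
congr addn; apply/esym/eqP; rewrite eqn_leq lt0n dimv_eq0.
have /dimvS : (limg (lin_hom a) <= fullv)%VS by exact: subvf.
rewrite [X in (_ <= X)%N]dimvf /dim /= => -> /=.
apply/eqP => l0; have := memv_img (lin_hom a) (memvf (aproj P *m map_mx intr (coroot D a))).
rewrite l0 memv0 lfunE /= lin_val_coroot// pairing_coroot//.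
by rewrite intr_eq0.
Qed.

Lemma dir_exists e : exists U : {vspace V}, forall u, u \in U <->
  forall B, affine_root D B -> aff_val B e = 0 -> lin_val B.1 u = 0.
Proof.
have [U UP] : exists U : {vspace V}, forall u, u \in U <->
    forall a, a \in (Phi D : seq _) -> (exists r, aff_val (a, r) e = 0) -> lin_val a u = 0.
  elim: (Phi D : seq _) => [|a s [U UP]].
    by exists fullv => u; split=> // _; rewrite memvf.
  have [ae|nae] := pselect (exists r, aff_val (a, r) e = 0).
    exists (U :&: lker (lin_hom a))%VS => u; rewrite memv_cap mem_lker_lin_hom; split.
      move=> /andP[/UP Uu /eqP au] b; rewrite inE => /orP[/eqP->//|bs].
      exact: Uu.
    move=> h; apply/andP; split; last by apply/eqP/h => //; exact: mem_head.
    by apply/UP => b bs; apply: h; rewrite inE bs orbT.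
  exists U => u; rewrite UP; split=> h b bs be; last by apply: h; rewrite ?inE ?bs ?orbT.
  by move: bs; rewrite inE => /orP[/eqP ba|bs]; [rewrite ba in be|exact: h].
exists U => u; rewrite UP; split=> [h [a r] aP ae|h a aP [r ae]].
  by apply: h => //; exists r.
exact: (h (a, r)).
Qed.

Lemma facet_shift F e u : fpts F e ->
  (forall B, affine_root D B -> aff_val B e = 0 -> lin_val B.1 u = 0) ->
  exists2 t : K, 0 < t & fpts F (e + t *: u).
Proof.
move=> Fe u0; have [t t0 ht] := aff_val_perturb e u; exists t => //.
rewrite (facetE Fe) => B BP; have [e0|e0] := eqVneq (aff_val B e) 0.
  by rewrite aff_valD lin_valZ u0// mulr0 addr0.
by apply: ht => //; rewrite t0 /=.
Qed.

(** The affine span of F is cut out by the hyperplanes containing F, because from a point of F one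
    can move a little in every direction along them ([facet_shift]). *)
Lemma directionP F e u : fpts F e -> u \in direction F <->
  forall B, affine_root D B -> aff_val B e = 0 -> lin_val B.1 u = 0.
Proof.
move=> Fe; have [U UP] := dir_exists e; rewrite -UP.
suff UF : is_direction F U.
  rewrite /direction; case: xgetP => [U' _ [U'1 U'2]|/(_ U)//].
  have [U1 U2] := UF; suff -> : U' = U by [].
  by apply/eqP; rewrite eqEsubv U'2//= U2.
split=> [x y Fx Fy|U' U'F].
  apply/UP => B BP e0; have z0 z : fpts F z -> aff_val B z = 0.
    by move=> Fz; apply/eqP; rewrite -sgr_eq0 (facet_sg BP Fz Fe) sgr_eq0 e0.
  rewrite lin_valB; have -> : lin_val B.1 x - lin_val B.1 y = aff_val B x - aff_val B y.
    by rewrite !aff_valE; ring.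
  by rewrite !z0// subrr.
apply/subvP => x /UP Ux; have [t t0 Ft] := facet_shift Fe Ux.
have : e + t *: x - e \in U' by exact: U'F.
rewrite addrAC subrr add0r => /(memvZ t^-1).
by rewrite scalerA mulVf ?scale1r// (gt_eqF t0).
Qed.

(** * Chambers, galleries and the gate property *)

Lemma is_chamberP F e : fpts F e ->
  is_chamber F <-> forall B, affine_root D B -> aff_val B e != 0.
Proof.
move=> Fe; split=> h B; first by move=> BP; exact: h.
by move=> e' BP Fe'; rewrite -sgr_eq0 (facet_sg BP Fe' Fe) sgr_eq0 h.
Qed.

Lemma base_facet_chamber : is_chamber base_facet.
Proof.
apply/(is_chamberP (facet_at_self _)) => B BP.
exact: base_chamber_neq0 BP (base_ptP P).
Qed.

Lemma chamber_wfacet w F : is_chamber (wfacet w F) <-> is_chamber F.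
Proof.
have Ff := facet_ptP F; rewrite (is_chamberP Ff) (is_chamberP (wfacet_pt w Ff)).
split=> h B BP.
  by have := h _ (affine_root_wact w BP); rewrite aff_val_wact.
by rewrite aff_val_wactE//; apply: h; exact: affine_root_wact.
Qed.

Lemma chamber_fdim F : is_chamber F -> fdim F = \dim {:V}.
Proof.
have Ff := facet_ptP F => /(is_chamberP Ff) h; congr (\dim _).
apply/vspaceP => u; rewrite memvf; apply/(directionP _ Ff) => B BP /eqP.
by rewrite (negPf (h B BP)).
Qed.

Lemma lin_val_wact w B u : affine_root D B ->
  lin_val (wact_root w B).1 (wact_lin w u) = lin_val B.1 u.
Proof.
move=> BP; have h A e x : lin_val A.1 x = aff_val A (e + x) - aff_val A e :> K.
  by rewrite aff_valD addrAC subrr add0r.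
rewrite (h _ (wact w 0)) -wact_shift !aff_val_wact// -h.
Qed.

Lemma direction_wfacet w F u : (wact_lin w u \in direction (wfacet w F)) = (u \in direction F).
Proof.
have Ff := facet_ptP F; apply/idP/idP.
  move=> /(directionP _ (wfacet_pt w Ff)) h; apply/(directionP _ Ff) => B BP B0.
  rewrite -(lin_val_wact w u BP); apply: h; first exact: affine_root_wact.
  by rewrite aff_val_wact.
move=> /(directionP _ Ff) h; apply/(directionP _ (wfacet_pt w Ff)) => B BP.
have BP' := affine_root_wact w^-1%g BP.
rewrite aff_val_wactE// -[B in lin_val B.1](wact_rootVK w) lin_val_wact//.
exact: h.
Qed.

Lemma fdim_wfacet w F : fdim (wfacet w F) = fdim F.
Proof.
have lf : linear (wact_lin w : V -> V) by move=> k x y; rewrite wact_linD wact_linZ.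
pose L := HB.pack_for {linear V -> V} (wact_lin w : V -> V) (GRing.isLinear.Build _ _ _ _ _ lf).
rewrite /fdim; have -> : direction (wfacet w F) = (linfun L @: direction F)%VS.
  apply/vspaceP => u; apply/idP/memv_imgP => [uF|[x xF ->]].
    exists (wact_lin w^-1%g u); last by rewrite lfunE /= wact_linVK.
    by rewrite -(direction_wfacet w) wact_linVK.
  by rewrite lfunE /= direction_wfacet.
apply: limg_dim_eq; apply/eqP; rewrite -subv0; apply/subvP => u.
rewrite memv_cap memv_ker lfunE memv0 /= => /andP[_ /eqP u0].
by rewrite -(wact_linK w u) u0 /wact_lin /alift !mulmx0.
Qed.

(** A hyperplane separating E from F contains their common face G of codimension one, hence has the
    direction of G. Two such have proportional gradients, so they agree up to sign by reducedness,
    and positivity on E fixes the sign. *)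
Lemma adjacent_nsep E F e f : adjacent E F -> fpts E e -> fpts F f ->
  (nsep f <= (nsep e).+1)%N.
Proof.
move=> [Ech Fch _ [G [GE GF dG]]] Ee Ff; have Gg := facet_ptP G.
set g := facet_pt G in Gg; pose X := [set B | aff_pos D B /\ 0 < aff_val B e /\ aff_val B f < 0].
have Xg B : X B -> aff_val B g = 0.
  move=> [[BP _] [e0 f0]]; apply/eqP; rewrite eq_le !leNgt; apply/andP; split; apply/negP => g0.
    have := (is_faceP Gg Ff).1 GF _ BP g0.
    by move=> /(lt_trans f0); rewrite ltxx.
  have := (is_faceP Gg Ee).1 GE _ (affine_root_opp BP).
  rewrite !aff_val_opp !oppr_gt0 => /(_ g0)/(lt_trans e0).
  by rewrite ltxx.
have kerE B : X B -> direction G = lker (lin_hom B.1).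
  move=> XB; have BP : affine_root D B by case: XB => -[].
  apply/eqP; rewrite eqEdim -ltnS (dim_lker_lin_hom BP) dG (chamber_fdim Ech) leqnn andbT.
  apply/subvP => u /(directionP _ Gg) h; rewrite mem_lker_lin_hom; apply/eqP.
  by apply: h => //; exact: Xg.
have Xsub A B : X A -> X B -> A = B.
  move=> XA XB; have [AP Apos] : aff_pos D A by case: XA.
  have [BP Bpos] : aff_pos D B by case: XB.
  pose u1 : V := aproj P *m map_mx intr (coroot D A.1).
  pose m := pairing B.1 (coroot D A.1).
  (* Subtracting from u its component along the coroot of A lands in the common kernel. Thus 2 B.1 =
     m A.1, the relation to which [root_reduced] applies. *)
  have prop u : lin_val A.1 u * m%:~R = 2 * lin_val B.1 u.
    have : u - (lin_val A.1 u / 2) *: u1 \in lker (lin_hom B.1).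
      rewrite -(kerE B XB) (kerE A XA) mem_lker_lin_hom lin_valB lin_valZ.
      by rewrite /u1 lin_val_coroot// pairing_coroot// mulrAC mulfK ?subrr// intr_eq0.
    rewrite mem_lker_lin_hom lin_valB lin_valZ /u1 lin_val_coroot// -/m subr_eq0 => /eqP ->.
    by field.
  have : 2 *: B.1 = m *: A.1.
    apply/rowP => j; apply: (@intr_inj K); have := prop (aproj P *m delta_mx j 0).
    rewrite !lin_val_aproj// -!colE !mxE !intrM => h.
    by rewrite [RHS]mulrC h.
  move=> /(root_reduced AP BP) h.
  have gA := Xg A XA; have gB := Xg B XB; rewrite aff_valE in gA gB.
  have [//|BA|BA] := h.
    case: A B BA {XA XB AP Apos BP Bpos prop h u1 m} gA gB => [a r] [b q] /= -> <- /addrI /eqP.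
    by rewrite /= eqr_int => /eqP->.
  exfalso; have : B = opp_aff A.
    case: A B BA {XA XB AP Apos BP Bpos prop h u1 m} gA gB => [a r] [b q] /= -> gA gB.
    congr pair; apply: (@intr_inj K); rewrite intrN.
    by move: gB; rewrite aff_valE /= lin_valNl; lra.
  move=> BE; have [_ [e0 _]] := XA; have [_ [e1 _]] := XB.
  by move: e1; rewrite BE aff_val_opp oppr_gt0 => /(lt_trans e0); rewrite ltxx.
have sub : sep f `<=` sep e `|` X.
  move=> B [BP neg]; have [e0|e0] := ltP (aff_val B e) 0; first by left.
  right; split=> //; split=> //; rewrite lt_neqAle e0 eq_sym andbT.
  by apply/(is_chamberP Ee).1 => //; exact: BP.1.
have [[A XA]|nX] := pselect (exists A, X A).
  have : (fset_set (sep f) `<=` A |` fset_set (sep e))%fset.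
    apply/fsubsetP => B; rewrite in_fset_set; last exact: finite_sep.
    move=> /set_mem/sub[Be|XB]; rewrite !inE; last by rewrite (Xsub _ _ XB XA) eqxx.
    by rewrite in_fset_set ?(mem_set Be) ?orbT//; exact: finite_sep.
  move=> /fsubset_leq_card; rewrite cardfsU1 => /leq_trans; apply.
  by rewrite -[(nsep e).+1]add1n leq_add2r; case: (_ \notin _).
apply: leqW; apply: fsubset_leq_card; apply/fsubsetP => B.
rewrite !in_fset_set; [|exact: finite_sep..] => /set_mem/sub[|XB]; first exact: mem_set.
by exfalso; apply: nX; exists B.
Qed.

(** The midpoint p of v0 and s v0 lies on the hyperplane of A and, since s preserves the other
    positive affine roots, on no other. Its facet is the common face. *)
Lemma adjacent_simple A s : simple_aff D A -> is_aff_refl A s ->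
  adjacent base_facet (wfacet s base_facet).
Proof.
move=> AS As; have AP := simple_affine_root AS; have Apos := simple_aff_pos AS.
have v0P := base_ptP P; have sV := aff_reflV AP As; pose v0 := base_pt P.
have sA : aff_val A (wact s v0) = - aff_val A v0.
  by rewrite aff_val_wactE// sV (wact_root_self AP As) aff_val_opp.
have same B : affine_root D B -> B <> A -> B <> opp_aff A ->
    0 < aff_val B v0 -> 0 < aff_val B (wact s v0).
  move=> BP BA BoA /(aff_pos_val BP v0P) Bpos.
  rewrite aff_val_wactE// sV; apply: v0P.
  exact: (simple_refl_pos AS As Bpos BA).
pose p := (1/2) *: (v0 + wact s v0).
have pE B : aff_val B p = (aff_val B v0 + aff_val B (wact s v0)) / 2.
  by rewrite !aff_valE lin_valZ lin_valD; field.
have pA : aff_val A p = 0 by rewrite pE sA subrr mul0r.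
have posP B : affine_root D B -> 0 < aff_val B p ->
    0 < aff_val B v0 /\ 0 < aff_val B (wact s v0).
  move=> BP p0; have BA : B <> A by move=> BA; rewrite BA pA ltxx in p0.
  have BoA : B <> opp_aff A by move=> BoA; rewrite BoA aff_val_opp pA oppr0 ltxx in p0.
  have [v0B|v0B] := ltP 0 (aff_val B v0); first by split=> //; exact: same.
  exfalso; have oB := affine_root_opp BP.
  have neg : 0 < aff_val (opp_aff B) v0.
    rewrite aff_val_opp oppr_gt0 lt_neqAle v0B andbT.
    exact: base_chamber_neq0.
  have := same _ oB _ _ neg; rewrite aff_val_opp oppr_gt0 => neg'.
  have {}neg' : aff_val B (wact s v0) < 0.
    by apply: neg' => h; [apply: BoA|apply: BA]; rewrite -[B]opp_affK h ?opp_affK.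
  move: p0 neg; rewrite pE aff_val_opp; lra.
split; first exact: base_facet_chamber.
- by apply/chamber_wfacet; exact: base_facet_chamber.
- move=> e; have : fpts base_facet (wact s v0) by rewrite e; exact: wfacet_pt.
  rewrite base_facet_val => /(_ _ Apos); rewrite sA oppr_gt0.
  by move=> /(lt_trans (v0P _ Apos)); rewrite ltxx.
have pP := facet_at_self p.
exists (facet_at p); split.
- by apply/(is_faceP pP (facet_at_self v0)) => B BP /(posP _ BP)[].
- by apply/(is_faceP pP (wfacet_pt s (facet_at_self v0))) => B BP /(posP _ BP)[].
rewrite (chamber_fdim base_facet_chamber) -(dim_lker_lin_hom AP); congr (_.+1).
congr (\dim _); apply/vspaceP => u; rewrite mem_lker_lin_hom.
apply/idP/eqP => [/(directionP _ pP) h|u0]; first exact: h.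
apply/(directionP _ pP) => B BP p0.
have [->//|BA] := pselect (B = A).
have [->|BoA] := pselect (B = opp_aff A); first by rewrite /= lin_valNl u0 oppr0.
exfalso; have := posP B BP; have := posP _ (affine_root_opp BP).
have v0B := base_chamber_neq0 BP v0P.
have [h|h|h] := ltgtP 0 (aff_val B v0); last by rewrite -/v0 -h eqxx in v0B.
  have := same B BP BA BoA h; move: p0; rewrite pE; lra.
have h' : 0 < aff_val (opp_aff B) v0 by rewrite aff_val_opp oppr_gt0.
have := same _ (affine_root_opp BP) _ _ h'; rewrite aff_val_opp oppr_gt0 => h2.
have {}h2 : aff_val B (wact s v0) < 0.
  by apply: h2 => e; [apply: BoA|apply: BA]; rewrite -[B]opp_affK e ?opp_affK.
move: p0; rewrite pE; lra.
Qed.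

Lemma adjacent_wfacet w E F : adjacent E F -> adjacent (wfacet w E) (wfacet w F).
Proof.
move=> [Ech Fch EF [G [GE GF dG]]]; split; [exact/chamber_wfacet..| |].
  by move=> /(can_inj (wfacetK w)).
by exists (wfacet w G); split; [exact/is_face_wfacet..|rewrite !fdim_wfacet].
Qed.

Lemma gallery_nsep E F e f k : gallery E F k -> fpts E e -> fpts F f ->
  (nsep f <= nsep e + k)%N.
Proof.
move=> [s [<- ps <-]]; elim: s E e f ps => [|G s IHs] E e f /=.
  move=> _ Ee Ef; rewrite addn0; suff -> : nsep f = nsep e by [].
  rewrite /nsep; congr (#|` fset_set _|%fset); apply/seteqP.
  have se B : aff_pos D B -> (aff_val B f < 0) = (aff_val B e < 0).
    by move=> BP; rewrite -sgr_lt0 (facet_sg BP.1 Ef Ee) sgr_lt0.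
  by split=> B [BP B0]; split=> //; rewrite ?se// -se.
move=> /andP[/asboolP EG ps] Ee lf; have Gg := facet_ptP G.
have := IHs G _ f ps Gg lf; have := adjacent_nsep EG Ee Gg; lia.
Qed.

(** With [gallery_nsep] this identifies the gallery distance from C. If E is not C, some simple
    affine root is negative on E and its reflection s lowers the count; a gallery from C to s E,
    moved by s and preceded by C, leads from C to E. *)
Lemma chamber_gallery E e : is_chamber E -> fpts E e ->
  exists w, [/\ W_aff w, E = wfacet w base_facet & gallery base_facet E (nsep e)].
Proof.
have [W1 WM _] := gen_subgroupP [set s : W | exists2 A, affine_root D A & is_aff_refl A s].
have [k] := ubnP (nsep e); elim: k E e => // k IHk E e ek Ech Ee.
have [e0|] := posnP (nsep e).
  have Eb : E = base_facet.
    apply: facet_eq; rewrite (facetE Ee) base_facet_val; apply: base_facetE.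
    move=> B Bpos; rewrite lt_neqAle (nsep_eq0 e0)// eq_sym andbT.
    by apply: ((is_chamberP Ee).1 Ech); exact: Bpos.1.
  exists 1%g; rewrite e0 wfacet1; split=> //.
  by exists [::]; rewrite Eb.
move=> /nsep_gt0[A AS neg]; have AP := simple_affine_root AS.
have [s As] := aff_refl_ex AP; have sV := aff_reflV AP As.
have nE := nsep_refl AS As neg.
have sE := wfacet_pt s Ee.
have [|w [wW Ew [t [tk tp tl]]]] := IHk _ _ _ ((chamber_wfacet s E).2 Ech) sE.
  by move: ek; rewrite nE.
have {}Ew : E = wfacet (s * w)%g base_facet by rewrite wfacetM -Ew -{1}sV wfacetK.
exists (s * w)%g; split=> //.
  by apply: WM => //; apply: gen_subgroup_sub; exists A.
exists (map (wfacet s) (base_facet :: t)); split.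
- by rewrite size_map /= tk nE.
- rewrite /=; apply/andP; split; first exact/asboolP/(adjacent_simple AS As).
  rewrite path_map; apply: sub_path tp => F G /asboolP FG.
  exact/asboolP/adjacent_wfacet.
by rewrite /= last_map tl -{1}sV wfacetK.
Qed.

(* Moving g slightly towards the base point gives a chamber which has G in    *)
(* its closure and no hyperplane through G between itself and C.              *)
Lemma gate_chamber G g : fpts G g -> exists E e,
  [/\ is_chamber E, is_face G E, fpts E e & sep e = sep g].
Proof.
move=> Gg; have v0P := base_ptP P; pose v0 := base_pt P.
have [t0 t0p ht] := aff_val_perturb g (v0 - g).
pose t := Order.min t0 1; have tp : 0 < t by rewrite lt_min t0p ltr01.
pose e := g + t *: (v0 - g); have eE := facet_at_self e.
have sg1 B : affine_root D B -> aff_val B g != 0 ->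
    Num.sg (aff_val B e) = Num.sg (aff_val B g).
  by move=> BP; apply: ht => //; rewrite tp ge_min lexx.
have sg0 B : affine_root D B -> aff_val B g = 0 -> aff_val B e = t * aff_val B v0.
  move=> BP g0; rewrite aff_valD g0 add0r lin_valZ lin_valB; congr (_ * _).
  by rewrite -[RHS]subr0 -g0 !aff_valE; ring.
exists (facet_at e), e; split=> //.
- apply/(is_chamberP eE) => B BP; have [g0|g0] := eqVneq (aff_val B g) 0.
    by rewrite sg0// mulf_neq0 ?(gt_eqF tp)//; exact: base_chamber_neq0.
  by rewrite -sgr_eq0 sg1// sgr_eq0.
- apply/(is_faceP Gg eE) => B BP g0.
  by rewrite -sgr_gt0 sg1 ?sgr_gt0// gt_eqF.
apply/seteqP; split=> B [Bpos neg]; split=> //; have BP := Bpos.1; last first.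
  by rewrite -sgr_lt0 sg1 ?sgr_lt0// lt_eqF.
have [g0|g0] := eqVneq (aff_val B g) 0; last by rewrite -sgr_lt0 -sg1// sgr_lt0.
by move: neg; rewrite sg0// pmulr_rlt0// => /(lt_trans (v0P _ Bpos)); rewrite ltxx.
Qed.

Lemma sep_face G E g e : is_face G E -> fpts G g -> fpts E e -> sep g `<=` sep e.
Proof.
move=> GE Gg Ee B [Bpos neg]; split=> //.
have := (is_faceP Gg Ee).1 GE _ (affine_root_opp Bpos.1).
by rewrite !aff_val_opp !oppr_gt0; apply.
Qed.

(** Every chamber around G is separated from C by the hyperplanes that separate G ([sep_face]), and
    the chamber of [gate_chamber] by no others. So a closest chamber has exactly these, whichever
    element [d_] selects. *)
Lemma d_spec G g : fpts G g ->
  sep (wact (d_ G) (base_pt P)) = sep g /\ is_face G (wfacet (d_ G) base_facet).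
Proof.
move=> Gg; have [E0 [e0 [E0ch GE0 E0e sepE]]] := gate_chamber Gg.
have v0e := facet_at_self (base_pt P).
have v0n : nsep (base_pt P) = 0%N.
  apply/eqP; rewrite cardfs_eq0; apply/eqP/fsetP => B; rewrite inE.
  rewrite in_fset_set; last exact: finite_sep.
  apply/negbTE/negP => /set_mem[Bpos /(lt_trans (base_ptP P Bpos))].
  by rewrite ltxx.
have closest E e : closest_chamber G E -> fpts E e -> sep e = sep g.
  move=> [C [CE [Ech GE [k gal kmin]]]] Ee.
  have {}CE : C = base_facet by apply: facet_eq; rewrite CE base_facet_val.
  rewrite {}CE in gal kmin.
  have [w [_ _ gal0]] := chamber_gallery E0ch E0e.
  have := kmin _ _ E0ch GE0 gal0.
  have := gallery_nsep gal v0e Ee; rewrite v0n add0n => h1 h2.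
  have gsub := sep_face GE Gg Ee.
  (* [sep g] lies in [sep e], and minimality of the gallery gives nsep e <= k <= nsep e0 = nsep
     g. *)
  have : fset_set (sep g) == fset_set (sep e).
    rewrite eqEfcard; apply/andP; split.
      by rewrite -fset_set_sub//; exact: finite_sep.
    by apply: leq_trans h1 _; apply: leq_trans h2 _; rewrite /nsep sepE.
  move=> /eqP/(congr1 (fun X : {fset _} => [set` X])).
  by rewrite !fset_setK//; exact: finite_sep.
have [w [wW E0w gal0]] := chamber_gallery E0ch E0e.
have E0close : closest_chamber G E0.
  exists base_facet; split; first exact: base_facet_val.
  split=> //; exists (nsep e0) => // E' k' E'ch GE' gal'.
  have E'e := facet_ptP E'; have := gallery_nsep gal' v0e E'e; rewrite v0n add0n.
  apply: leq_trans; rewrite /nsep sepE; apply: fsubset_leq_card.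
  by rewrite -fset_set_sub; [exact: sep_face GE' Gg E'e|exact: finite_sep..].
(* The element w, which carries C to the closest chamber E0, shows that [d_] chooses from a nonempty
   set. *)
suff [E Eclose Ed] : exists2 E, closest_chamber G E & fpts E = wact (d_ G) @` C0.
  have {}Ed : E = wfacet (d_ G) base_facet.
    by apply: facet_eq; rewrite Ed -base_facet_val.
  rewrite -Ed; split; last by case: Eclose => C [_ []].
  by apply: closest Eclose _; rewrite Ed; exact: wfacet_pt.
rewrite /d_; case: xgetP => [x _ [_ //]|/(_ w)[]]; split=> //.
by exists E0 => //; rewrite E0w -base_facet_val.
Qed.

(** The gate property in terms of signs: an affine root vanishing on G has the same sign on d_G C as
    on C. *)
Lemma d_gate G g B : fpts G g -> affine_root D B ->
  aff_pos D (wact_root (d_ G)^-1%g B) <->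
  0 < aff_val B g \/ aff_val B g = 0 /\ aff_pos D B.
Proof.
move=> Gg BP; have [sepE Gface] := d_spec Gg; have v0P := base_ptP P.
have dB := affine_root_wact (d_ G)^-1%g BP; rewrite (aff_pos_val dB v0P) -aff_val_wactE//.
set e := wact _ _ in sepE *.
have De : fpts (wfacet (d_ G) base_facet) e by exact: wfacet_pt (facet_at_self _).
have ch : is_chamber (wfacet (d_ G) base_facet).
  by apply/chamber_wfacet; exact: base_facet_chamber.
have e0 := (is_chamberP De).1 ch _ BP.
split=> [epos|[g0|[g0 Bpos]]]; last 1 first.
- rewrite lt_neqAle eq_sym e0 /= leNgt; apply/negP => neg.
  have : sep e B by [].
  by rewrite sepE => -[_]; rewrite g0 ltxx.
- have [//|g1] := ltP 0 (aff_val B g); first by left.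
  right; split.
    apply/eqP; rewrite eq_le g1 leNgt; apply/negP => neg.
    have := (is_faceP Gg De).1 Gface _ (affine_root_opp BP).
    rewrite !aff_val_opp !oppr_gt0 => /(_ neg)/(lt_trans epos).
    by rewrite ltxx.
  apply: contrapT => npos; have neg : aff_neg D B by [].
  have opos := (aff_neg_opp P BP).1 neg.
  have : sep e (opp_aff B) by split=> //; rewrite aff_val_opp oppr_lt0.
  rewrite sepE => -[_]; rewrite aff_val_opp oppr_lt0 => /lt_le_trans/(_ g1).
  by rewrite ltxx.
exact: (is_faceP Gg De).1 Gface _ BP g0.
Qed.

Lemma d_inCbar G : inCbar (wfacet (d_ G)^-1%g G).
Proof.
have [_ Gd] := d_spec (facet_ptP G); rewrite /inCbar -base_facet_val.
by apply/(is_face_wfacet (d_ G)); rewrite wfacetVK.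
Qed.

(** By [wlength_add] it is enough that a positive B made negative by d_G^-1 w is also made negative
    by w. As w^-1 G lies in the closure of C, w B is nonnegative on G; were it positive on C too,
    [d_gate] would make d_G^-1 w B positive. *)
Lemma wlength_d G w : inCbar (wfacet w^-1%g G) ->
  wlength w = (wlength (d_ G) + wlength ((d_ G)^-1 * w)%g)%N.
Proof.
move=> wG; have Gg := facet_ptP G; set g := facet_pt G in Gg.
rewrite -[in LHS](mulVKg (d_ G) w); apply: (wlength_add P) => B Bpos neg.
rewrite mulVKg; have BP := Bpos.1; have wB := affine_root_wact w BP.
split=> // wBpos; have [_] := neg; rewrite wact_rootM; apply.
apply/(d_gate Gg wB).
have Bg : 0 <= aff_val (wact_root w B) g.
  rewrite -aff_val_wactV//; apply: (inCbarP (wfacet_pt _ Gg)).1 => //.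
by move: Bg; rewrite le_eqVlt => /orP[/eqP<-|]; [right|left].
Qed.

(** * Stabilizers of facets in the closure of C *)

Lemma S_of_fix F s : S_of F s -> wfacet s F = F.
Proof.
move=> [_ sF]; apply: facet_eq; apply/seteqP; split=> [_ [e Fe <-]|e Fe].
  by rewrite sF.
by exists e; rewrite ?sF.
Qed.

Lemma wall_S_of F e A s : fpts F e -> aff_val A e = 0 -> simple_aff D A ->
  is_aff_refl A s -> S_of F s.
Proof.
move=> Fe A0 AS As; have AP := simple_affine_root AS; split; first by exists A.
move=> e' Fe'; have {}A0 : aff_val A e' = 0.
  by apply/eqP; rewrite -sgr_eq0 (facet_sg AP Fe' Fe) A0 sgr0.
case: As => s1 s2; rewrite /wact s1 s2 -[RHS]aprojK; congr (_ *m _).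
set c := map_mx intr (A.2 *: _).
have cE : c = A.2%:~R *: map_mx intr (coroot D A.1).
  by apply/matrixP => i j; rewrite !mxE intrM.
have -> : map_mx intr (refl D A.1) =
    1%:M - map_mx intr (coroot D A.1) *m map_mx intr A.1 :> 'M[K]_n.
  by rewrite /refl map_mxB map_mx1 map_mxM.
set k := map_mx intr (coroot D A.1) in cE *.
have ax x : map_mx intr A.1 *m (alift x : 'cV[K]_n) = (lin_val A.1 x)%:M.
  by apply/matrixP => i j; rewrite !ord1 [RHS]mxE eqxx.
have ac : map_mx intr A.1 *m k = 2%:M :> 'M[K]_1.
  by rewrite /k -map_mxM pairing_scalar pairing_coroot//; apply/matrixP => i j; rewrite !mxE !ord1.
rewrite cE mulmxBl mul1mx -mulmxA mulmxDr -scalemxAr ax ac mulmxDr -scalemxAr !mul_mx_scalar.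
have -> : lin_val A.1 e' = - A.2%:~R by apply/eqP; rewrite -addr_eq0; apply/eqP.
by apply/matrixP => i j; rewrite !mxE; ring.
Qed.

(** Induction on the length. If x is not in Omega, some simple A has x A negative. Then A is
    nonnegative on F while x A is nonpositive on F', so A vanishes on F and its reflection s fixes F
    pointwise; x s is shorter and still carries F to F'. With a constant predicate this yields an
    element of Omega carrying F to F'. *)
Lemma stab_ind F F' (Q : W -> Prop) : inCbar F -> inCbar F' ->
  (forall x, Omega x -> wfacet x F = F' -> Q x) ->
  (forall x s, S_of F s -> wfacet x F = F' -> wlength (x * s)%g = (wlength x).+1 ->
     Q x -> Q (x * s)%g) ->
  forall x, wfacet x F = F' -> Q x.
Proof.
move=> FC F'C QO QS x; have [k] := ubnP (wlength x); elim: k x => // k IHk x xk xF.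
have [x0|] := posnP (wlength x); first exact: QO.
rewrite (wlengthE x (base_ptP P)) => /nsep_gt0[A AS neg].
have AP := simple_affine_root AS; rewrite aff_val_wactV// in neg.
have xA := affine_root_wact x AP.
have {}neg := (aff_neg_val xA (base_ptP P)).2 neg.
have Fe := facet_ptP F; have [s As] := aff_refl_ex AP.
have A0 : aff_val A (facet_pt F) = 0.
  apply/eqP; rewrite eq_le ((inCbarP Fe).1 FC) ?andbT; last exact: simple_aff_pos.
  rewrite -(aff_val_wact x _ AP) -oppr_ge0 -aff_val_opp.
  have F'e : fpts F' (wact x (facet_pt F)) by rewrite -xF; exact: wfacet_pt.
  by apply: (inCbarP F'e).1 => //; exact/(aff_neg_opp P xA).
have sF := wall_S_of Fe A0 AS As; have ss := aff_refl_invol AP As.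
have len := wlength_refl_neg P AS As neg.
have xsF : wfacet (x * s)%g F = F' by rewrite wfacetM (S_of_fix sF).
rewrite -[x]mulg1 -ss mulgA; apply: QS => //; first by rewrite -mulgA ss mulg1.
by apply: IHk => //; rewrite -ltnS; apply: leq_trans xk; rewrite len.
Qed.

Lemma W_of_fix F w : W_of F w -> wfacet w F = F.
Proof.
move=> /(_ [set x | wfacet x F = F]); apply; first split.
- exact: wfacet1.
- by move=> x y /= xF yF; rewrite wfacetM yF.
- by move=> x /= xF; rewrite -[in LHS]xF wfacetK.
move=> x [xW|[_ xF]]; last by apply: facet_eq.
apply: (xW [set x | wfacet x F = F]); last by move=> s; exact: S_of_fix.
split.
- exact: wfacet1.
- by move=> y z /= yF zF; rewrite wfacetM zF.
- by move=> y /= yF; rewrite -[in LHS]yF wfacetK.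
Qed.

Lemma W_ofP F w : inCbar F -> W_of F w <-> wfacet w F = F.
Proof.
move=> FC; split; first exact: W_of_fix.
have [W1 WM WV] := gen_subgroupP (W0_of F `|` Omega_of F).
apply: (stab_ind FC FC) => [x xO xF|x s sF _ _ xW].
  by apply: gen_subgroup_sub; right; split=> //; rewrite -[in RHS]xF.
apply: WM => //; apply: gen_subgroup_sub; left; exact: gen_subgroup_sub.
Qed.

(** d_G^-1 G is a facet of the closure of C in the orbit of F, so by [stab_ind] some element of
    Omega carries F to it; multiply that element by d_G. *)
Lemma facet_Omega F G w : inCbar F -> G = wfacet w F ->
  exists2 x, G = wfacet x F & Omega ((d_ G)^-1 * x)%g.
Proof.
move=> FC GE; have := d_inCbar (G := G); set F' := wfacet _^-1%g G => F'C.
have: wfacet ((d_ G)^-1 * w)%g F = F' by rewrite wfacetM -GE.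
apply: (stab_ind (Q := fun _ => _) FC F'C) => // x xO xF.
exists (d_ G * x)%g; first by rewrite wfacetM xF /F' wfacetVK.
by rewrite mulKg.
Qed.

End Facets.

(** * Oriented facets and elementary chains *)

Section Orientations.
Context (K : realType) (n : nat) (D : root_system n) (P : apartment K D).
Local Notation V := 'cV[K]_(adim P).
Local Notation W := (extW D).
Implicit Types (v w s : W) (F G : facet P).

Lemma direction_wfacetV w F u : (wact_lin w^-1%g u \in direction F) = (u \in direction (wfacet w F)).
Proof. by rewrite -(direction_wfacet w) wact_linVK. Qed.

Lemma map_wact_linK i w (Y : i.-tuple V) :
  map_tuple (wact_lin w) (map_tuple (wact_lin w^-1%g) Y) = Y.
Proof. by apply: eq_from_tnth => j; rewrite !tnth_map wact_linVK. Qed.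

Lemma map_wact_linVK i w (Y : i.-tuple V) :
  map_tuple (wact_lin w^-1%g) (map_tuple (wact_lin w) Y) = Y.
Proof. by apply: eq_from_tnth => j; rewrite !tnth_map wact_linK. Qed.

Lemma wact_lin_sum w i (X : i.-tuple V) (c : 'I_i -> K) :
  wact_lin w (\sum_j c j *: X`_j) = \sum_j c j *: (map_tuple (wact_lin w) X)`_j.
Proof.
have l0 : wact_lin w 0 = 0 :> V by rewrite -[0 in LHS](scale0r 0) wact_linZ scale0r.
rewrite (big_morph (wact_lin w) (wact_linD w) l0); apply: eq_bigr => j _.
by rewrite wact_linZ -!tnth_nth tnth_map.
Qed.

Lemma basis_wfacet i w F (X : i.-tuple V) : basis_of (direction F) X ->
  basis_of (direction (wfacet w F)) (map_tuple (wact_lin w) X).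
Proof.
move=> XF; rewrite basisEdim; apply/andP; split.
  apply/subvP => u; rewrite -direction_wfacetV => uF.
  rewrite -(wact_linVK w u) (coord_basis XF uF) wact_lin_sum.
  by apply: memv_suml => j _; apply/memvZ/memv_span/mem_nth; rewrite size_tuple.
rewrite size_tuple -/(fdim _) fdim_wfacet /fdim.
by rewrite (size_basis XF).
Qed.

Lemma coord_wfacet i w F (X : i.-tuple V) j u : basis_of (direction F) X ->
  u \in direction (wfacet w F) ->
  coord (map_tuple (wact_lin w) X) j u = coord X j (wact_lin w^-1%g u).
Proof.
move=> XF; rewrite -direction_wfacetV => uF; have X'F := basis_wfacet w XF.
rewrite -[u in LHS](wact_linVK w) {1}(coord_basis XF uF) wact_lin_sum.
by rewrite coord_sum_free// (basis_free X'F).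
Qed.

Fact wofacet_subproof i w (o : ofacet P i) :
  ofacet_pred (wfacet w o, fun Y => oori o (map_tuple (wact_lin w^-1%g) Y)).
Proof.
have /asboolP[oi [X XF oX]] := ofacetP o; apply/asboolP; split=> /=.
  by rewrite fdim_wfacet.
exists (map_tuple (wact_lin w) X); first exact: basis_wfacet.
apply/funext => Y; rewrite oX /orient_of.
have -> : all (fun y => y \in direction o) (map_tuple (wact_lin w^-1%g) Y) =
          all (fun y => y \in direction (wfacet w o)) Y.
  by rewrite all_map; apply: eq_all => u /=; rewrite direction_wfacetV.
case: ifP => // /all_tnthP YF; congr (sgz (\det _)); apply/matrixP => j k.
by rewrite !mxE tnth_map (coord_wfacet _ XF (YF j)).
Qed.

Definition wofacet i w (o : ofacet P i) : ofacet P i := ofacet_sub (wofacet_subproof w o).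

Lemma ofac_wofacet i w (o : ofacet P i) : ofac (wofacet w o) = wfacet w (ofac o).
Proof. by []. Qed.

Lemma wofacetM i v w (o : ofacet P i) : wofacet (v * w)%g o = wofacet v (wofacet w o).
Proof.
apply: ofacet_eq; first exact: wfacetM.
move=> Y /=; congr (oori o _); apply: eq_from_tnth => j; rewrite !tnth_map.
by rewrite -wact_linM invgM.
Qed.

Lemma wofacet1 i (o : ofacet P i) : wofacet 1%g o = o.
Proof.
apply: ofacet_eq; first exact: wfacet1.
move=> Y /=; congr (oori o _); apply: eq_from_tnth => j; rewrite !tnth_map.
by rewrite invg1 wact_lin1.
Qed.

Lemma wofacetK i w : cancel (@wofacet i w) (wofacet w^-1%g).
Proof. by move=> o; rewrite -wofacetM mulVg wofacet1. Qed.

Lemma wofacetVK i w : cancel (@wofacet i w^-1%g) (wofacet w).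
Proof. by move=> o; rewrite -wofacetM mulgV wofacet1. Qed.

Lemma wofacet_bij i w : bijective (@wofacet i w).
Proof. by exists (wofacet w^-1%g); [exact: wofacetK|exact: wofacetVK]. Qed.

Lemma induces_wofacet i w (o : ofacet P i.+1) (o' : ofacet P i) :
  induces o o' -> induces (wofacet w o) (wofacet w o').
Proof.
move=> eo' _ _ Y [u ou <-] [u' o'u' <-] YF /=.
rewrite (eo' u u')//; last by rewrite all_map; apply: sub_all YF => y /=; rewrite direction_wfacetV.
congr (oori o _); apply: val_inj => /=; congr (_ :: _).
by rewrite wact_sub wact_linK.
Qed.

(** Two orientations differ by the sign of the nonzero determinant of a change of basis. *)
Lemma ofacet_ext i (o o' : ofacet P i) : ofac o = ofac o' ->
  o' = o \/ forall Y, oori o' Y = - oori o Y.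
Proof.
move=> eo'; have /asboolP[_ [X XF oX]] := ofacetP o.
have /asboolP[_ [X' X'F oX']] := ofacetP o'; rewrite -eo' in X'F oX'.
have d0 := detc_neq0 X'F XF.
have e Y : oori o' Y = sgz (detc X' X) * oori o Y by rewrite oX oX' (orient_change X'F XF).
move: d0 e; case: sgzP => // _ _ e; [left; apply: ofacet_eq => // Y|right=> Y].
  by rewrite e mul1r.
by rewrite e mulN1r.
Qed.

Lemma oori_not_opp i (o o' : ofacet P i) : ofac o = ofac o' ->
  (forall Y, oori o' Y = - oori o Y) -> o' <> o.
Proof.
move=> _ e eo'; have /asboolP[_ [X XF oX]] := ofacetP o.
have := e X; rewrite eo' oX /orient_of (basis_all XF) -/(detc X X) (detcXX XF).
by rewrite sgz1.
Qed.

Lemma ofacet0_eq (o o' : ofacet P 0) : ofac o = ofac o' -> o' = o.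
Proof.
move=> eo'; have [//|e] := ofacet_ext eo'.
have one (x : ofacet P 0) Y : oori x Y = 1.
  have /asboolP[_ [X _ ->]] := ofacetP x.
  by rewrite /orient_of tuple0 /= det_mx00 sgz1.
by have := e [tuple]; rewrite !one.
Qed.

(** The alternating indicator function of o, evaluated at o'. In dimension 0 the value -1 does not
    occur ([ofacet0_eq]). *)
Definition osgn i (o o' : ofacet P i) : int :=
  if ofac o == ofac o' then (if o' == o then 1 else -1) else 0.

Lemma osgn_self i (o : ofacet P i) : osgn o o = 1.
Proof. by rewrite /osgn !eqxx. Qed.

Lemma osgn_neq i (o o' : ofacet P i) : ofac o <> ofac o' -> osgn o o' = 0.
Proof. by rewrite /osgn => /eqP/negbTE->. Qed.

Lemma osgn_wofacet i w (o o' : ofacet P i) : osgn (wofacet w o) (wofacet w o') = osgn o o'.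
Proof.
rewrite /osgn (can_eq (@wofacetK i w)) /=.
by rewrite (can_eq (wfacetK w)).
Qed.

Lemma osgnC i (o o' : ofacet P i) : osgn o o' = osgn o' o.
Proof. by rewrite /osgn eq_sym [o' == o]eq_sym. Qed.

Lemma osgn_opp i (o o1 o2 : ofacet P i) : ofac o1 = ofac o2 ->
  (forall Y, oori o2 Y = - oori o1 Y) -> osgn o o2 = - osgn o o1.
Proof.
move=> e12 s12; rewrite /osgn -e12; case: eqP => [eo|]; last by rewrite oppr0.
have [e1|n1] := eqVneq o1 o.
  by case: eqP => // e2; have := oori_not_opp e12 s12; rewrite e1 e2.
have [|s1] := ofacet_ext eo; first by move=> e; rewrite e eqxx in n1.
have -> : o2 = o; last by rewrite eqxx opprK.
by apply: ofacet_eq => [|Y]; [rewrite -e12|rewrite s12 s1 opprK].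
Qed.

Lemma preserves_orientationP F i (c : i.-tuple V -> int) w : fdim F = i ->
  is_orientation (direction F) c ->
  preserves_orientation F w <-> forall Y, c (map_tuple (wact_lin w) Y) = c Y.
Proof.
move=> Fi; case: _ / Fi c => c co; split=> [h Y|h c' [X' X'F ->] Y]; first exact: h.
by have [X XF cX] := co; rewrite (orient_change X'F XF) -cX h.
Qed.

Lemma eps_osgn i (o : ofacet P i) w : wfacet w (ofac o) = ofac o ->
  eps (ofac o) w = osgn o (wofacet w o).
Proof.
move=> wo; rewrite /osgn /= wo eqxx /eps.
suff -> : `[< preserves_orientation (ofac o) w >] = (wofacet w o == o) by [].
have /asboolP[oi oo] := ofacetP o.
apply/asboolP/eqP => [/(preserves_orientationP w oi oo) h|h].
  by apply: ofacet_eq => // Y /=; rewrite -[in RHS](map_wact_linK w Y) h.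
apply/(preserves_orientationP w oi oo) => Y.
by rewrite -[o in LHS]h /= map_wact_linVK.
Qed.

(** s fixes F pointwise, hence also the small displacements within F, which give all of its
    direction. *)
Lemma S_of_wofacet i (o : ofacet P i) s : S_of (ofac o) s -> wofacet s o = o.
Proof.
move=> so; have fo := S_of_fix so; apply: ofacet_eq => // Y /=.
have fixd u : u \in direction (ofac o) -> wact_lin s^-1%g u = u.
  have Fe := facet_ptP (ofac o); move=> /(directionP _ Fe)/(facet_shift Fe)[t t0 Ft].
  have [_ fix_s] := so; have := wact_sub s (facet_pt o + t *: u) (facet_pt o).
  rewrite !fix_s// addrAC subrr add0r wact_linZ => /(congr1 ( *:%R t^-1)).
  by rewrite !scalerA mulVf ?(gt_eqF t0)// !scale1r => {1}->; rewrite wact_linK.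
case: (boolP (all (fun y => y \in direction o) Y)) => [/all_tnthP YF|/negbTE YF].
  by congr (oori o _); apply: eq_from_tnth => j; rewrite tnth_map fixd.
have /asboolP[_ [X XF ->]] := ofacetP o; rewrite /orient_of YF all_map.
have -> : all (preim (wact_lin s^-1%g) (fun y => y \in direction o)) Y =
          all (fun y => y \in direction o) Y.
  by apply: eq_all => y /=; rewrite direction_wfacetV fo.
by rewrite YF.
Qed.

Lemma S_of_eps i (o : ofacet P i) s w : S_of (ofac o) s -> wfacet w (ofac o) = ofac o ->
  eps (ofac o) (w * s)%g = eps (ofac o) w.
Proof.
move=> so wo; have ws : wfacet (w * s)%g (ofac o) = ofac o by rewrite wfacetM (S_of_fix so).
by rewrite (eps_osgn ws) (eps_osgn wo) wofacetM (S_of_wofacet so).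
Qed.

End Orientations.

Section Elementary.
Context (K : realType) (n : nat) (D : root_system n) (P : apartment K D).
Context (H : nzRingType) (i : nat).
Local Notation V := 'cV[K]_(adim P).
Local Notation W := (extW D).
Implicit Types (o p : ofacet P i) (c : chain P H i).

Lemma chain_ext c c' : (forall o, c o = c' o) -> c = c'.
Proof. by move=> e; apply: val_inj; apply/funext. Qed.

Lemma chain_valD c c' o : (c + c') o = c o + c' o. Proof. by []. Qed.
Lemma chain_valN c o : (- c) o = - c o. Proof. by []. Qed.
Lemma chain_val0 o : (0 : chain P H i) o = 0. Proof. by []. Qed.
Lemma chain_valMn c k o : (c *+ k) o = c o *+ k.
Proof. by elim: k => // k IHk; rewrite !mulrS chain_valD IHk. Qed.
Lemma chain_valMz c (k : int) o : (c *~ k) o = c o *~ k.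
Proof. by case: k => k; rewrite ?chain_valN chain_valMn. Qed.

Definition supp c : {fset ofacet P i} := fset_set [set o | c o != 0].

Lemma finite_supp c : finite_set [set o | c o != 0].
Proof. by have /asboolP[] := chainP c. Qed.

Lemma mem_supp c o : (o \in supp c) = (c o != 0).
Proof.
rewrite in_fset_set; last exact: finite_supp.
by apply/idP/idP => [/set_mem|/mem_set].
Qed.

Lemma chain_osgn c o o' : ofac o = ofac o' -> c o' = c o *~ osgn o o'.
Proof.
move=> eo; rewrite /osgn eo eqxx; have [->//|n1] := eqVneq o' o.
have [e|s] := ofacet_ext eo; first by rewrite e eqxx in n1.
have /asboolP[_ alt] := chainP c.
(* Two distinct orientations exist only for i > 0, where chains are alternating. *)
have i0 : (0 < i)%N by case: i o o' c eo n1 {s alt} => // o o' c /ofacet0_eq->; rewrite eqxx.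
by rewrite (alt i0 o o')// mulrN1z.
Qed.

Fact elem_subproof o (h : H) : (fun o' => h *~ osgn o o') \in @chain_pred _ _ _ P H i.
Proof.
apply/asboolP; split.
  apply: (sub_finite_set _ (finite_ofaces i (ofac o))) => o' /=.
  have [->|ne] := pselect (ofac o = ofac o'); first by move=> _; exact: subset_closure.
  by rewrite osgn_neq// mulr0z eqxx.
by move=> _ o1 o2 e s; rewrite (osgn_opp _ _ s) ?mulrNz.
Qed.
Definition elem o h : chain P H i := Chain (elem_subproof o h).

Lemma elemE o h o' : elem o h o' = h *~ osgn o o'. Proof. by []. Qed.

Lemma elemD o h h' : elem o (h + h') = elem o h + elem o h'.
Proof. by apply: chain_ext => o'; rewrite chain_valD !elemE mulrzDl. Qed.

Lemma elemMz o h k : elem o (h *~ k) = elem o h *~ k.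
Proof. by apply: chain_ext => o'; rewrite chain_valMz !elemE mulrzAC. Qed.

Lemma elem_osgn o o' h : ofac o = ofac o' -> elem o' h = elem o (h *~ osgn o o').
Proof.
move=> eo; apply: chain_ext => p; rewrite !elemE.
have [e|ne] := pselect (ofac o = ofac p); last first.
  by rewrite (osgn_neq ne) osgn_neq ?mulr0z// -eo.
by have := chain_osgn (elem o' h) e; rewrite !elemE (osgnC o' o).
Qed.

(* Removing the value of c on one oriented facet lowers the size of its       *)
(* support.                                                                   *)
Lemma chain_ind (Q : chain P H i -> Prop) : Q 0 ->
  (forall c c', Q c -> Q c' -> Q (c + c')) -> forall c,
  (forall o, c o != 0 -> Q (elem o (c o))) -> Q c.
Proof.
move=> Q0 QD c; have [k] := ubnP #|` supp c|; elim: k c => // k IHk c ck Qc.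
have [/eqP|[o oc]] := fset_0Vmem (supp c).
  rewrite -cardfs_eq0 => /eqP c0; suff -> : c = 0 by [].
  apply: chain_ext => o; apply/eqP; rewrite chain_val0 -[_ == _]negbK -mem_supp.
  by move: c0 => /eqP; rewrite cardfs_eq0 => /eqP->.
rewrite mem_supp in oc.
have eE p : (c - elem o (c o)) p = if ofac o == ofac p then 0 else c p.
  rewrite chain_valD chain_valN elemE; case: eqP => [e|ne].
    by rewrite (chain_osgn c e) subrr.
  by rewrite osgn_neq// mulr0z subr0.
rewrite -[c](subrK (elem o (c o))); apply: QD; last exact: Qc.
apply: IHk => [|p]; last first.
  rewrite eE; case: ifP => [|ne pc]; first by rewrite eqxx.
  exact: Qc.
rewrite ltnS in ck; apply: leq_trans ck; apply: fproper_ltn_card.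
rewrite fproperE; apply/andP; split.
  by apply/fsubsetP => p; rewrite !mem_supp eE; case: ifP; rewrite ?eqxx.
by apply/fsubsetPn; exists o; rewrite ?mem_supp// eE eqxx negbK.
Qed.

End Elementary.

(** * The Hecke algebra acting on chains *)

Lemma mulr_fsum_support (A : nzRingType) (I : choiceType) (a : A) (Q : set I) (f : I -> A) :
  finite_set (Q `&` f @^-1` [set~ 0]) ->
  a * (\sum_(i \in Q) f i) = \sum_(i \in Q) a * f i.
Proof. exact: full_fsbig_distrr. Qed.

Lemma morphD_0 (M N : zmodType) (f : M -> N) : {morph f : x y / x + y} -> f 0 = 0.
Proof. by move=> fD; apply: (@addrI _ (f 0)); rewrite -fD !addr0. Qed.

Lemma morphMz (M N : zmodType) (f : M -> N) : {morph f : x y / x + y} ->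
  forall x (k : int), f (x *~ k) = f x *~ k.
Proof.
move=> fD; have f0 := morphD_0 fD.
have fN x : f (- x) = - f x by apply: (@addrI _ (f x)); rewrite -fD !subrr.
have fn x (k : nat) : f (x *+ k) = f x *+ k.
  by elim: k => // k IHk; rewrite !mulrS fD IHk.
by move=> x [k|k]; rewrite ?fn// !NegzE !mulrNz fN -!pmulrn fn.
Qed.

Section HeckeCoefficients.
Context (R : comNzRingType) (n : nat) (D : root_system n).
Local Notation W := (extW D).
Local Notation Rab := {poly {poly R}}.
Context (H : algType Rab) (T : W -> H) (T_hecke : generic_hecke T).
Implicit Types (z h : H) (v w x s : W) (c : W -> Rab).

Local Notation supp c := (fset_set [set w | c w != 0]).

Lemma expansion_sum (S : {fset W}) c : (forall w, w \notin S -> c w = 0) ->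
  expansion T (\sum_(w <- S) c w *: T w) c.
Proof.
move=> cS; split.
  apply: (@sub_finite_set _ _ [set` S]); last exact: finite_fset.
  by move=> w /=; apply: contraNT => /cS->.
by apply/esym/fsbigTE => w /cS->; rewrite scale0r.
Qed.

Lemma hcoefP h : expansion T h (hcoef T h).
Proof.
have [c [cE _]] := hecke_basis T_hecke h; rewrite /hcoef.
by case: xgetP => [c' _ //|/(_ c)].
Qed.

Lemma hcoef_unique h c : expansion T h c -> hcoef T h = c.
Proof.
move=> hc; have [c' [_ u]] := hecke_basis T_hecke h.
by rewrite -(u _ (hcoefP h)) -(u _ hc).
Qed.

Lemma finite_hcoef h : finite_set [set w | hcoef T h w != 0].
Proof. by have [] := hcoefP h. Qed.

Lemma hcoef_out h w : w \notin supp (hcoef T h) -> hcoef T h w = 0.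
Proof.
rewrite in_fset_set; last exact: finite_hcoef.
by move=> nw; apply/eqP; apply: contraNT nw => ?; apply/mem_set.
Qed.

Lemma hcoef_sum h (S : {fset W}) : (forall w, w \notin S -> hcoef T h w = 0) ->
  h = \sum_(w <- S) hcoef T h w *: T w.
Proof.
move=> hS; have [_ {1}->] := hcoefP h.
by apply: fsbigTE => w /hS->; rewrite scale0r.
Qed.

Lemma hcoefD h h' w : hcoef T (h + h') w = hcoef T h w + hcoef T h' w.
Proof.
suff -> : hcoef T (h + h') = fun w => hcoef T h w + hcoef T h' w by [].
apply: hcoef_unique; pose S := (supp (hcoef T h) `|` supp (hcoef T h'))%fset.
have hS x : x \notin S -> hcoef T h x = 0.
  by rewrite inE negb_or => /andP[/hcoef_out].
have hS' x : x \notin S -> hcoef T h' x = 0.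
  by rewrite inE negb_or => /andP[_ /hcoef_out].
rewrite {1}(hcoef_sum hS) {1}(hcoef_sum hS') -big_split.
rewrite [X in expansion T X](_ : _ = \sum_(w <- S) (hcoef T h w + hcoef T h' w) *: T w).
  by apply: expansion_sum => x xS; rewrite hS ?hS' ?addr0.
by apply: eq_bigr => x _; rewrite scalerDl.
Qed.

Lemma hcoefZ (k : Rab) h w : hcoef T (k *: h) w = k * hcoef T h w.
Proof.
suff -> : hcoef T (k *: h) = fun w => k * hcoef T h w by [].
apply: hcoef_unique; have hS := @hcoef_out h.
rewrite {1}(hcoef_sum hS) scaler_sumr.
rewrite [X in expansion T X](_ : _ = \sum_(w <- supp (hcoef T h)) (k * hcoef T h w) *: T w).
  by apply: expansion_sum => x xS; rewrite hS ?mulr0.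
by apply: eq_bigr => x _; rewrite scalerA.
Qed.

Lemma hcoefT v w : hcoef T (T v) w = (if w == v then 1 else 0).
Proof.
suff -> : hcoef T (T v) = fun w => (if w == v then 1 else 0) by [].
apply: hcoef_unique.
rewrite [X in expansion T X](_ : _ = \sum_(w <- [fset v]%fset) (if w == v then 1 else 0) *: T w).
  apply: expansion_sum => x; rewrite in_fset1 => /negbTE e.
  by rewrite e.
by rewrite big_seq_fset1 eqxx scale1r.
Qed.

Lemma hecke_ind (Q : H -> Prop) : Q 0 -> (forall h h', Q h -> Q h' -> Q (h + h')) ->
  (forall k w, Q (k *: T w)) -> forall h, Q h.
Proof.
move=> Q0 QD QT h; rewrite (hcoef_sum (@hcoef_out h)).
by elim/big_rec: _ => // w x _; exact: QD.
Qed.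

Lemma hecke_ext (M : zmodType) (f g : H -> M) :
  {morph f : x y / x + y} -> {morph g : x y / x + y} ->
  (forall k w, f (k *: T w) = g (k *: T w)) -> f =1 g.
Proof.
move=> fD gD fg h.
have [f0 g0] := (morphD_0 fD, morphD_0 gD).
elim/hecke_ind: h => [|x y fx fy|//]; first by rewrite f0 g0.
by rewrite fD gD fx fy.
Qed.

(** l(1) = 0 makes T_1 a left unit on the basis, hence on H; apply it to 1. *)
Lemma hecke_T1 : T 1%g = 1.
Proof.
have l1 : wlength (1 : W)%g = 0%N.
  apply/eqP; rewrite cardfs_eq0; apply/eqP; rewrite -fset_set0.
  congr fset_set; apply/seteqP; split=> // A [Apos].
  by rewrite wact_root1 => -[].
have TT w : T 1%g * T w = T w.
  by rewrite (hecke_mul T_hecke) ?mul1g// l1.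
have T1 h : T 1%g * h = h.
  elim/hecke_ind: h => [|x y hx hy|k w]; first by rewrite mulr0.
    by rewrite mulrDr hx hy.
  by rewrite -scalerAr TT.
by rewrite -[LHS]mulr1 T1.
Qed.

End HeckeCoefficients.

(** * The star product of H on chains *)

Section Star.
Context (R : comNzRingType) (n : nat) (D : root_system n).
Context (K : realType) (P : apartment K D).
Local Notation V := 'cV[K]_(adim P).
Local Notation W := (extW D).
Local Notation Rab := {poly {poly R}}.
Context (H : algType Rab) (T : W -> H) (T_hecke : generic_hecke T).
Implicit Types (z h : H) (v w x s : W).
Local Notation TH := T_hecke.

Lemma hecke_mul_Omega w x : Omega x -> T w * T x = T (w * x)%g.
Proof.
by move=> xO; apply: (hecke_mul TH); rewrite (wlength_mul_Omega P)// [wlength x]xO addn0.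
Qed.

Lemma hecke_Omega_mul w x : Omega x -> T x * T w = T (x * w)%g.
Proof.
move=> xO; apply: (hecke_mul TH); rewrite [wlength x]xO add0n.
rewrite -(wlengthV P (x * w)%g) invgM (wlength_mul_Omega P) ?(wlengthV P)//.
exact: (OmegaV P).
Qed.

Lemma hecke_Omega_mulV x : Omega x -> T x * T x^-1%g = 1.
Proof. by move=> xO; rewrite hecke_Omega_mul// mulgV hecke_T1. Qed.

Lemma hecke_sqr s : S_aff s ->
  T s * T s = (par_a R + par_b R) *: T s + (- (par_a R * par_b R)) *: 1.
Proof.
move=> /(hecke_quad TH); rewrite mulrBr !mulrBl => /eqP.
rewrite !mulr_algl !mulr_algr scalerA subr_eq add0r subr_eq => /eqP->.
by rewrite addrAC scaleNr scalerDl [par_a R *: _ + _]addrC.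
Qed.

Lemma hecke_mul_d i (o : ofacet P i) w : inCbar (wfacet w^-1%g (ofac o)) ->
  T (d_ (ofac o)) * T ((d_ (ofac o))^-1 * w)%g = T w.
Proof.
move=> wo; rewrite (hecke_mul TH) mulVKg//.
exact: wlength_d.
Qed.

Lemma face_wfacetV w (F G : facet P) : is_face F G ->
  is_face (wfacet w^-1%g F) (wfacet w^-1%g G).
Proof. by move=> FG; apply/is_face_wfacet. Qed.

Lemma inCbar_face (F G : facet P) : is_face F G -> inCbar G -> inCbar F.
Proof.
move=> FG GC; have [Ff Gg] := (facet_ptP F, facet_ptP G).
apply/(inCbarP Ff) => B Bpos; rewrite leNgt; apply/negP => neg.
have := (is_faceP Ff Gg).1 FG _ (affine_root_opp Bpos.1).
rewrite !aff_val_opp !oppr_gt0 => /(_ neg); apply/negP; rewrite -leNgt.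
by apply: (inCbarP Gg).1.
Qed.

(** Lengths add by three uses of [wlength_d]: for w at G, and for w and d_G at F. This is where the
    transition maps meet the star product. *)
Lemma hecke_mul_face w (F G : facet P) : is_face F G ->
  inCbar (wfacet w^-1%g G) ->
  T ((d_ F)^-1 * d_ G)%g * T ((d_ G)^-1 * w)%g = T ((d_ F)^-1 * w)%g.
Proof.
move=> FG wG; rewrite (hecke_mul TH) -mulgA mulVKg//.
have wF := inCbar_face (face_wfacetV (w := w) FG) wG.
have dF := inCbar_face (face_wfacetV (w := d_ G) FG) (@d_inCbar _ _ _ _ G).
apply/eqP; rewrite -(eqn_add2l (wlength (d_ F))) -(wlength_d wF) addnA.
by rewrite -(wlength_d dF) -(wlength_d wG).
Qed.

Context (i : nat).
Implicit Types (o p q : ofacet P i) (c : chain P H i).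
Local Notation hc := (hcoef T).
Local Notation hsupp z := (fset_set [set w | hcoef T z w != 0]).

(* star z c is the product z . c in the bimodule of chains, provided c is     *)
(* supported on the closure of C and its value on F is read in H at F, not    *)
(* transported by T_(d_F).                                                    *)
Definition star_fun z c p : H :=
  \sum_(w \in [set: W]) hc z w *: (T ((d_ (ofac p))^-1 * w)%g * c (wofacet w^-1%g p)).

Lemma star_funE z c p (S : {fset W}) : (forall w, w \notin S -> hc z w = 0) ->
  star_fun z c p = \sum_(w <- S) hc z w *: (T ((d_ (ofac p))^-1 * w)%g * c (wofacet w^-1%g p)).
Proof. by move=> zS; apply: fsbigTE => w /zS->; rewrite scale0r. Qed.

Fact star_subproof z c : star_fun z c \in @chain_pred _ _ _ P H i.
Proof.
have [/= cf co] := asboolP _ (chainP c).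
apply/asboolP; split.
  apply: (@sub_finite_set _ _ (\bigcup_(w in [set w | hc z w != 0])
      (wofacet w @` [set o | c o != 0]))).
    move=> p /=; apply: contra_neqP => np.
    apply: fsbig1 => w _; have [->|w0] := eqVneq (hc z w) 0; first exact: scale0r.
    have [->|c0] := eqVneq (c (wofacet w^-1%g p)) 0; first by rewrite mulr0 scaler0.
    by exfalso; apply: np; exists w => //; exists (wofacet w^-1%g p); rewrite ?wofacetVK.
  apply: bigcup_finite; first exact: finite_hcoef.
  by move=> w _; exact: finite_image.
move=> i0 o o' e s; rewrite /star_fun e -fsbig_opp.
apply: eq_fsbigr => w _; rewrite -scalerN -mulrN; congr (_ *: (_ * _)).
apply: co => //; first by rewrite !ofac_wofacet e.
by move=> Y /=; rewrite s.
Qed.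
Definition star z c : chain P H i := Chain (star_subproof z c).

Lemma starE z c p : star z c p = star_fun z c p. Proof. by []. Qed.

Lemma starDl z z' c : star (z + z') c = star z c + star z' c.
Proof.
apply: chain_ext => p; rewrite chain_valD !starE.
pose S := (hsupp z `|` hsupp z')%fset.
have zS w : w \notin S -> hc z w = 0.
  by rewrite inE negb_or => /andP[+ _]; exact: hcoef_out.
have z'S w : w \notin S -> hc z' w = 0.
  by rewrite inE negb_or => /andP[_]; exact: hcoef_out.
rewrite (star_funE _ _ zS) (star_funE _ _ z'S) (@star_funE _ _ _ S) => [|w wS].
  by rewrite -big_split; apply: eq_bigr => w _; rewrite hcoefD// scalerDl.
by rewrite hcoefD// zS// z'S// addr0.
Qed.

Lemma starDr z c c' : star z (c + c') = star z c + star z c'.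
Proof.
apply: chain_ext => p; rewrite chain_valD !starE.
rewrite !(star_funE _ _ (hcoef_out TH (h := z))) -big_split.
by apply: eq_bigr => w _; rewrite chain_valD mulrDr scalerDr.
Qed.

Lemma star_ract z c h : star z (chain_ract c h) = chain_ract (star z c) h.
Proof.
apply: chain_ext => p; rewrite /= !(star_funE _ _ (hcoef_out TH (h := z))).
by rewrite mulr_suml; apply: eq_bigr => w _; rewrite /= -scalerAl mulrA.
Qed.

(** Scalars are central and pass to the right action, so identities respecting that action need
    checking only for z = T_w. *)
Lemma starZl k z c : star (k *: z) c = chain_ract (star z c) k%:A.
Proof.
apply: chain_ext => p; rewrite /= (star_funE _ _ (hcoef_out TH (h := z))).
rewrite (@star_funE _ _ _ (hsupp z)) => [|w /(hcoef_out TH) zw].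
  rewrite mulr_suml; apply: eq_bigr => w _.
  by rewrite hcoefZ// mulr_algr scalerA.
by rewrite hcoefZ// zw mulr0.
Qed.

Lemma star_T w c p : star (T w) c p = T ((d_ (ofac p))^-1 * w)%g * c (wofacet w^-1%g p).
Proof.
rewrite starE (@star_funE _ _ _ [fset w]%fset) => [|v].
  by rewrite big_seq_fset1 hcoefT// eqxx scale1r.
by rewrite in_fset1 hcoefT// => /negbTE->.
Qed.

Fact lmul_subproof h c : (fun o => h * c o) \in @chain_pred _ _ _ P H i.
Proof.
have [/= cf co] := asboolP _ (chainP c); apply/asboolP; split.
  apply: (sub_finite_set _ cf) => o /=; apply: contra_neq => ->.
  by rewrite mulr0.
by move=> i0 o o' e s; rewrite (co i0 o o')// mulrN.
Qed.
Definition chain_lmul h c : chain P H i := Chain (lmul_subproof h c).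

Lemma chain_lmul_elem h h' o : chain_lmul h (elem o h') = elem o (h * h').
Proof. by apply: chain_ext => p; rewrite /= -mulrzAr. Qed.

Fact pull_subproof w c : (fun o => c (wofacet w^-1%g o)) \in @chain_pred _ _ _ P H i.
Proof.
have [/= cf co] := asboolP _ (chainP c); apply/asboolP; split.
  apply: (sub_finite_set _ (finite_image (wofacet w) cf)) => o /= co0.
  by exists (wofacet w^-1%g o); rewrite ?wofacetVK.
move=> i0 o o' e s; apply: (co i0); first by rewrite !ofac_wofacet e.
by move=> Y /=; rewrite s.
Qed.
Definition chain_pull w c : chain P H i := Chain (pull_subproof w c).

Lemma chain_pull_elem w o h : chain_pull w (elem o h) = elem (wofacet w o) h.
Proof. by apply: chain_ext => p; rewrite /= -(osgn_wofacet w) wofacetVK. Qed.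

(** As l(x) = 0, lengths add both in T_w T_x and in the coefficient T_(d_p^-1 w) T_x. *)
Lemma star_mul_Omega z x c : Omega x ->
  star (z * T x) c = star z (chain_lmul (T x) (chain_pull x c)).
Proof.
move=> xO; move: z; apply: (hecke_ext TH) => [y y'|y y'|k w].
- by rewrite mulrDl starDl.
- by rewrite starDl.
rewrite -scalerAl !starZl; congr chain_ract; apply: chain_ext => p.
rewrite (hecke_mul_Omega _ xO) !star_T /= invgM wofacetM mulrA.
by rewrite hecke_mul_Omega// mulgA.
Qed.

(* For T_w T_s with l(ws) < l(w), write w = w's with l(w') < l(w) and use the *)
(* quadratic relation.                                                        *)
Lemma star_mul_S z s c : S_aff s ->
  (forall o, c o != 0 -> inCbar (ofac o) /\ S_of (ofac o) s) ->
  star (z * T s) c = star z (chain_lmul (T s) c).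
Proof.
move=> sS cs; have ss := S_aff_invol sS.
have sV : (s^-1 = s)%g by rewrite -[LHS]mulg1 -ss mulKg.
move: z; apply: (hecke_ext TH) => [y y'|y y'|k w]; rewrite ?mulrDl ?starDl//.
rewrite -scalerAl !starZl; congr chain_ract.
(* The lengthening case. On the support of c', fixed by s, both v^-1 p and (v s)^-1 p lie in the
   closure of C; by [wlength_d] passing from d_p^-1 v to d_p^-1 v s also adds one to the length. *)
have up v c' : (forall o, c' o != 0 -> inCbar (ofac o) /\ S_of (ofac o) s) ->
    wlength (v * s)%g = (wlength v).+1 ->
    star (T v * T s) c' = star (T v) (chain_lmul (T s) c').
  move=> {}cs vs; have l1 := S_aff_length P sS.
  rewrite (hecke_mul TH) ?vs ?l1 ?addn1//; apply: chain_ext => p; rewrite !star_T /=.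
  rewrite invgM sV wofacetM.
  have fixs q : c' q != 0 -> wofacet s q = q by move=> /cs[_]; exact: S_of_wofacet.
  set q := wofacet v^-1%g p.
  have -> : c' (wofacet s q) = c' q.
    have [q0|/fixs->//] := eqVneq (c' q) 0; rewrite q0.
    have [->//|sq0] := eqVneq (c' (wofacet s q)) 0.
    by have := fixs _ sq0; rewrite -wofacetM ss wofacet1 => e; rewrite -e q0 eqxx in sq0.
  have [->|q0] := eqVneq (c' q) 0; first by rewrite !mulr0.
  have [qC qs] := cs _ q0; rewrite mulrA; congr (_ * _).
  rewrite (hecke_mul TH) ?mulgA//.
  have C1 : inCbar (wfacet v^-1%g (ofac p)) by rewrite -ofac_wofacet.
  have C2 : inCbar (wfacet (v * s)^-1%g (ofac p)).
    by rewrite invgM sV wfacetM -ofac_wofacet (S_of_fix qs).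
  apply/eqP; rewrite -mulgA -(eqn_add2l (wlength (d_ (ofac p)))) addnA.
  by rewrite -(wlength_d C1) -(wlength_d C2) vs l1 addn1.
have [A AS As] := sS; have [pos|npos] := pselect (aff_pos D (wact_root w A)).
  by apply: up => //; exact: (wlength_refl_pos P AS As pos).
have neg : aff_neg D (wact_root w A).
  by split=> //; apply: affine_root_wact; exact: simple_affine_root.
have := wlength_refl_neg P AS As neg; set v := (w * s)%g => wv.
have vs : (v * s = w)%g by rewrite -mulgA ss mulg1.
have {wv} l1 : wlength (v * s)%g = (wlength v).+1 by rewrite vs.
have -> : T w = T v * T s by rewrite (hecke_mul TH) vs// -vs l1 (S_aff_length P sS) addn1.
have cs' o : chain_lmul (T s) c o != 0 -> inCbar (ofac o) /\ S_of (ofac o) s.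
  by move=> /= h; apply: cs; apply: contra_neq h => ->; rewrite mulr0.
rewrite up// -mulrA hecke_sqr// mulrDr -!scalerAr mulr1 starDl !starZl up//.
rewrite -!star_ract -starDr; congr (star _ _); apply: chain_ext => p.
rewrite chain_valD /= mulrA hecke_sqr// mulrDl -!scalerAl mul1r.
by rewrite !mulr_algr.
Qed.

End Star.

(** * Star product against boundary, augmentation and the algebras H_F *)

Section Equivariance.
Context (R : comNzRingType) (n : nat) (D : root_system n).
Context (K : realType) (P : apartment K D).
Local Notation W := (extW D).
Local Notation Rab := {poly {poly R}}.
Context (H : algType Rab) (T : W -> H) (T_hecke : generic_hecke T).
Implicit Types (z h : H) (v w x s : W).
Local Notation TH := T_hecke.

Definition supported_in_Cbar i (c : chain P H i) : Prop :=
  forall o, c o != 0 -> inCbar (ofac o).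

Lemma boundary_fset (T' : W -> H) i (c : chain P H i.+1) (p : ofacet P i)
    (S : {fset ofacet P i.+1}) : (forall q, q \notin S -> c q = 0) ->
  boundary T' c p = \sum_(q <- S) (if `[< is_face p q /\ induces q p >]
                                   then transition T' q p (c q) else 0).
Proof.
move=> cS; rewrite /= /boundary_fun fsbig_mkcond.
rewrite (@fsbigTE _ _ _ _ S); last first.
  by move=> q /cS cq; rewrite /patch /transition cq mulr0; case: ifP.
apply: eq_bigr => q _; rewrite /patch; congr (if _ then _ else _).
Qed.

Lemma supp_out i (c : chain P H i) (S : {fset ofacet P i}) o :
  (supp c `<=` S)%fset -> o \notin S -> c o = 0.
Proof.
move=> /fsubsetP cS oS; apply/eqP; apply: contraNT oS.
by rewrite -mem_supp; exact: cS.
Qed.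

Lemma boundaryD (T' : W -> H) i : {morph boundary (P := P) T' (i := i) : c c' / c + c'}.
Proof.
move=> c c'; apply: chain_ext => p; rewrite chain_valD.
have cS := @supp_out _ c (supp c `|` supp c')%fset ^~ (fsubsetUl _ _).
have c'S := @supp_out _ c' (supp c `|` supp c')%fset ^~ (fsubsetUr _ _).
rewrite (boundary_fset _ _ cS) (boundary_fset _ _ c'S).
rewrite (@boundary_fset _ _ _ _ (supp c `|` supp c')%fset) => [|q qS].
  rewrite -big_split; apply: eq_bigr => q _; case: ifP => _; last by rewrite /= addr0.
  by rewrite /transition chain_valD mulrDr.
by rewrite chain_valD cS// c'S// addr0.
Qed.

Lemma boundary_ract (T' : W -> H) i (c : chain P H i.+1) h :
  boundary T' (chain_ract c h) = chain_ract (boundary T' c) h.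
Proof.
apply: chain_ext => p; have cS := @supp_out _ c (supp c) ^~ (fsubset_refl _).
rewrite [RHS]/= -[boundary_fun _ _ _]/(boundary T' c p) (boundary_fset _ _ cS).
rewrite (@boundary_fset _ _ _ _ (supp c)) => [|q /cS qS]; last by rewrite /= qS mul0r.
rewrite mulr_suml; apply: eq_bigr => q _; case: ifP; rewrite ?mul0r//.
by rewrite /transition mulrA.
Qed.

Lemma supported_boundary (T' : W -> H) i (c : chain P H i.+1) :
  supported_in_Cbar c -> supported_in_Cbar (boundary T' c).
Proof.
move=> cC p h.
have [[q [pq q0]]|nq] := pselect (exists q : ofacet P i.+1, is_face p q /\ c q != 0).
  by apply: (inCbar_face pq); exact: cC.
exfalso; move/eqP: h; apply; apply: fsbig1 => q [pq _].
have [q0|q0] := eqVneq (c q) 0; first by rewrite /transition q0 mulr0.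
by exfalso; apply: nq; exists q.
Qed.

(** The values of c are not yet transported, so its own boundary is taken with identity transitions,
    [fun=> 1]. For z = T_w, reindexing the cofaces of p by w matches the terms through
    [hecke_mul_face]. *)
Lemma boundary_star i z (c : chain P H i.+1) : supported_in_Cbar c ->
  boundary T (star TH z c) = star TH z (boundary (fun=> 1) c).
Proof.
move=> cC; move: z; apply: (hecke_ext TH) => [y y'|y y'|k w].
- by rewrite starDl boundaryD.
- by rewrite starDl.
rewrite !starZl boundary_ract; congr chain_ract; apply: chain_ext => p.
rewrite star_T /= /boundary_fun.
rewrite (reindex_fsbig (@wofacet _ _ _ _ i.+1 w) [set q : ofacet P i.+1 | is_face (wofacet w^-1%g p) q /\ induces q (wofacet w^-1%g p)]); last first.
  split.
  - move=> q [pq qp]; split.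
      by have /(is_face_wfacet w) := pq; rewrite -!ofac_wofacet wofacetVK.
    by have := induces_wofacet (w := w) qp; rewrite wofacetVK.
  - by move=> q q' _ _; exact: (can_inj (wofacetK w)).
  - move=> q [pq qp]; exists (wofacet w^-1%g q); last exact: wofacetVK.
    split; last exact: induces_wofacet.
    exact/(is_face_wfacet w^-1%g).
rewrite mulr_fsum_support; last first.
  apply: (sub_finite_set _ (finite_supp c)) => q [_ /=] h.
  by apply/eqP => q0; apply: h; rewrite /transition q0 mulr0.
apply: eq_fsbigr => q /set_mem[pq _].
rewrite /transition mul1r -(starE TH) star_T wofacetK.
have [->|q0] := eqVneq (c q) 0; first by rewrite !mulr0.
rewrite mulrA; congr (_ * _); apply: (hecke_mul_face TH).
  by have /(is_face_wfacet w) := pq; rewrite -!ofac_wofacet wofacetVK.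
by rewrite -!ofac_wofacet wofacetK; exact: cC.
Qed.

Lemma augmentationE (T' : W -> H) (c : chain P H 0) (S : {fset ofacet P 0}) :
  (forall q, q \notin S -> c q = 0) ->
  augmentation T' c = \sum_(q <- S) T' (d_ (ofac q)) * c q.
Proof. by move=> cS; apply: fsbigTE => q /cS->; rewrite mulr0. Qed.

Lemma augmentationD (T' : W -> H) :
  {morph augmentation (P := P) T' : c c' / c + c'}.
Proof.
move=> c c'; have cS := @supp_out _ c (supp c `|` supp c')%fset ^~ (fsubsetUl _ _).
have c'S := @supp_out _ c' (supp c `|` supp c')%fset ^~ (fsubsetUr _ _).
rewrite (augmentationE _ cS) (augmentationE _ c'S).
rewrite (@augmentationE _ _ (supp c `|` supp c')%fset) => [|q qS].
  by rewrite -big_split; apply: eq_bigr => q _; rewrite chain_valD mulrDr.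
by rewrite chain_valD cS// c'S// addr0.
Qed.

Lemma augmentation_ract (T' : W -> H) (c : chain P H 0) h :
  augmentation T' (chain_ract c h) = augmentation T' c * h.
Proof.
have cS := @supp_out _ c (supp c) ^~ (fsubset_refl _).
rewrite (augmentationE _ cS) (@augmentationE _ _ (supp c)) => [|q /cS qS].
  by rewrite mulr_suml; apply: eq_bigr => q _; rewrite /= mulrA.
by rewrite /= qS mul0r.
Qed.

(** The same with T_(d_x) as last transition: [hecke_mul_d] collapses T_(d_x) T_(d_x^-1 w) to
    T_w. *)
Lemma augmentation_star z (c : chain P H 0) : supported_in_Cbar c ->
  augmentation T (star TH z c) = z * augmentation (fun=> 1) c.
Proof.
move=> cC; move: z; apply: (hecke_ext TH) => [y y'|y y'|k w].
- by rewrite starDl augmentationD.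
- by rewrite mulrDl.
rewrite starZl augmentation_ract mulr_algr -scalerAl; congr (_ *: _).
rewrite /augmentation (reindex_fsbigT (@wofacet _ _ _ P 0 w)); last exact: wofacet_bij.
rewrite mulr_fsum_support; last first.
  apply: (sub_finite_set _ (finite_supp c)) => q [_ /=] h.
  by apply/eqP => q0; apply: h; rewrite q0 mulr0.
apply: eq_fsbigr => q _; rewrite star_T wofacetK mul1r.
have [->|q0] := eqVneq (c q) 0; first by rewrite !mulr0.
rewrite mulrA hecke_mul_d// -ofac_wofacet wofacetK; exact: cC.
Qed.

Lemma supported_elem i (o : ofacet P i) h : inCbar (ofac o) -> supported_in_Cbar (elem o h).
Proof.
move=> oC p; rewrite elemE; have [<-//|ne] := pselect (ofac o = ofac p).
by rewrite osgn_neq// mulr0z eqxx.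
Qed.

Lemma star_elemD i z (o : ofacet P i) h h' :
  star TH z (elem o (h + h')) = star TH z (elem o h) + star TH z (elem o h').
Proof. by rewrite elemD starDr. Qed.

Lemma starMzr i z (c : chain P H i) (k : int) : star TH z (c *~ k) = star TH z c *~ k.
Proof. by apply: (morphMz (f := star TH z)) => c1 c2; exact: starDr. Qed.

Lemma starMzl i z (c : chain P H i) (k : int) : star TH (z *~ k) c = star TH z c *~ k.
Proof.
by apply: (@morphMz H (chain P H i) (fun y => star TH y c)) => y y'; exact: starDl.
Qed.

Lemma elemZ i (o : ofacet P i) (k : Rab) h : elem o (k *: h) = chain_ract (elem o h) k%:A.
Proof.
apply: chain_ext => p; rewrite /= mulr_algr.
by rewrite -(morphMz (f := fun x : H => k *: x))// => x y; exact: scalerDr.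
Qed.

Lemma elem_ract i (o : ofacet P i) h h' : elem o (h * h') = chain_ract (elem o h) h'.
Proof. by apply: chain_ext => p; rewrite /= mulrzAl. Qed.

(** The relation z r' (x) h = z (x) r h of the tensor product, read through [star]. *)
Definition balanced i (o : ofacet P i) (r' r : H) : Prop :=
  forall z h, star TH (z * r') (elem o h) = star TH z (elem o (r * h)).

Lemma balancedM i (o : ofacet P i) (x1 y1 x2 y2 : H) :
  balanced o x1 y1 -> balanced o x2 y2 -> balanced o (x1 * x2) (y1 * y2).
Proof. by move=> b1 b2 z h; rewrite mulrA b2 b1 mulrA. Qed.

Lemma balancedD i (o : ofacet P i) (x1 y1 x2 y2 : H) :
  balanced o x1 y1 -> balanced o x2 y2 -> balanced o (x1 + x2) (y1 + y2).
Proof. by move=> b1 b2 z h; rewrite mulrDr mulrDl starDl star_elemD b1 b2. Qed.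

Lemma balancedZ i (o : ofacet P i) (k : Rab) (r' r : H) :
  balanced o r' r -> balanced o (k *: r') (k *: r).
Proof.
by move=> b z h; rewrite -scalerAr -scalerAl starZl b elemZ star_ract.
Qed.

(** No sign appears, since s preserves the orientations of a facet that it fixes pointwise. *)
Lemma balanced_S i (o : ofacet P i) s : inCbar (ofac o) -> S_of (ofac o) s ->
  balanced o (T s) (T s).
Proof.
move=> oC so z h; rewrite star_mul_S ?chain_lmul_elem//; first by case: so.
move=> p; rewrite elemE; have [<-//|ne] := pselect (ofac o = ofac p).
by rewrite osgn_neq// mulr0z eqxx.
Qed.

Lemma star_mul_Omega_elem i z x (o : ofacet P i) h : Omega x ->
  star TH (z * T x) (elem o h) = star TH z (elem (wofacet x o) (T x * h)).
Proof. by move=> xO; rewrite star_mul_Omega// chain_pull_elem chain_lmul_elem. Qed.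

(** x maps (F, c) to F with orientation eps(x) c, and this sign cancels the one attached to T_x. *)
Lemma balanced_Omega i (o : ofacet P i) x : Omega x -> wfacet x (ofac o) = ofac o ->
  balanced o (T x *~ eps (ofac o) x) (T x).
Proof.
move=> xO xo z h; rewrite mulrzAr starMzl star_mul_Omega_elem//.
rewrite (elem_osgn (o' := wofacet x o) _ (esym xo)) elemMz starMzr -(eps_osgn xo) -mulrzA.
suff -> : eps (ofac o) x * eps (ofac o) x = 1 by rewrite mulr1z.
by rewrite /eps; case: ifP.
Qed.

(** [stab_ind] builds w from Omega and simple reflections fixing F with lengths adding, so T_w is
    the corresponding product; the reflections leave eps unchanged ([S_of_eps]). *)
Lemma balanced_W i (o : ofacet P i) w : inCbar (ofac o) -> W_of (ofac o) w ->
  balanced o (T w *~ eps (ofac o) w) (T w).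
Proof.
move=> oC /(W_ofP _ oC); move: w; apply: (stab_ind oC oC) => [x xO|x s so xo xs bx].
  exact: balanced_Omega.
have -> : T (x * s)%g = T x * T s.
  by apply/esym/(hecke_mul TH); rewrite xs (S_aff_length P so.1) addn1.
by rewrite S_of_eps// -mulrzAl; apply: balancedM bx _; exact: balanced_S.
Qed.

Lemma j_of_sum i (o : ofacet P i) h (S : {fset W}) : H_of T (ofac o) h ->
  (forall w, w \notin S -> hcoef T h w = 0) ->
  j_of T (ofac o) h = \sum_(w <- S) hcoef T h w *: (T w *~ eps (ofac o) w).
Proof.
move=> [c hc cW] hS; rewrite /j_of fsbig_mkcond.
rewrite (@fsbigTE _ _ _ _ S) => [|w /hS hw]; last first.
  by rewrite /patch hw mul0rz scale0r if_same.
apply: eq_bigr => w _; rewrite /patch.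
have e : (hcoef T h w *~ eps (ofac o) w) *: T w = hcoef T h w *: (T w *~ eps (ofac o) w).
  rewrite (morphMz (f := fun x : Rab => x *: T w)); last by move=> x y; exact: scalerDl.
  by rewrite (morphMz (f := fun x : H => hcoef T h w *: x))// => x y; exact: scalerDr.
case: ifPn => // nW; have [h0|h0] := eqVneq (hcoef T h w) 0; first by rewrite h0 scale0r.
have c0 : c w != 0 by rewrite -(hcoef_unique TH hc).
by exfalso; move/negP: nW; apply; apply/mem_set; exact: (cW w c0).
Qed.

(** The sign in [balanced_W] is the reason for the twist by j_F in the left factor. *)
Lemma balanced_H i (o : ofacet P i) h : inCbar (ofac o) -> H_of T (ofac o) h ->
  balanced o (j_of T (ofac o) h) h.
Proof.
move=> oC hH; have hS := @hcoef_out _ _ _ _ _ TH h.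
rewrite (j_of_sum hH hS) [X in balanced _ _ X](hcoef_sum TH hS).
have [c hc cW] := hH; have cE := hcoef_unique TH hc.
have b0 : balanced o 0 0.
  have b1 : balanced o 1 1 by move=> z k; rewrite mulr1 mul1r.
  by have := balancedZ 0 b1; rewrite scale0r.
elim: (fset_set _ : seq _) => [|w r IHr]; first by rewrite !big_nil.
rewrite !big_cons; apply: balancedD IHr.
have [->|c0] := eqVneq (hcoef T h w) 0; first by rewrite !scale0r.
by apply/balancedZ/balanced_W => //; apply: (cW w); rewrite -cE.
Qed.

End Equivariance.

(** * Tensor products *)

Lemma morphB_D (M N : zmodType) (f : M -> N) :
  {morph f : x y / x - y} -> {morph f : x y / x + y}.
Proof.
move=> fB x y; have f0 : f 0 = 0 by rewrite -{1}(subrr 0) fB subrr.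
by rewrite -[y in LHS]opprK fB -[- y]sub0r fB f0 sub0r opprK.
Qed.

Section TensorTheory.
Local Open Scope quotient_scope.
Context (M N : zmodType) (S : Type) (B : set S).
Context (mr : M -> S -> M) (nl : S -> N -> N).
Local Notation tensor := (tensor B mr nl).
Local Notation tens := (tens B mr nl).
Local Notation piT := (\pi_(Quotient.quot (tensor_pred B mr nl))).

Lemma pi_tensor_eq x y : tensor_rel B mr nl (x - y) -> piT x = piT y.
Proof. by move=> r; apply/eqP; rewrite -Quotient.idealrBE; exact/asboolP. Qed.

Lemma pi_tensorD : {morph piT : x y / x + y >-> (x + y : tensor)}.
Proof. by move=> x y; exact: raddfD. Qed.

Lemma tensDl m m' z : tens (m + m') z = tens m z + tens m' z.
Proof.
rewrite /Defs.tens -pi_tensorD; apply: pi_tensor_eq.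
by rewrite opprD addrA; exact: TensorRelDl.
Qed.

Lemma tensDr m z z' : tens m (z + z') = tens m z + tens m z'.
Proof.
rewrite /Defs.tens -pi_tensorD; apply: pi_tensor_eq.
by rewrite opprD addrA; exact: TensorRelDr.
Qed.

Lemma tensS m s z : B s -> tens (mr m s) z = tens m (nl s z).
Proof. by move=> Bs; apply: pi_tensor_eq; exact: TensorRelS. Qed.

Lemma freeg_ind_additive (Q : {freeg (M * N)} -> Prop) : Q 0 ->
  (forall x y, Q x -> Q y -> Q (x + y)) -> (forall x, Q x -> Q (- x)) ->
  (forall p, Q << p >>) -> forall x, Q x.
Proof.
move=> Q0 QD QN QU x; rewrite -[x]freeg_sumE.
elim/big_rec: _ => // p y _ Qy; apply: (QD) => //.
have Qn (k : nat) : Q (<< p >> *+ k) by elim: k => // k IHk; rewrite mulrS; apply: QD.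
have -> : << coeff p x *g p >> = << p >> *~ (coeff p x) :> {freeg (M * N)}.
  by rewrite freegU_mulz intz.
by case: (coeff p x) => k; rewrite ?NegzE ?mulrNz; [|apply: QN]; exact: Qn.
Qed.

Lemma tensor_ind (Q : tensor -> Prop) : Q 0 ->
  (forall x y, Q x -> Q y -> Q (x + y)) -> (forall x, Q x -> Q (- x)) ->
  (forall m z, Q (tens m z)) -> forall t, Q t.
Proof.
move=> Q0 QD QN QT t; rewrite -[t]reprK; elim/freeg_ind_additive: (repr t).
- by rewrite raddf0.
- by move=> x y Qx Qy; rewrite raddfD; exact: QD.
- by move=> x Qx; rewrite raddfN; exact: QN.
- by case=> m z; exact: QT.
Qed.

Lemma tensor_ext (A : zmodType) (f g : tensor -> A) :
  {morph f : x y / x + y} -> {morph g : x y / x + y} ->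
  (forall m z, f (tens m z) = g (tens m z)) -> f =1 g.
Proof.
move=> fD gD fg.
have [f0 g0] := (morphD_0 fD, morphD_0 gD).
elim/tensor_ind => [|x y fx fy|x fx|//]; first by rewrite f0 g0.
  by rewrite fD gD fx fy.
by apply: (@addrI _ (f x)); rewrite -fD {1}fx -gD !subrr f0 g0.
Qed.

(** Universal property: the extension to the free abelian group kills the relators, so the
    representative chosen in the quotient does not matter. *)
Lemma tensor_lift (A : zmodType) (f : M -> N -> A) :
  (forall m m' z, f (m + m') z = f m z + f m' z) ->
  (forall m z z', f m (z + z') = f m z + f m z') ->
  (forall m s z, B s -> f (mr m s) z = f m (nl s z)) ->
  exists2 F : tensor -> A, {morph F : x y / x + y} & forall m z, F (tens m z) = f m z.
Proof.
move=> fDl fDr fS; pose L := fglift (fun p => f p.1 p.2 : zmodule A).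
have LB : {morph L : x y / x - y} by move=> x y; exact: lift_is_additive.
have LD := morphB_D LB.
have LU p : L << p >> = f p.1 p.2 by rewrite /L liftU scale1r.
have Lrel t : tensor_rel B mr nl t -> L t = 0.
  elim=> [|x y _ x0 _ y0|m m' z|m z z'|m s z Bs].
  - by rewrite -(subrr 0) LB subrr.
  - by rewrite LB x0 y0 subrr.
  - by rewrite !LB !LU /= fDl -addrA -opprD subrr.
  - by rewrite !LB !LU /= fDr -addrA -opprD subrr.
  - by rewrite LB !LU /= fS// subrr.
have Lpi x : L (repr (piT x)) = L x.
  apply/eqP; rewrite -subr_eq0 -LB; apply/eqP/Lrel/asboolP.
  suff : repr (piT x) - x \in tensor_pred B mr nl by [].
  by rewrite Quotient.idealrBE reprK.
exists (fun t => L (repr t)) => [x y|m z]; last by rewrite Lpi LU.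
by rewrite -[x in LHS]reprK -[y in LHS]reprK -raddfD Lpi LD.
Qed.

Lemma tensor_mapD (f : M -> M) (g : N -> N) :
    {morph f : x y / x + y} -> {morph g : x y / x + y} ->
    (forall x s, B s -> f (mr x s) = mr (f x) s) ->
    (forall s y, B s -> g (nl s y) = nl s (g y)) ->
  {morph tensor_map (B := B) (mr := mr) (nl := nl) f g : x y / x + y}.
Proof.
move=> fD gD fS gS.
pose L := fglift (fun p => << (f p.1, g p.2) >> : {freeg (M * N)}).
have LB : {morph L : x y / x - y} by move=> x y; exact: lift_is_additive.
have LU p : L << p >> = << (f p.1, g p.2) >> by rewrite /L liftU scale1r.
have Lrel t : tensor_rel B mr nl t -> tensor_rel B mr nl (L t).
  elim=> [|x y _ rx _ ry|m m' z|m z z'|m s z Bs].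
  - by rewrite -(subrr 0) LB subrr; exact: TensorRel0.
  - by rewrite LB; exact: TensorRelB.
  - by rewrite !LB !LU /= fD; exact: TensorRelDl.
  - by rewrite !LB !LU /= gD; exact: TensorRelDr.
  - by rewrite LB !LU /= fS// gS//; exact: TensorRelS.
have mapE x : tensor_map f g (piT x) = piT (L x).
  apply: pi_tensor_eq; rewrite -LB; apply: Lrel.
  apply/asboolP; suff : repr (piT x) - x \in tensor_pred B mr nl by [].
  by rewrite Quotient.idealrBE reprK.
have LD := morphB_D LB.
move=> x y; rewrite -[x]reprK -[y]reprK -pi_tensorD !mapE LD.
exact: pi_tensorD.
Qed.

End TensorTheory.

(** * The bimodule structure *)

Section ElementaryChains.
Context (R : comNzRingType) (n : nat) (D : root_system n).
Context (K : realType) (P : apartment K D).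
Local Notation W := (extW D).
Local Notation Rab := {poly {poly R}}.
Context (H : algType Rab) (T : W -> H) (T_hecke : generic_hecke T).
Local Notation TH := T_hecke.

Lemma ofacet_exists i (F : facet P) : fdim F = i -> exists o : ofacet P i, ofac o = F.
Proof.
case: _ / => /=; have h : @ofacet_pred _ _ _ P (fdim F) (F, orient_of (direction F) (vbasis (direction F))).
  by apply/asboolP; split=> //; exists (vbasis (direction F)) => //; exact: vbasisP.
by exists (ofacet_sub h).
Qed.

(** Stripping from w the simple reflections that fix F leaves the image of F unchanged, down to
    length zero. *)
Lemma facet_Omega_Cbar (F G : facet P) w : inCbar F -> inCbar G ->
  wfacet w F = G -> exists2 x, Omega x & wfacet x F = G.
Proof.
move=> FC GC; apply: (stab_ind (Q := fun _ => _) FC GC) => // x xO xF.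
by exists x.
Qed.

Lemma star_T_elem i w (o : ofacet P i) h :
  star TH (T w) (elem o h) =
  elem (wofacet w o) (T ((d_ (wfacet w (ofac o)))^-1 * w)%g * h).
Proof.
apply: chain_ext => p; rewrite star_T !elemE -(osgn_wofacet w o) wofacetVK -mulrzAr.
have [e|ne] := pselect (ofac (wofacet w o) = ofac p); last by rewrite osgn_neq// !mulr0z !mulr0.
by rewrite -e.
Qed.

Lemma H_of_T i (o : ofacet P i) (k : Rab) w : W_of (ofac o) w ->
  H_of T (ofac o) (k *: T w).
Proof.
move=> wF; exists (hcoef T (k *: T w)); first exact: hcoefP.
move=> v; rewrite hcoefZ// hcoefT//; case: (v =P w) => [->//|_].
by rewrite mulr0 eqxx.
Qed.

Lemma j_of_T i (o : ofacet P i) (k : Rab) w : W_of (ofac o) w ->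
  j_of T (ofac o) (k *: T w) = k *: (T w *~ eps (ofac o) w).
Proof.
move=> wF; rewrite (j_of_sum TH (H_of_T k wF) (S := [fset w]%fset)) => [|v].
  by rewrite big_seq_fset1 hcoefZ// hcoefT// eqxx mulr1.
by rewrite in_fset1 hcoefZ// hcoefT// => /negbTE->; rewrite mulr0.
Qed.

End ElementaryChains.

Section Bimodule.
Context (R : comNzRingType) (n : nat) (D : root_system n).
Context (K : realType) (P : apartment K D).
Local Notation W := (extW D).
Local Notation Rab := {poly {poly R}}.
Context (H : algType Rab) (T : W -> H) (T_hecke : generic_hecke T).
Context (i : nat) (Fs : {fset facet P}) (Fs_reps : orbit_reps i Fs).
Local Notation TH := T_hecke.
Implicit Types (z h k : H) (v w x : W) (c : chain P H i) (F : Fs) (G : facet P).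

Lemma rep_fdim F : fdim (fsval F) = i.
Proof. by have [h _] := Fs_reps; have [] := h _ (fsvalP F). Qed.

Lemma rep_inCbar F : inCbar (fsval F).
Proof. by have [h _] := Fs_reps; have [] := h _ (fsvalP F). Qed.

Arguments rep_inCbar : clear implicits.

Lemma rep_unique F F' w : fsval F' = wfacet w (fsval F) -> F' = F.
Proof.
move=> e; have [_ /(_ _ (rep_fdim F))[E [_ u]]] := Fs_reps.
have eF : E = fsval F.
  apply: u; split; first exact: fsvalP.
  by exists 1%g; rewrite -[LHS]/(fpts (fsval F)) -{1}(wfacet1 (fsval F)).
have eF' : E = fsval F' by apply: u; split; [exact: fsvalP|exists w; rewrite e].
by apply: val_inj; rewrite /= -eF -eF'.
Qed.

Lemma rep_exists G : fdim G = i -> exists F w, G = wfacet w (fsval F).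
Proof.
move=> Gi; have [_ /(_ _ Gi)[E [[EFs [w Ew]] _]]] := Fs_reps.
exists [` EFs]%fset, w^-1%g; rewrite /=.
have -> : E = wfacet w G by apply: facet_eq.
by rewrite wfacetK.
Qed.

Definition rep_ofacet F : ofacet P i := projT1 (cid (ofacet_exists (rep_fdim F))).
Lemma ofac_rep F : ofac (rep_ofacet F) = fsval F.
Proof. exact: (projT2 (cid (ofacet_exists (rep_fdim F)))). Qed.

Lemma rep_ofacet_inCbar F : inCbar (ofac (rep_ofacet F)).
Proof. by rewrite ofac_rep; exact: rep_inCbar. Qed.

Arguments rep_ofacet_inCbar : clear implicits.

Local Notation tensF F := (tens (H_of T (fsval F)) (fun m s => m * j_of T (fsval F) s)
                            (fun s z => s * z)).
Local Notation elemF F := (elem (rep_ofacet F)).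

(** Of the relations of the tensor product only the H_F-balancing is not formal; it is
    [balanced_H]. *)
Lemma psi_exists F : exists2 f : twisted_tensor T (fsval F) -> chain P H i,
  {morph f : x y / x + y} & forall z h, f (tensF F z h) = star TH z (elemF F h).
Proof.
apply: tensor_lift => [z z' h|z h h'|z s h sH]; first exact: starDl.
  by rewrite elemD starDr.
have := balanced_H TH (rep_ofacet_inCbar F); rewrite ofac_rep.
by apply.
Qed.

Definition psi_at F := projT1 (cid2 (psi_exists F)).
Arguments psi_at : clear implicits.

Lemma psi_atD F : {morph psi_at F : x y / x + y}.
Proof. by rewrite /psi_at; case: cid2. Qed.
Lemma psi_atE F z h : psi_at F (tensF F z h) = star TH z (elemF F h).
Proof. by rewrite /psi_at; case: cid2. Qed.
Lemma psi_at0 F : psi_at F 0 = 0.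
Proof. exact: (morphD_0 (@psi_atD F)). Qed.

Definition psi (t : twisted_sum T Fs) : chain P H i := \sum_F psi_at F (t F).

Lemma psiD : {morph psi : s t / s + t}.
Proof. by move=> s t; rewrite -big_split; apply: eq_bigr => F _; exact: psi_atD. Qed.

(** Among the elements carrying F to G, one with T_x = T_(d_G) T_(d_G^-1 x) and a unit as second
    factor. The default 1 is harmless: [theta] uses only G in the orbit of F. *)
Definition frame F G : W :=
  xget 1%g [set x | G = wfacet x (fsval F) /\ Omega ((d_ G)^-1 * x)%g].

Lemma frameP F G w : G = wfacet w (fsval F) ->
  G = wfacet (frame F G) (fsval F) /\ Omega ((d_ G)^-1 * frame F G)%g.
Proof.
move=> e; have [x xF xO] := facet_Omega (rep_inCbar F) e.
by rewrite /frame; case: xgetP => [y _ //|/(_ x)[]].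
Qed.

(** [star] turns T_x (x) h into the chain with value T_(d_G^-1 x) h on x F = G; inverting this unit
    recovers h from the value of c. *)
Definition theta_term F c G : twisted_tensor T (fsval F) :=
  tensF F (T (frame F G)) (T ((d_ G)^-1 * frame F G)^-1%g * c (wofacet (frame F G) (rep_ofacet F))).

Definition theta c : twisted_sum T Fs := fun F =>
  \sum_(G \in [set G | exists w, G = wfacet w (fsval F)]) theta_term F c G.

Lemma tens0r F z : tensF F z 0 = 0.
Proof. by apply: (morphD_0 (f := tensF F z)) => x y; exact: tensDr. Qed.

Lemma theta_term0 F c G : (exists w, G = wfacet w (fsval F)) ->
  (forall o, c o != 0 -> ofac o <> G) -> theta_term F c G = 0.
Proof.
move=> [w e] h; have [eG _] := frameP e; rewrite /theta_term.
set o := wofacet _ _; have [->|/h] := eqVneq (c o) 0; first by rewrite mulr0 tens0r.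
by rewrite /= ofac_rep -eG.
Qed.

Lemma thetaE F c (S : {fset facet P}) : (forall o, c o != 0 -> ofac o \in S) ->
  theta c F = \sum_(G <- S) (if `[< exists w, G = wfacet w (fsval F) >]
                             then theta_term F c G else 0).
Proof.
move=> cS; rewrite /theta fsbig_mkcond (@fsbigTE _ _ _ _ S) => [|G GS].
  by apply: eq_bigr => G _; rewrite /patch.
rewrite /patch; case: ifPn => // /set_mem GF; apply: theta_term0 => // o oc oG.
by move: GS; rewrite -oG cS.
Qed.

Lemma thetaD : {morph theta : c c' / c + c'}.
Proof.
move=> c c'; apply: functional_extensionality_dep => F.
rewrite -[RHS]/(theta c F + theta c' F).
pose S := [fset ofac o | o in (supp c `|` supp c')%fset]%fset.
have inS (c0 : chain P H i) : (supp c0 `<=` supp c `|` supp c')%fset ->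
    forall o, c0 o != 0 -> ofac o \in S.
  by move=> /fsubsetP c0S o; rewrite -mem_supp => /c0S oS; apply/imfsetP; exists o.
rewrite !(@thetaE F _ S); last 3 first.
- by apply: inS; exact: fsubsetUr.
- by apply: inS; exact: fsubsetUl.
- apply: inS; apply/fsubsetP => o; rewrite inE !mem_supp chain_valD.
  by have [->|//] := eqVneq (c o) 0; rewrite add0r.
rewrite -big_split; apply: eq_bigr => G _; case: ifP => _; last by rewrite /= addr0.
by rewrite /theta_term chain_valD mulrDr tensDr.
Qed.

Lemma theta_elem_out F F' w h : F' <> F -> theta (elem (wofacet w (rep_ofacet F)) h) F' = 0.
Proof.
move=> FF'; apply: fsbig1 => G GF'; apply: theta_term0 => // o oe oG.
move: oe; rewrite elemE; have [e _|ne] := pselect (ofac (wofacet w (rep_ofacet F)) = ofac o); last first.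
  by rewrite osgn_neq// mulr0z eqxx.
case: GF' => v Gv; apply: FF'; apply: (@rep_unique _ _ (v^-1 * w)%g).
by rewrite wfacetM -[in RHS](ofac_rep F) -[wfacet w _]/(ofac (wofacet w (rep_ofacet F))) e oG Gv wfacetK.
Qed.

(** 1 lies in W_F with trivial orientation sign, so scalars belong to H_F and are fixed by j_F. *)
Lemma tens_scale F (k : Rab) z h : tensF F (k *: z) h = tensF F z (k *: h).
Proof.
have W1 : W_of (ofac (rep_ofacet F)) 1%g by apply/(W_ofP _ (rep_ofacet_inCbar F)); exact: wfacet1.
have eps1 : eps (ofac (rep_ofacet F)) 1%g = 1.
  by rewrite eps_osgn ?wfacet1// wofacet1 osgn_self.
have := j_of_T TH k W1; rewrite eps1 mulr1z hecke_T1// ofac_rep => jk.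
have := H_of_T TH k W1; rewrite hecke_T1// ofac_rep => kH.
have := tensS (fun m s => m * j_of T (fsval F) s) (fun s z => s * z) z h kH.
by rewrite /= jk mulr_algr mulr_algl.
Qed.

Lemma tensMzr F z h (k : int) : tensF F z (h *~ k) = tensF F z h *~ k.
Proof. by apply: (morphMz (f := tensF F z)) => x y; exact: tensDr. Qed.

Lemma tensMzl F z h (k : int) : tensF F (z *~ k) h = tensF F z h *~ k.
Proof.
by apply: (@morphMz H (twisted_tensor T (fsval F)) (fun y => tensF F y h)) => x y; exact: tensDl.
Qed.

(** For z = T_w and f the frame of G = w F, the element v = f^-1 w stabilizes F. The value of the
    chain on f (F, c) gives T_f (x) eps(v) T_v h; moving T_v to the left factor brings a second
    eps(v) from j_F, the signs cancel, and T_f T_v = T_w. *)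
Lemma theta_star F z h : theta (star TH z (elemF F h)) F = tensF F z h.
Proof.
move: z; apply: (hecke_ext TH) => [z z'|z z'|k w]; [by rewrite starDl thetaD|exact: tensDl|].
rewrite starZl -star_ract -elemZ tens_scale; move: (k *: h) => {}h.
rewrite star_T_elem; set o := wofacet w _; set G := wfacet w _.
have oG : ofac o = G by [].
have Gw : G = wfacet w (fsval F) by rewrite /G ofac_rep.
rewrite (@thetaE _ _ [fset G]%fset) => [|p]; last first.
  rewrite elemE in_fset1; have [e _|ne] := pselect (ofac o = ofac p); first by rewrite -e oG.
  by rewrite osgn_neq// mulr0z eqxx.
rewrite big_seq_fset1 ifT; last by apply/asboolP; exists w.
rewrite /theta_term; have [GG GO] := frameP Gw; set f := frame F G in GG GO *.
pose v := (f^-1 * w)%g.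
have vF : wfacet v (fsval F) = fsval F by rewrite wfacetM -Gw {1}GG wfacetK.
have vo : wfacet v (ofac (rep_ofacet F)) = ofac (rep_ofacet F) by rewrite ofac_rep.
have Wv : W_of (fsval F) v by apply/W_ofP => //; exact: rep_inCbar.
have -> : elem o (T ((d_ G)^-1 * w)%g * h) (wofacet f (rep_ofacet F)) =
    (T ((d_ G)^-1 * w)%g * h) *~ eps (fsval F) v.
  rewrite elemE; congr (_ *~ _); rewrite -ofac_rep (eps_osgn vo) osgnC /o.
  by rewrite -(osgn_wofacet f _ (wofacet v _)) -wofacetM /v mulVKg.
rewrite mulrzAr mulrA tensMzr (hecke_Omega_mul P TH)//; last exact: (OmegaV P).
have -> : (((d_ G)^-1 * f)^-1 * ((d_ G)^-1 * w) = v)%g by rewrite invgM invgK -mulgA mulVKg.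
have Wv' : W_of (ofac (rep_ofacet F)) v by rewrite ofac_rep.
have := j_of_T TH 1 Wv'; rewrite !scale1r ofac_rep => jv.
have := H_of_T TH 1 Wv'; rewrite scale1r ofac_rep => vH.
have <- := tensS (fun m s => m * j_of T (fsval F) s) (fun s z => s * z) (T f) h vH.
rewrite /= jv mulrzAr tensMzl -mulrzA.
have -> : eps (fsval F) v * eps (fsval F) v = 1 by rewrite /eps; case: ifP.
rewrite mulr1z; congr (tens _ _ _ _ _).
(* In T_f T_v, the length zero factor T_(d_G^-1 f) absorbs T_v into T_(d_G^-1 w), which
   [hecke_mul_d] recombines with T_(d_G). *)
have fE : T f = T (d_ G) * T ((d_ G)^-1 * f)%g by rewrite (hecke_mul_Omega P TH)// mulVKg.
rewrite fE -mulrA (hecke_Omega_mul P TH)// -mulgA mulVKg -oG hecke_mul_d//.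
by rewrite oG Gw wfacetK; exact: rep_inCbar.
Qed.

Lemma theta_star_out F F' z h : F' <> F -> theta (star TH z (elemF F h)) F' = 0.
Proof.
move=> FF'; have t0 : theta 0 F' = 0.
  by apply: fsbig1 => G GF'; apply: theta_term0 => // o; rewrite chain_val0 eqxx.
move: z; apply: (hecke_ext TH) => [z z'|z z'|k w]; first by rewrite starDl thetaD.
  by rewrite addr0.
by rewrite starZl -star_ract -elemZ star_T_elem theta_elem_out.
Qed.

Lemma theta_psi_at F t : theta (psi_at F t) F = t.
Proof.
move: t; apply: tensor_ext => // [x y|z h]; first by rewrite psi_atD thetaD.
by rewrite psi_atE theta_star.
Qed.

Lemma theta_psi_at_out F F' t : F' <> F -> theta (psi_at F t) F' = 0.
Proof.
move=> FF'; move: t; apply: tensor_ext => [x y|x y|z h].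
- by rewrite psi_atD thetaD.
- by rewrite addr0.
- by rewrite psi_atE theta_star_out.
Qed.

Lemma theta0 : theta 0 = 0.
Proof. exact: morphD_0 thetaD. Qed.

Lemma thetaK : cancel psi theta.
Proof.
move=> t; apply: functional_extensionality_dep => F.
rewrite /psi (big_morph theta thetaD theta0).
have -> : (\sum_F' theta (psi_at F' (t F'))) F = \sum_F' theta (psi_at F' (t F')) F.
  by apply: (big_morph (fun s : twisted_sum T Fs => s F)).
rewrite (bigD1 F)//= theta_psi_at big1 ?addr0// => F' F'F.
by apply: theta_psi_at_out; apply/eqP; rewrite eq_sym.
Qed.

(** Surjectivity of [psi] in the form of an induction principle: on G = f F with f its frame, the
    unit T_(d_G^-1 f) can be inverted, so every value on G comes from some T_f (x) h. *)
Lemma chain_gen (Q : chain P H i -> Prop) :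
  Q 0 -> (forall c c', Q c -> Q c' -> Q (c + c')) ->
  (forall F z h, Q (star TH z (elemF F h))) -> forall c, Q c.
Proof.
move=> Q0 QD QS c; apply: chain_ind => // o _; move: (c o) => h.
have /asboolP[oi _] := ofacetP o; have [F [w ow]] := rep_exists oi.
have [oE oO] := frameP ow; set f := frame F (ofac o) in oE oO.
have e : ofac (wofacet f (rep_ofacet F)) = ofac o by rewrite /= ofac_rep -oE.
rewrite (elem_osgn _ e); set h' := h *~ _.
suff -> : elem (wofacet f (rep_ofacet F)) h' =
    star TH (T f) (elemF F (T ((d_ (ofac o))^-1 * f)^-1%g * h')) by [].
rewrite star_T_elem ofac_rep -oE mulrA (hecke_mul_Omega P TH); last exact: (OmegaV P).
by rewrite mulgV hecke_T1// mul1r.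
Qed.

Lemma psi0 : psi 0 = 0.
Proof. exact: morphD_0 psiD. Qed.

Lemma psi_at_theta F z h : psi (theta (star TH z (elemF F h))) = star TH z (elemF F h).
Proof.
rewrite /psi (bigD1 F)//= theta_star psi_atE big1 ?addr0// => F' /eqP F'F.
by rewrite theta_star_out// psi_at0.
Qed.

Lemma psiK : cancel theta psi.
Proof.
move=> c; elim/chain_gen: c => [|c c' ec ec'|F z h]; first by rewrite theta0 psi0.
  by rewrite thetaD psiD ec ec'.
exact: psi_at_theta.
Qed.

(** * The left action on chains *)

Lemma twisted_lactD F h : {morph @twisted_lact K n D P R H T (fsval F) h : s t / s + t}.
Proof.
by apply: tensor_mapD => // [x y|x s _]; [exact: mulrDr|exact: mulrA].
Qed.

Lemma twisted_lactE F h z k : twisted_lact h (tensF F z k) = tensF F (h * z) k.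
Proof.
by apply: tensor_mapE => // [x y|x s _]; [exact: mulrDr|exact: mulrA].
Qed.

Lemma twisted_ractD F h : {morph @twisted_ract K n D P R H T (fsval F) ^~ h : s t / s + t}.
Proof.
by apply: tensor_mapD => // [x y|s x _]; [exact: mulrDl|rewrite mulrA].
Qed.

Lemma twisted_ractE F h z k : twisted_ract (tensF F z k) h = tensF F z (k * h).
Proof.
by apply: tensor_mapE => // [x y|s x _]; [exact: mulrDl|rewrite mulrA].
Qed.

Definition lact h c : chain P H i := psi (twisted_sum_lact h (theta c)).

Lemma sum_lactD h : {morph @twisted_sum_lact K n D P R H T Fs h : s t / s + t}.
Proof. by move=> s t; apply: functional_extensionality_dep => F; exact: twisted_lactD. Qed.

Lemma psi_ract t h : psi (twisted_sum_ract t h) = chain_ract (psi t) h.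
Proof.
have ract0 : chain_ract (0 : chain P H i) h = 0 by apply: chain_ext => o /=; rewrite mul0r.
have ractD : {morph chain_ract (P := P) (i := i) ^~ h : c c' / c + c'}.
  by move=> c c'; apply: chain_ext => o; rewrite chain_valD /= mulrDl.
rewrite /psi (big_morph _ ractD ract0); apply: eq_bigr => F _.
rewrite /twisted_sum_ract; move: (t F); apply: tensor_ext => [x y|x y|z k].
- by rewrite twisted_ractD psi_atD.
- by rewrite psi_atD ractD.
- by rewrite twisted_ractE !psi_atE elem_ract star_ract.
Qed.

Lemma theta_ract c h : theta (chain_ract c h) = twisted_sum_ract (theta c) h.
Proof. by apply: (can_inj thetaK); rewrite psiK psi_ract psiK. Qed.

(** [psi] intertwines the right actions ([psi_ract]) and [lact] is transported along it, so the
    axioms involving [lact] reduce to pure tensors. *)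
Lemma lact_bimodule : bimodule lact (chain_ract (i := i)).
Proof.
have ext (f g : forall F, twisted_tensor T (fsval F) -> twisted_tensor T (fsval F)) c :
    (forall F, f F =1 g F) ->
    psi (fun F => f F (theta c F)) = psi (fun F => g F (theta c F)).
  by move=> fg; congr psi; apply: functional_extensionality_dep => F; exact: fg.
split.
- move=> h k c; rewrite /lact -psiD.
  apply: (ext (fun F => twisted_lact (h + k)) (fun F t => twisted_lact h t + twisted_lact k t)) => F.
  apply: tensor_ext => [x y|x y|z l]; first exact: twisted_lactD.
    by rewrite !twisted_lactD addrACA.
  by rewrite !twisted_lactE mulrDl tensDl.
- by move=> h c c'; rewrite /lact thetaD sum_lactD psiD.
- move=> c; rewrite -[RHS]psiK; apply: (ext (fun F => twisted_lact 1) (fun F => id)) => F.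
  by apply: tensor_ext => [x y|//|z l]; [exact: twisted_lactD|rewrite twisted_lactE mul1r].
- move=> h k c; rewrite /lact thetaK.
  apply: (ext (fun F => twisted_lact (h * k)) (fun F t => twisted_lact h (twisted_lact k t))) => F.
  apply: tensor_ext => [x y|x y|z l]; [exact: twisted_lactD|by rewrite !twisted_lactD|].
  by rewrite !twisted_lactE mulrA.
- by move=> c c' h; apply: chain_ext => o /=; rewrite mulrDl.
- by move=> c h k; apply: chain_ext => o /=; rewrite mulrDr.
- by move=> c; apply: chain_ext => o /=; rewrite mulr1.
- by move=> c h k; apply: chain_ext => o /=; rewrite mulrA.
- move=> h c k; rewrite /lact -psi_ract theta_ract.
  apply: (ext (fun F t => twisted_ract (twisted_lact h t) k) (fun F t => twisted_lact h (twisted_ract t k))) => F.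
  apply: tensor_ext => [x y|x y|z l].
  + by rewrite twisted_lactD twisted_ractD.
  + by rewrite twisted_ractD twisted_lactD.
  + by rewrite !twisted_lactE !twisted_ractE twisted_lactE.
Qed.

Lemma theta_bij : bijective theta.
Proof. by exists psi; [exact: psiK|exact: thetaK]. Qed.

Lemma theta_lact h c : theta (lact h c) = twisted_sum_lact h (theta c).
Proof. exact: thetaK. Qed.

Lemma lactD h : {morph lact h : c c' / c + c'}.
Proof. exact: bimod_lDr lact_bimodule h. Qed.

Lemma lact0 h : lact h 0 = 0.
Proof. exact: morphD_0 (lactD h). Qed.

Lemma lact_star_rep F h z k : lact h (star TH z (elemF F k)) = star TH (h * z) (elemF F k).
Proof.
have l0 F' : twisted_lact h (0 : twisted_tensor T (fsval F')) = 0.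
  exact: morphD_0 (@twisted_lactD F' h).
rewrite /lact /psi (bigD1 F)//= /twisted_sum_lact theta_star twisted_lactE psi_atE.
rewrite big1 ?addr0// => F' /eqP F'F.
by rewrite theta_star_out// l0 psi_at0.
Qed.

(** A facet of the closure of C is the translate of its representative by some x in Omega, and T_x
    is a unit, so [star_mul_Omega_elem] brings the chain back to the representative. This covers the
    faces of representatives, which need not be representatives themselves. *)
Lemma lact_star h z c : supported_in_Cbar c -> lact h (star TH z c) = star TH (h * z) c.
Proof.
move=> cC; have s0 y : star TH y (0 : chain P H i) = 0.
  by apply: (morphD_0 (f := star TH y)) => c1 c2; exact: starDr.
apply: (chain_ind (Q := fun c => lact h (star TH z c) = star TH (h * z) c)).
- by rewrite !s0 lact0.
- by move=> c1 c2 e1 e2; rewrite !starDr lactD e1 e2.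
move=> o /cC oC; move: (c o) => k.
have /asboolP[oi _] := ofacetP o; have [F [w ow]] := rep_exists oi.
have [x xO xF] := facet_Omega_Cbar (rep_inCbar F) oC (esym ow).
have e : ofac (wofacet x (rep_ofacet F)) = ofac o by rewrite /= ofac_rep.
rewrite (elem_osgn _ e); set k' := k *~ _.
have -> : k' = T x * (T x^-1%g * k').
  by rewrite mulrA (hecke_Omega_mulV P TH)// mul1r.
by rewrite -!(star_mul_Omega_elem TH)// lact_star_rep mulrA.
Qed.

End Bimodule.

Theorem proposition2p18
    (R : comNzRingType) (R_noetherian : noetherian R)
    (n : nat) (D : root_system n)
    (H : algType {poly {poly R}}) (T : extW D -> H) (T_hecke : generic_hecke T)
    (K : realType) (P : apartment K D)
    (Fs : nat -> {fset facet P}) (Fs_reps : forall i, orbit_reps i (Fs i)) :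
  exists lact : forall i, H -> chain P H i -> chain P H i,
    [/\ forall i, bimodule (lact i) (chain_ract (i := i)),
        forall i, exists theta : chain P H i -> twisted_sum T (Fs i),
          [/\ bijective theta, {morph theta : x y / x + y} &
              biequivariant (lact i) (chain_ract (i := i))
                (twisted_sum_lact (T := T) (Fs := Fs i))
                (twisted_sum_ract (T := T) (Fs := Fs i)) theta],
        forall i, biequivariant (lact i.+1) (chain_ract (i := i.+1))
          (lact i) (chain_ract (i := i)) (boundary T (i := i)) &
        biequivariant (lact 0%N) (chain_ract (i := 0%N)) *%R *%R (augmentation T)].
Proof.
exists (fun i => lact T_hecke (Fs_reps i)); split=> [i|i|i|].
- exact: lact_bimodule.
- exists (theta T (Fs_reps i)); split; [exact: theta_bij|exact: thetaD|].
  by split=> [h c|c h]; [exact: theta_lact|exact: theta_ract].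
- split=> [h c|c h]; last exact: boundary_ract.
  (* On the generators z . [F, c, k] both sides become [star] of h z on the untransported boundary
     of the elementary chain, which is again supported on the closure of C. *)
  move: c; apply: (chain_gen (T_hecke := T_hecke) (Fs_reps := Fs_reps i.+1)) => [|c c' ec ec'|F z k].
  + by rewrite lact0 !(morphD_0 (boundaryD T (i := i))) lact0.
  + by rewrite lactD !boundaryD lactD ec ec'.
  rewrite lact_star_rep; have eC := supported_elem (h := k) (rep_ofacet_inCbar (Fs_reps := Fs_reps i.+1) (F := F)).
  rewrite !boundary_star// lact_star//; exact: supported_boundary.
split=> [h c|c h]; last exact: augmentation_ract.
move: c; apply: (chain_gen (T_hecke := T_hecke) (Fs_reps := Fs_reps 0%N)) => [|c c' ec ec'|F z k].
+ by rewrite lact0 (morphD_0 (augmentationD T)) mulr0.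
+ by rewrite lactD !augmentationD ec ec' mulrDr.
rewrite lact_star_rep; have eC := supported_elem (h := k) (rep_ofacet_inCbar (Fs_reps := Fs_reps 0%N) (F := F)).
by rewrite !augmentation_star// mulrA.
Qed.
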